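(* Consider the periodic initial boundary value problem $$u_{xt}+uu_{xx}-\lambda u_x^2=I(t),\quad u(x,0)=u_0(x),\quad I(t)=-(\lambda+1)\int_0^1u_x^2\,dx,\quad u(0,t)=u(1,t),\ u_x(0,t)=u_x(1,t),$$ for $x\in[0,1]$, $t>0$. If $\lambda>0$, suppose there is $C_1<0$ with $u_0'(\alpha)\sim M_0+C_1|\alpha-\overline\alpha_i|$ near every $\overline\alpha_i$; if $\lambda<0$, suppose there is $C_2>0$ with $u_0'(\alpha)\sim m_0+C_2|\alpha-\underline\alpha_j|$ near every $\underline\alpha_j$. For $\lambda\in\mathbb{R}\setminus[0,1/2]$, let $t_*>0$ denote the finite time at which $\|u_x\|_\infty$ blows up. Then: 1. For $\lambda>1/2$ and $p>1$, $\lim_{t\uparrow t_*}\|u_x\|_p=+\infty$. 2. For $\lambda<0$ and $t\in[0,t_*]$, $u_x$ remains integrable; moreover, if $\frac{1}{1-p}<\lambda<0$ and $p>1$, then $u_x\in L^p$ for all $t\in[0,t_*]$. 3. The energy $E(t)=\|u_x\|_2^2$ diverges as $t\uparrow t_*$ if $\lambda\in(-\infty,-1]\cup(1/2,+\infty)$ but remains finite for $t\in[0,t_*]$ if $\lambda\in(-1,0)$. Also, $\lim_{t\uparrow t_*}\dot E(t)=+\infty$ when $\lambda\in(-\infty,-1/2)\cup(1/2,+\infty)$, whereas $\dot E(t)\equiv0$ if $\lambda=-1/2$, while $\dot E(t)$ stays bounded for $t\in[0,t_*]$ if $\lambda\in(-1/2,0)$.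
   Context: Standing assumptions on the data: $u_0$ is periodic, $u_0'$ is bounded and at least continuous a.e. on $(0,1)$ (so $\int_0^1u_0'=0$); $M_0>0>m_0$ are the greatest and least values of $u_0'$, attained at finitely many points $\overline\alpha_i$ and $\underline\alpha_j$ of $[0,1]$ respectively (and $u_0'$ is bounded away from these values off any neighbourhood of these points). Neighbourhoods are periodic. $u_0'(\alpha)\sim M_0+C_1|\alpha-\overline\alpha_i|^q$ near $\overline\alpha_i$ means $M_0-u_0'(\alpha)$ is asymptotically equivalent (ratio $\to1$) to $|C_1||\alpha-\overline\alpha_i|^q$ as $\alpha\to\overline\alpha_i$; similarly $u_0'(\alpha)\sim m_0+C_2|\alpha-\underline\alpha_j|^q$ means $u_0'(\alpha)-m_0$ is asymptotically equivalent to $C_2|\alpha-\underline\alpha_j|^q$. Solutions are understood along characteristics $\gamma$, $\dot\gamma(\alpha,t)=u(\gamma(\alpha,t),t)$, $\gamma(\alpha,0)=\alpha$. For $\lambda\ne0$ put $\mathcal{J}(\alpha,t)=1-\lambda\eta(t)u_0'(\alpha)$, $\bar{\mathcal{K}}_i(t)=\int_0^1\mathcal{J}(\alpha,t)^{-i-1/\lambda}d\alpha$, where $\dot\eta=\bar{\mathcal{K}}_0^{-2\lambda}$, $\eta(0)=0$. The solution is given by $$\gamma_\alpha=\frac{\mathcal{J}(\alpha,t)^{-1/\lambda}}{\bar{\mathcal{K}}_0(t)},\qquad u_x(\gamma(\alpha,t),t)=\frac{1}{\lambda\eta(t)\bar{\mathcal{K}}_0(t)^{2\lambda}}\left(\frac{1}{\mathcal{J}(\alpha,t)}-\frac{\bar{\mathcal{K}}_1(t)}{\bar{\mathcal{K}}_0(t)}\right)$$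 (with value $u_0'(\alpha)$ at $t=0$) as long as $\eta(t)<\eta_*$, where $\eta_*=\frac1{\lambda M_0}$ if $\lambda>0$ and $\eta_*=\frac1{\lambda m_0}$ if $\lambda<0$. It is defined for $t\in[0,t_* )$ with $$t_*=\lim_{\eta\uparrow\eta_*}\int_0^\eta\left(\int_0^1(1-\lambda\mu u_0'(\alpha))^{-1/\lambda}d\alpha\right)^{2\lambda}d\mu,$$ which is finite for the data and the values $\lambda\in\mathbb{R}\setminus[0,1/2]$ considered, and is the $L^\infty$ blow-up time of $u_x$. $\|\cdot\|_p$ is the norm of $L^p(0,1)$ in $x$, so $\|u_x(\cdot,t)\|_p^p=\int_0^1|u_x(\gamma(\alpha,t),t)|^p\gamma_\alpha(\alpha,t)\,d\alpha$. Statements that $u_x$ is in $L^p$ (integrable if $p=1$), or that a quantity is finite, ''for all $t\in[0,t_*]$'' include that the corresponding limit as $t\uparrow t_*$ is finite. $\dot E$ is the time derivative of $E$. *)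

(* Defs.v *)
From HB Require Import structures.
From mathcomp Require Import all_boot all_order all_algebra.
From mathcomp Require Import all_classical all_reals all_analysis.

Set Implicit Arguments.
Unset Strict Implicit.
Unset Printing Implicit Defensive.

Import Order.TTheory GRing.Theory Num.Theory.
Import numFieldNormedType.Exports.

Local Open Scope classical_set_scope.
Local Open Scope ring_scope.

(* All data and solutions are extended 1-periodically in space from [0, 1] to
   the real line, so that characteristics may leave [0, 1].  A function of
   space and time is curried in this order: [u x t], [gamma a t]. *)

Section general_notions.
Variable R : realType.
Local Notation mu := (@lebesgue_measure R).

(* [f] is locally absolutely continuous with (almost everywhere defined)
   derivative represented by [f']. *)
Definition density (f f' : R -> R) : Prop :=
  forall a b : R, a <= b ->
    mu.-integrable `[a, b] (EFin \o f') /\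
    f b - f a = \int[mu]_(x in `[a, b]) f' x.

(* Derivative relative to the time axis [0, +oo[ : the usual derivative for
   0 < t, the right derivative at t = 0. *)
Definition time_derivative (f : R -> R) (t l : R) : Prop :=
  (f s - f t) / (s - t) @[s --> within [set s | 0 <= s] t^'] --> l.

Definition converges_to_finite (f : R -> \bar R) (t : R) : Prop :=
  exists l : R, f s @[s --> t^'-] --> l%:E.

End general_notions.

Section data.
Variable R : realType.
Local Notation mu := (@lebesgue_measure R).

Definition level_points (du0 : R -> R) (c : R) : set R :=
  [set a | a \in `[0, 1] /\ du0 a = c].

(* [du0] is u_0'.  Because of the periodicity, [level_points du0 M0] contains 0
   iff it contains 1, hence neighbourhoods of its points within [0, 1] are
   automatically periodic neighbourhoods. *)
Record admissible_data (u0 du0 : R -> R) (M0 m0 : R) : Prop := {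
  data_u0_periodic : periodic u0 1;
  data_du0_periodic : periodic du0 1;
  data_density : density u0 du0;
  data_ae_continuous :
    {ae mu, forall x : R, x \in `]0, 1[ -> {for x, continuous du0}};
  data_sign : m0 < 0 < M0;
  data_bounds : forall a : R, m0 <= du0 a <= M0;
  data_max_attained : level_points du0 M0 !=set0;
  data_max_finite : finite_set (level_points du0 M0);
  data_max_separated : forall e : R, 0 < e -> exists2 d : R, 0 < d &
    forall a : R, a \in `[0, 1] ->
      (forall b : R, level_points du0 M0 b -> e <= `|a - b|) ->
      du0 a <= M0 - d;
  data_min_attained : level_points du0 m0 !=set0;
  data_min_finite : finite_set (level_points du0 m0);
  data_min_separated : forall e : R, 0 < e -> exists2 d : R, 0 < d &
    forall a : R, a \in `[0, 1] ->
      (forall b : R, level_points du0 m0 b -> e <= `|a - b|) ->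
      m0 + d <= du0 a
}.

(* u_0'(a) ~ M_0 + C_1 |a - b| near every b where the maximum is attained. *)
Definition linear_max_profile (du0 : R -> R) (M0 C1 : R) : Prop :=
  forall b : R, level_points du0 M0 b ->
    (M0 - du0 a) / (`|C1| * `|a - b|) @[a --> b^'] --> (1 : R).

(* u_0'(a) ~ m_0 + C_2 |a - b| near every b where the minimum is attained. *)
Definition linear_min_profile (du0 : R -> R) (m0 C2 : R) : Prop :=
  forall b : R, level_points du0 m0 b ->
    (du0 a - m0) / (C2 * `|a - b|) @[a --> b^'] --> (1 : R).

End data.

Section solutions.
Variable R : realType.
Local Notation mu := (@lebesgue_measure R).
Variables (lambda : R) (du0 : R -> R).

(* J and Kbar_i depend on time only through [s = eta t]. *)
Definition J (a s : R) : R := 1 - lambda * s * du0 a.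

Definition Kbar (i : nat) (s : R) : R :=
  \int[mu]_(a in `[0, 1]) (J a s `^ (- i%:R - lambda^-1)).

Definition eta_star (M0 m0 : R) : R :=
  if 0 < lambda then (lambda * M0)^-1 else (lambda * m0)^-1.

Definition is_blowup_time (M0 m0 tstar : R) : Prop :=
  \int[mu]_(s in `[0, e]) (Kbar 0 s `^ (2 * lambda))
    @[e --> (eta_star M0 m0)^'-] --> tstar.

(* The nonlocal term I(t). *)
Definition nonlocal (ux : R -> R -> R) (t : R) : R :=
  - (lambda + 1) * \int[mu]_(x in `[0, 1]) (ux x t ^+ 2).

(* A solution of the periodic problem on [0, tstar[, understood along its
   characteristics: since
     d/dt (u_x (gamma (a, t), t)) = (u_xt + u u_xx) (gamma (a, t), t),
   the evolution equation becomes [sol_equation]. *)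
Record characteristic_solution (u0 : R -> R) (M0 m0 tstar : R)
    (u ux gamma : R -> R -> R) (eta : R -> R) : Prop := {
  sol_periodic : forall t : R, 0 <= t < tstar ->
    [/\ periodic (u^~ t) 1, periodic (ux^~ t) 1 &
        forall a : R, gamma (a + 1) t = gamma a t + 1];
  sol_density : forall t : R, 0 <= t < tstar -> density (u^~ t) (ux^~ t);
  sol_initial : forall x : R, u x 0 = u0 x /\ ux x 0 = du0 x;
  sol_gamma0 : forall a : R, gamma a 0 = a;
  sol_flow : forall a t : R, 0 <= t < tstar ->
    time_derivative (gamma a) t (u (gamma a t) t);
  sol_equation : forall a t : R, 0 <= t < tstar ->
    time_derivative (fun s => ux (gamma a s) s) t
      (lambda * ux (gamma a t) t ^+ 2 + nonlocal ux t);
  sol_eta0 : eta 0 = 0;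
  sol_eta_range : forall t : R, 0 <= t < tstar ->
    0 <= eta t < eta_star M0 m0;
  sol_eta_ode : forall t : R, 0 <= t < tstar ->
    time_derivative eta t (Kbar 0 (eta t) `^ (- (2 * lambda)));
  sol_gamma_formula : forall t : R, 0 <= t < tstar ->
    density (gamma^~ t)
      (fun a => J a (eta t) `^ (- lambda^-1) / Kbar 0 (eta t));
  sol_ux_formula : forall a t : R, 0 < t < tstar ->
    ux (gamma a t) t =
      (lambda * eta t * Kbar 0 (eta t) `^ (2 * lambda))^-1 *
      ((J a (eta t))^-1 - Kbar 1 (eta t) / Kbar 0 (eta t))
}.

End solutions.

Section norms.
Variable R : realType.
Local Notation mu := (@lebesgue_measure R).

Definition slice (v : R -> R -> R) (t : R) : R -> R := (v^~ t) \_ `[0, 1].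

Definition Lp_norm (p : R) (v : R -> R -> R) (t : R) : \bar R :=
  'N[mu]_(p%:E)[EFin \o slice v t]%E.

(* [v] is in L^p(0, 1) at every time of [0, tstar]; at the final time this
   means that the norm has a finite limit. *)
Definition Lp_up_to (p : R) (v : R -> R -> R) (tstar : R) : Prop :=
  (forall t : R, 0 <= t < tstar -> slice v t \in Lfun mu p%:E) /\
  converges_to_finite (Lp_norm p v) tstar.

Definition energy (v : R -> R -> R) (t : R) : \bar R := (Lp_norm 2 v t ^+ 2)%E.

Definition energy_derivative (v : R -> R -> R) (tstar : R) (dE : R -> R) :
    Prop :=
  forall t : R, 0 <= t < tstar ->
    energy v t \is a fin_num /\
    time_derivative (fun s => fine (energy v s)) t (dE t).

End norms.

(* Main.v *)
Require Import Defs.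
From HB Require Import structures.
From mathcomp Require Import all_boot all_order all_algebra.
From mathcomp Require Import all_classical all_reals all_analysis.
From mathcomp Require Import measurable_realfun ring lra.

Set Implicit Arguments.
Unset Strict Implicit.
Unset Printing Implicit Defensive.

Import Order.TTheory GRing.Theory Num.Theory.
Import numFieldNormedType.Exports.

Local Open Scope classical_set_scope.
Local Open Scope ring_scope.

(** Along characteristics the solution is explicit, so every quantity of the
    theorem is an average over [a] in [0, 1] of powers of
    [J a s = 1 - lambda * s * du0 a], where [s = eta t].  For [s > 0] one has
    [J a s = `|lambda| * s * (e + g a)], where [g >= 0] is the distance of [du0]
    to its maximum (if [lambda > 0]) or minimum (if [lambda < 0]), and
    [e = excess s] decreases to 0 as [s] increases to [eta_star].  The factor
    [`|lambda| * s] cancels from the gradient and from the Jacobian of the flow,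
    and everything reduces to the behaviour, as [e] tends to 0, of
    [I i e = \int (e + g) ^ (- i - 1 / lambda)] ([shift_moment]), where [g]
    vanishes linearly at finitely many points.

    Singular integrals.  Comparing [g] with [c * `|a - z|] on each side of each
    zero gives, for all [b > 1] and one and the same [L > 0],
    [e ^ (b - 1) \int (e + g) ^ (- b) --> L / (b - 1)] ([blowup_constant_gt0]).
    For [b = 1] the integral diverges ([integral_inv_shift_cvgy]), and for
    [b < 1] the power [g ^ (- b)] is integrable ([integrable_powRN]).

    The case [lambda > 1 / 2].  Let [X = (e + g)^-1] under the probability density
    proportional to [(e + g) ^ (- 1 / lambda)].  On the characteristics, [ux] is
    [I 0 e ^ (- 2 lambda) (X - E X)] up to sign.  Since [X] and [E X] lie in
    [0, 1 / e], the mean deviation is at least [e] times the variance, and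
    [`|y| ^ p >= `|y| - 1] makes this a lower bound for all the norms
    ([gradient_moment_lower]).  The asymptotics of the [I i] show that this bound
    diverges ([deviation_lower_cvgy]), as does the third central moment of [X]
    ([third_moment_cvgy]).  Both facts use that [I 0] grows slowly enough
    ([shift_moment0_le]) and that the rescaled central moments have positive
    limits; the hypothesis enters through [1 / lambda < 2].

    The case [lambda < 0].  Dominated convergence gives finite limits as long as
    the exponents stay below 1: [p + 1 / lambda < 1] for the norm in [L^p]
    ([deviation_power_cvg]), [3 + 1 / lambda < 1] for the third central moment
    ([weak_third_moment_cvg]).  Otherwise the second, respectively third, moment
    of [X] diverges while the mean stays bounded, which forces the variance
    ([variance_cvgy]), respectively the third central moment
    ([weak_third_moment_cvgy]), to diverge.

    Energy.  In terms of central moments of [du0 / J], the energy is a power of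
    [moment 0] times the variance, and differentiation gives
    [1 + 2 lambda] times a power of [moment 0] times the third central moment
    ([is_derive_flow_energy], [energy_derivativeE]).  This explains the role of
    [lambda = - 1 / 2].

    Back to space and time.  The norms in [x] become integrals in [a] because the
    measure of density [gamma_a] is mapped by [gamma] to Lebesgue measure
    ([ge0_integral_periodic_substitution]).  The time elapsed until [eta] reaches
    the value [e] is [\int_0^e Kbar 0 ^ (2 lambda)], whence [eta t] tends to
    [eta_star] as [t] tends to [tstar] ([eta_cvg]). *)

(** * Integrals and powers on segments *)

Section real_integrable.
Context d (T : measurableType d) (R : realType) (m : {measure set T -> \bar R}).
Variables (D : set T) (mD : measurable D).
Implicit Types f h : T -> R.

Lemma integrable_addr f h :
  m.-integrable D (EFin \o f) -> m.-integrable D (EFin \o h) ->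
  m.-integrable D (EFin \o (fun a => f a + h a)).
Proof. by move=> fi hi; apply: eq_integrable (integrableD mD fi hi). Qed.

Lemma integrable_subr f h :
  m.-integrable D (EFin \o f) -> m.-integrable D (EFin \o h) ->
  m.-integrable D (EFin \o (fun a => f a - h a)).
Proof. by move=> fi hi; apply: eq_integrable (integrableB mD fi hi). Qed.

Lemma integrable_mulrl k f :
  m.-integrable D (EFin \o f) -> m.-integrable D (EFin \o (fun a => k * f a)).
Proof. by move=> fi; apply: eq_integrable (integrableZl mD k fi). Qed.

End real_integrable.

Section interval_integrals.
Variable R : realType.
Local Notation mu := (@lebesgue_measure R).
Implicit Types (f g : R -> R) (x y z : R).

Lemma lebesgue_itvcc x y : x <= y -> mu `[x, y] = (y - x)%:E.
Proof.
rewrite le_eqVlt => /predU1P[->|xy]; first by rewrite set_itv1 lebesgue_measure_set1 subrr.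
by rewrite lebesgue_measure_itv/= lte_fin xy EFinB.
Qed.

Lemma bounded_integrable_itv f x y C :
  measurable_fun `[x, y] f -> (forall a, a \in `[x, y] -> `|f a| <= C) ->
  mu.-integrable `[x, y] (EFin \o f).
Proof.
move=> mf fC; apply: measurable_bounded_integrable => //.
  have [xy|yx] := leP x y; first by rewrite [ltLHS]lebesgue_itvcc// ltry.
  by rewrite set_itv_ge ?measure0// -leNgt bnd_simp.
exists C; split; first exact: num_real.
by move=> D CD a /= axy; apply: le_trans (ltW CD); apply: fC.
Qed.

Lemma integrable_cst_itv (k x y : R) : mu.-integrable `[x, y] (EFin \o (fun=> k)).
Proof. by apply: (@bounded_integrable_itv _ _ _ `|k|) => //; exact: measurable_cst. Qed.

Lemma Rintegral_itv_cat f x y z : x <= y -> y <= z ->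
  mu.-integrable `[x, z] (EFin \o f) ->
  \int[mu]_(a in `[x, z]) f a =
  \int[mu]_(a in `[x, y]) f a + \int[mu]_(a in `[y, z]) f a.
Proof.
move=> xy yz fi; apply/eqP; rewrite addrC -subr_eq; apply/eqP.
rewrite Rintegral_itvB ?bnd_simp//.
rewrite Rintegral_itv_obnd_cbnd//.
apply: integrableS fi => //; apply: subset_itvr; by rewrite bnd_simp.
Qed.

(** A property of intervals that is inherited by concatenation holds on a
    segment as soon as it holds on the short intervals starting or ending at
    each point: the supremum of the endpoints reached from the left end cannot
    be interior. *)
Lemma segment_induction (P : R -> R -> Prop) (u v : R) :
  (forall x y z, u <= x -> x <= y -> y <= z -> z <= v -> P x y -> P y z -> P x z) ->
  (forall z, u <= z <= v -> exists2 r, 0 < r &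
     (forall x, u <= x -> z - r < x <= z -> P x z) /\
     (forall y, y <= v -> z <= y < z + r -> P z y)) ->
  forall x y, u <= x -> x <= y -> y <= v -> P x y.
Proof.
move=> Pcat Ploc x Y ux xY Yv.
pose S := [set y | x <= y <= Y /\ P x y].
have Sx : S x.
  split; first by rewrite lexx xY.
  have [|r r0 [_ h]] := Ploc x; first by rewrite ux (le_trans xY).
  by apply: h; [exact: le_trans Yv|rewrite lexx ltrDl].
have Sub : has_ubound S by exists Y => y [/andP[_ ?] _].
have hS : has_sup S by split => //; exists x.
pose z := sup S.
have xz : x <= z by exact: ub_le_sup.
have zY : z <= Y by apply: ge_sup; [exists x|move=> y [/andP[_ ?] _]].
have [|r r0 [hl hr]] := Ploc z.
  by rewrite (le_trans ux)// (le_trans zY).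
have [y [/andP[xy yY] Pxy] zry] := sup_adherent r0 hS.
have yz : y <= z by apply: ub_le_sup => //; split => //; rewrite xy yY.
have Pxz : P x z.
  apply: (Pcat x y z) => //; first exact: le_trans Yv.
  by apply: hl; [exact: le_trans xy|rewrite zry yz].
have PzY y' : z <= y' -> y' <= Y -> y' < z + r -> P x y'.
  move=> zy' y'Y y'r; apply: (Pcat x z y') => //; first exact: le_trans Yv.
  by apply: hr; [exact: le_trans Yv|rewrite zy'].
have [zrY|Yzr] := leP (z + r / 2) Y; last first.
  by apply: PzY => //; apply: lt_trans Yzr _; rewrite ltrD2l; lra.
have : S (z + r / 2).
  split; first by rewrite zrY andbT; lra.
  apply: PzY => //; lra.
move=> /(ub_le_sup Sub); rewrite -/z; lra.
Qed.

End interval_integrals.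

Section power_integrals.
Variable R : realType.
Local Notation mu := (@lebesgue_measure R).
Implicit Types (x y p q b : R).

Lemma ler_powRN b x y : 0 <= b -> 0 < x -> x <= y -> y `^ (- b) <= x `^ (- b).
Proof.
move=> b0 x0 xy; rewrite !powRN lef_pV2 ?posrE ?powR_gt0//; last exact: lt_le_trans xy.
by apply: ge0_ler_powR => //; rewrite nnegrE ltW//; apply: lt_le_trans xy.
Qed.

Lemma gt0_powRD x p q : 0 < x -> x `^ (p + q) = x `^ p * x `^ q.
Proof. by move=> x0; rewrite powRD// (gt_eqF x0) implybT. Qed.

Lemma continuous_powRl b x : 0 < x -> {for x, continuous (fun a : R => a `^ b)}.
Proof.
move=> x0; apply/differentiable_continuous/derivable1_diffP.
by apply: derivable_powR; rewrite in_itv/= x0.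
Qed.

Lemma cvg_powR (T : Type) (F : set_system T) (FF : Filter F) (f : T -> R) b x :
  0 < x -> f t @[t --> F] --> x -> f t `^ b @[t --> F] --> x `^ b.
Proof. by move=> x0 fx; exact: cvg_comp fx (continuous_powRl x0). Qed.

Lemma cvg_powR0 (T : Type) (F : set_system T) (FF : Filter F) (f : T -> R) b :
  0 < b -> (forall t, 0 <= f t) -> f t @[t --> F] --> 0 ->
  f t `^ b @[t --> F] --> 0.
Proof.
move=> b0 f0 fc; apply/cvgrPdist_lt => e e0.
have e1 : 0 < e `^ b^-1 by rewrite powR_gt0.
move/cvgrPdist_lt : fc => /(_ _ e1); apply: filterS => t.
rewrite !sub0r !normrN !ger0_norm ?powR_ge0// => fe.
rewrite -[ltRHS](powRr1 (ltW e0)) -[X in e `^ X](mulVf (lt0r_neq0 b0)) powRrM.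
by apply: gt0_ltr_powR; rewrite ?nnegrE// ltW.
Qed.

(** [x + y] is at most twice the maximum of [x] and [y]. *)
Lemma ler_powRD b x y : 0 <= b -> 0 <= x -> 0 <= y ->
  (x + y) `^ b <= 2 `^ b * (x `^ b + y `^ b).
Proof.
move=> b0 x0 y0; have m0 : 0 <= Num.max x y by rewrite le_max x0.
have xm : x <= Num.max x y by rewrite le_max lexx.
have ym : y <= Num.max x y by rewrite le_max lexx orbT.
apply: (@le_trans _ _ ((2 * Num.max x y) `^ b)).
  by apply: ge0_ler_powR; rewrite ?nnegrE ?addr_ge0 ?mulr_ge0//; lra.
rewrite powRM//; apply: ler_wpM2l; first exact: powR_ge0.
by case: (leP x y) => _; rewrite ?lerDl ?lerDr powR_ge0.
Qed.

Lemma is_derive_powR_affine b p q x : 0 < p + q * x ->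
  is_derive x 1 (fun a => (p + q * a) `^ b) (b * q * (p + q * x) `^ (b - 1)).
Proof.
move=> h.
have h1 : is_derive x 1 (fun a => p + q * a) q.
  by apply: is_derive_eq; rewrite add0r mul1r /GRing.scale/= mulr1.
have := @is_derive1_comp _ (fun a => a `^ b) (fun a => p + q * a) x _ _
  (is_derive1_powR b h) h1.
by move=> H; apply: is_derive_eq; rewrite mulrAC.
Qed.

Lemma continuous_powR_affine b p q x : 0 < p + q * x ->
  {for x, continuous (fun a => (p + q * a) `^ b)}.
Proof.
move=> h; apply/differentiable_continuous/derivable1_diffP.
by have [] := is_derive_powR_affine b h.
Qed.

Lemma affine_gt0 p q x y a : 0 < p + q * x -> 0 < p + q * y -> x <= a <= y ->
  0 < p + q * a.
Proof. by move=> hx hy /andP[xa ay]; have [q0|q0] := leP 0 q; nra. Qed.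

Lemma FTC2_Rintegral (f F : R -> R) x y : x <= y ->
  (forall a, x <= a <= y -> {for a, continuous f}) ->
  (forall a, x <= a <= y -> is_derive a 1 F (f a)) ->
  \int[mu]_(a in `[x, y]) f a = F y - F x.
Proof.
rewrite le_eqVlt => /predU1P[<- _ _|xy fc dF].
  by rewrite set_itv1 Rintegral_set1 subrr.
have Fc a : x <= a <= y -> {for a, continuous F}.
  by move=> axy; apply/differentiable_continuous/derivable1_diffP; have [] := dF a axy.
rewrite /Rintegral (@continuous_FTC2 _ _ F)//.
- by apply/continuous_in_subspaceT => a /[!inE]/=; rewrite in_itv/=; exact: fc.
- split.
  + move=> a; rewrite in_itv/= => /andP[xa ay].
    by have [] := dF a _; rewrite // !ltW.
  + by apply: cvg_at_right_filter; apply: Fc; rewrite lexx ltW.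
  + by apply: cvg_at_left_filter; apply: Fc; rewrite lexx ltW.
- move=> a; rewrite in_itv/= => /andP[xa ay]; rewrite derive1E.
  by have [] := dF a _; rewrite // !ltW.
Qed.

Lemma integral_powR_affine b p q x y : b != 1 -> q != 0 -> x <= y ->
  0 < p + q * x -> 0 < p + q * y ->
  \int[mu]_(a in `[x, y]) (p + q * a) `^ (- b) =
  ((p + q * x) `^ (1 - b) - (p + q * y) `^ (1 - b)) / (q * (b - 1)).
Proof.
move=> b1 q0 xy px py.
have b1' : b - 1 != 0 by rewrite subr_eq0.
pose F a := - (q * (b - 1))^-1 * (p + q * a) `^ (1 - b).
have dF a : x <= a <= y -> is_derive a 1 F ((p + q * a) `^ (- b)).
  move=> axy; have pa := affine_gt0 px py axy.
  have D := is_derive_powR_affine (1 - b) pa.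
  rewrite /F; apply: is_derive_eq.
  rewrite /GRing.scale/= (_ : 1 - b - 1 = - b); last by ring.
  field; by rewrite b1' q0.
have cf a : x <= a <= y -> {for a, continuous (fun a => (p + q * a) `^ (- b))}.
  by move=> axy; apply: continuous_powR_affine; exact: affine_gt0 axy.
rewrite (FTC2_Rintegral xy cf dF) /F; field; by rewrite b1' q0.
Qed.

Lemma integral_inv_affine p q x y : q != 0 -> x <= y ->
  0 < p + q * x -> 0 < p + q * y ->
  \int[mu]_(a in `[x, y]) (p + q * a)^-1 =
  (ln (p + q * y) - ln (p + q * x)) / q.
Proof.
move=> q0 xy px py.
pose F a := q^-1 * ln (p + q * a).
have dF a : 0 < p + q * a -> is_derive a 1 F (p + q * a)^-1.
  move=> pa.
  have h1 : is_derive a 1 (fun a => p + q * a) q.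
    by apply: is_derive_eq; rewrite add0r mul1r /GRing.scale/= mulr1.
  have H := @is_derive1_comp _ (@ln R) (fun a => p + q * a) a _ _
    (is_derive1_ln pa) h1.
  rewrite /F; apply: is_derive_eq.
  rewrite /GRing.scale/=; field; by rewrite q0 gt_eqF.
have dF' a : x <= a <= y -> is_derive a 1 F ((p + q * a)^-1).
  by move=> axy; apply: dF; exact: affine_gt0 axy.
have cf a : x <= a <= y -> {for a, continuous (fun a => (p + q * a)^-1)}.
  move=> axy; have pa := affine_gt0 px py axy.
  apply: cvgV; first by rewrite gt_eqF.
  by apply: cvgD; [exact: cvg_cst|apply: cvgM; [exact: cvg_cst|exact: cvg_id]].
by rewrite (FTC2_Rintegral xy cf dF') /F; field.
Qed.

End power_integrals.

(** * Integrals on one side of a linear zero *)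

Definition linear_zero (R : realType) (g : R -> R) (c z : R) : Prop :=
  g z = 0 /\ (g a / (c * `|a - z|)) @[a --> z^'] --> (1 : R).

(** One-sided neighbourhood of [z]; the two sides are treated uniformly because
    a zero may sit at an endpoint of the interval of integration. *)
Definition side (R : realType) (l : bool) (z r : R) : interval R :=
  if l then `[z - r, z] else `[z, z + r].

Section linear_zeros.
Variable R : realType.
Local Notation mu := (@lebesgue_measure R).
Implicit Types (x y z r rd b d e : R) (l : bool).

Lemma side_dist l z r a : a \in side l z r -> `|a - z| <= r.
Proof.
by case: l; rewrite /side in_itv/= ler_norml => /andP[? ?]; apply/andP; split; lra.
Qed.

Lemma lebesgue_side l z r : 0 <= r -> mu [set` side l z r] = r%:E.
Proof.
move=> r0; case: l; rewrite /side [LHS]lebesgue_itvcc ?gerBl ?lerDl//.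
  by congr EFin; ring.
by congr EFin; ring.
Qed.

Lemma measurable_powRl (f : R -> R) b :
  measurable_fun setT f -> measurable_fun setT (fun a => f a `^ b).
Proof.
move=> mf; apply: (@measurableT_comp _ _ _ _ _ _ (fun x : R => x `^ b)) => //.
Qed.

Lemma measurable_powRN_shift (f : R -> R) e b :
  measurable_fun setT f -> measurable_fun setT (fun a => (e + f a) `^ b).
Proof.
by move=> mf; apply: measurable_powRl; exact: measurable_funD.
Qed.

Lemma integrable_powRN_shift (f : R -> R) e b x y :
  measurable_fun setT f -> (forall a, 0 <= f a) -> 0 < e -> 0 <= b ->
  mu.-integrable `[x, y] (EFin \o (fun a => (e + f a) `^ (- b))).
Proof.
move=> mf f0 e0 b0; apply: (@bounded_integrable_itv _ _ _ _ (e `^ (- b))).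
  by apply: measurable_funTS; exact: measurable_powRN_shift.
move=> a _; rewrite ger0_norm ?powR_ge0//; apply: ler_powRN => //.
by rewrite lerDl.
Qed.

Lemma integrable_side (f : R -> R) e b l z r :
  measurable_fun setT f -> (forall a, 0 <= f a) -> 0 < e -> 0 <= b ->
  mu.-integrable [set` side l z r] (EFin \o (fun a => (e + f a) `^ (- b))).
Proof. by case: l; exact: integrable_powRN_shift. Qed.

Lemma measurable_dist k z : measurable_fun setT (fun a : R => k * `|a - z|).
Proof.
apply: measurable_funM => //; apply: measurableT_comp => //.
by apply: measurable_funB.
Qed.

Lemma integral_side_powR l e k z r b : 0 < e -> 0 < k -> 0 <= r -> b != 1 ->
  \int[mu]_(a in [set` side l z r]) (e + k * `|a - z|) `^ (- b) =
  (e `^ (1 - b) - (e + k * r) `^ (1 - b)) / (k * (b - 1)).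
Proof.
move=> e0 k0 r0 b1; have b1' : b - 1 != 0 by rewrite subr_eq0.
have kr0 : 0 <= k * r by rewrite mulr_ge0// ltW.
case: l; rewrite /side.
  transitivity (\int[mu]_(a in `[z - r, z]) ((e + k * z) + (- k) * a) `^ (- b)).
    apply: eq_Rintegral => a /[!inE]/=; rewrite in_itv/= => /andP[_ az].
    by congr (_ `^ _); rewrite ler0_norm ?subr_le0//; ring.
  rewrite integral_powR_affine//; last 4 first.
  - by rewrite oppr_eq0 gt_eqF.
  - by rewrite gerBl.
  - by rewrite (_ : _ + _ = e + k * r); [lra|ring].
  - by rewrite (_ : _ + _ = e); [lra|ring].
  rewrite (_ : e + k * z + - k * (z - r) = e + k * r); last by ring.
  rewrite (_ : e + k * z + - k * z = e); last by ring.
  by field; rewrite b1' gt_eqF.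
transitivity (\int[mu]_(a in `[z, z + r]) ((e - k * z) + k * a) `^ (- b)).
  apply: eq_Rintegral => a /[!inE]/=; rewrite in_itv/= => /andP[za _].
  by congr (_ `^ _); rewrite ger0_norm ?subr_ge0//; ring.
rewrite integral_powR_affine//; last 4 first.
- by rewrite gt_eqF.
- by rewrite lerDl.
- by rewrite (_ : _ + _ = e); [lra|ring].
- by rewrite (_ : _ + _ = e + k * r); [lra|ring].
rewrite (_ : e - k * z + k * z = e); last by ring.
by rewrite (_ : e - k * z + k * (z + r) = e + k * r); last by ring.
Qed.

Lemma integral_side_inv l e k z r : 0 < e -> 0 < k -> 0 <= r ->
  \int[mu]_(a in [set` side l z r]) (e + k * `|a - z|) `^ (- 1) =
  (ln (e + k * r) - ln e) / k.
Proof.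
move=> e0 k0 r0; have kr0 : 0 <= k * r by rewrite mulr_ge0// ltW.
case: l; rewrite /side.
  transitivity (\int[mu]_(a in `[z - r, z]) ((e + k * z) + (- k) * a)^-1).
    apply: eq_Rintegral => a /[!inE]/=; rewrite in_itv/= => /andP[_ az].
    rewrite ler0_norm ?subr_le0// powR_inv1; last by nra.
    by congr (_^-1); ring.
  rewrite integral_inv_affine//; last 4 first.
  - by rewrite oppr_eq0 gt_eqF.
  - by rewrite gerBl.
  - by rewrite (_ : _ + _ = e + k * r); [lra|ring].
  - by rewrite (_ : _ + _ = e); [lra|ring].
  rewrite (_ : e + k * z + - k * (z - r) = e + k * r); last by ring.
  rewrite (_ : e + k * z + - k * z = e); last by ring.
  by field; rewrite gt_eqF.
transitivity (\int[mu]_(a in `[z, z + r]) ((e - k * z) + k * a)^-1).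
  apply: eq_Rintegral => a /[!inE]/=; rewrite in_itv/= => /andP[za _].
  rewrite ger0_norm ?subr_ge0// powR_inv1; last by nra.
  by congr (_^-1); ring.
rewrite integral_inv_affine//; last 4 first.
- by rewrite gt_eqF.
- by rewrite lerDl.
- by rewrite (_ : _ + _ = e); [lra|ring].
- by rewrite (_ : _ + _ = e + k * r); [lra|ring].
rewrite (_ : e - k * z + k * z = e); last by ring.
by rewrite (_ : e - k * z + k * (z + r) = e + k * r); last by ring.
Qed.

Variables (g : R -> R) (c : R).
Hypotheses (c0 : 0 < c) (mg : measurable_fun setT g) (g0 : forall a, 0 <= g a).

(** The asymptotic equivalence turned into a two-sided estimate, valid also at
    [z] itself because [g z = 0]. *)
Lemma linear_zero_bounds z d : linear_zero g c z -> 0 < d ->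
  exists2 r : R, 0 < r & forall a, `|a - z| < r ->
    (1 - d) * c * `|a - z| <= g a <= (1 + d) * c * `|a - z|.
Proof.
move=> [gz gl] d0.
have : \forall a \near z^', `|1 - g a / (c * `|a - z|)| <= d.
  by move/cvgrPdist_le : gl; apply.
rewrite near_withinE near_nbhs => -[r /= r0 Hr]; exists r => // a azr.
have [->|az] := eqVneq a z; first by rewrite gz subrr normr0 !mulr0 lexx.
have := Hr a; rewrite /= [`|z - a|]distrC => /(_ azr az).
have p0 : 0 < c * `|a - z| by rewrite mulr_gt0// normr_gt0 subr_eq0.
rewrite ler_norml => /andP[h1 h2].
have gE : g a = g a / (c * `|a - z|) * (c * `|a - z|) by rewrite divfK ?gt_eqF.
move: h1 h2 gE; set q := g a / _ => h1 h2 ->.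
by rewrite -2!mulrA !(ler_pM2r p0); apply/andP; split; lra.
Qed.

Section one_side.
Variables (z r0 : R).
Hypothesis r0b : forall a, `|a - z| <= r0 -> 1 / 2 * c * `|a - z| <= g a.

(** Within distance [rd] of [z] the slope of [g] is at least [(1 - d) c]; farther
    away the half slope given by [r0b] bounds the integrand by a constant that
    does not depend on [e].  Only the first contribution can be singular. *)
Lemma integral_side_upper l r rd d e b : 0 < r -> r <= r0 -> 0 < rd -> 0 < d < 1 ->
  (forall a, `|a - z| < rd -> (1 - d) * c * `|a - z| <= g a) ->
  0 < e -> 0 < b ->
  \int[mu]_(a in [set` side l z r]) (e + g a) `^ (- b) <=
  \int[mu]_(a in [set` side l z r]) (e + (1 - d) * c * `|a - z|) `^ (- b)
   + (1 / 2 * c * rd) `^ (- b) * r.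
Proof.
move=> r_gt0 rr0 rd0 /andP[d0 d1] Hd e0 b0.
have dc0 : 0 < (1 - d) * c by rewrite mulr_gt0// subr_gt0.
have i1 : mu.-integrable [set` side l z r]
    (EFin \o (fun a => (e + (1 - d) * c * `|a - z|) `^ (- b))).
  apply: integrable_side => //; last exact: ltW.
    exact: measurable_dist.
  by move=> a; rewrite mulr_ge0// ltW.
have i2 : mu.-integrable [set` side l z r]
    (EFin \o (fun=> (1 / 2 * c * rd) `^ (- b))).
  by case: (l); exact: integrable_cst_itv.
have -> : (1 / 2 * c * rd) `^ (- b) * r =
    \int[mu]_(a in [set` side l z r]) (1 / 2 * c * rd) `^ (- b).
  by rewrite Rintegral_cst// [X in fine X]lebesgue_side// ltW.
rewrite -RintegralD//; apply: le_Rintegral => //.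
- by apply: integrable_side => //; exact: ltW.
- exact: integrable_addr.
- move=> a /= /side_dist ar.
  have [ard|rda] := ltP `|a - z| rd.
    rewrite ler_wpDr ?powR_ge0//; apply: ler_powRN; first exact: ltW.
      by rewrite ltr_wpDr// mulr_ge0// ltW.
    by rewrite lerD2l; exact: Hd.
  rewrite ler_wpDl ?powR_ge0//; apply: ler_powRN; first exact: ltW.
    by rewrite !mulr_gt0.
  have := r0b (le_trans ar rr0); have : c * rd <= c * `|a - z| by rewrite ler_pM2l.
  by lra.
Qed.

(** Beyond distance [rd] nothing is known about [g] from above, but there the
    comparison integrand is at most the subtracted constant. *)
Lemma integral_side_lower l r rd d e b : 0 < r -> 0 < rd -> 0 < d ->
  (forall a, `|a - z| < rd -> g a <= (1 + d) * c * `|a - z|) ->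
  0 < e -> 0 < b ->
  \int[mu]_(a in [set` side l z r]) (e + (1 + d) * c * `|a - z|) `^ (- b)
   - ((1 + d) * c * rd) `^ (- b) * r <=
  \int[mu]_(a in [set` side l z r]) (e + g a) `^ (- b).
Proof.
move=> r_gt0 rd0 d0 Hd e0 b0.
have dc0 : 0 < (1 + d) * c by rewrite mulr_gt0// addr_gt0.
have i1 : mu.-integrable [set` side l z r]
    (EFin \o (fun a => (e + (1 + d) * c * `|a - z|) `^ (- b))).
  apply: integrable_side => //; last exact: ltW.
    exact: measurable_dist.
  by move=> a; rewrite mulr_ge0// ltW.
have i2 : mu.-integrable [set` side l z r]
    (EFin \o (fun=> ((1 + d) * c * rd) `^ (- b))).
  by case: (l); exact: integrable_cst_itv.
have -> : ((1 + d) * c * rd) `^ (- b) * r =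
    \int[mu]_(a in [set` side l z r]) ((1 + d) * c * rd) `^ (- b).
  by rewrite Rintegral_cst// [X in fine X]lebesgue_side// ltW.
rewrite -RintegralB//; apply: le_Rintegral => //.
- exact: integrable_subr.
- by apply: integrable_side => //; exact: ltW.
- move=> a /= /side_dist ar.
  have [ard|rda] := ltP `|a - z| rd.
    rewrite lerBlDr ler_wpDr ?powR_ge0//; apply: ler_powRN; first exact: ltW.
      by rewrite ltr_wpDr.
    by rewrite lerD2l; exact: Hd.
  rewrite lerBlDr ler_wpDl ?powR_ge0//; apply: ler_powRN; first exact: ltW.
    by rewrite mulr_gt0.
  by have := ler_wpM2l (ltW dc0) rda; lra.
Qed.

End one_side.

End linear_zeros.

(** * Rates of divergence of singular integrals *)

Section near_zero.
Variable R : realType.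

Lemma near0_gt0 : \forall e \near (0:R)^'+, 0 < e.
Proof. exact: nbhs_right_gt. Qed.

Lemma near0_lt (r : R) : 0 < r -> \forall e \near (0:R)^'+, e < r.
Proof. by move=> r0; exact: nbhs_right_lt. Qed.

Lemma near0_mulr_powR (C b d : R) : 0 < b -> 0 < d ->
  \forall e \near 0^'+, C * e `^ b <= d.
Proof.
move=> b0 d0; have : C * e `^ b @[e --> 0^'+] --> C * 0.
  by apply: cvgMr; exact: powR_cvg0.
rewrite mulr0 => /cvgrPdist_le/(_ _ d0); apply: filterS => e.
by rewrite sub0r normrN; exact: le_trans (ler_norm _).
Qed.

End near_zero.

(** The rate of divergence of the integral of [(e + g) ^ (- b)] over [x, y]; the
    factor [b - 1] is what makes [L] the same for all exponents: each zero of
    slope [c] contributes [c^-1] on each of its sides that lies in [x, y]. *)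
Definition blowup_constant (R : realType) (g : R -> R) (x y L : R) : Prop :=
  forall b : R, 1 < b ->
    e `^ (b - 1) * \int[@lebesgue_measure R]_(a in `[x, y]) (e + g a) `^ (- b)
      @[e --> 0^'+] --> L / (b - 1).

Section linear_vanishing.
Variable R : realType.
Local Notation mu := (@lebesgue_measure R).
Implicit Types (x y z r rd b d e : R) (l : bool).
Variables (g : R -> R) (c : R).
Hypotheses (c0 : 0 < c) (mg : measurable_fun setT g) (g0 : forall a, 0 <= g a).

Local Notation I b x y e := (\int[mu]_(a in `[x, y]) (e + g a) `^ (- b)).

Lemma linear_zero_half z : linear_zero g c z ->
  exists2 r0 : R, 0 < r0 & forall a, `|a - z| <= r0 ->
    1 / 2 * c * `|a - z| <= g a <= 3 / 2 * c * `|a - z|.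
Proof.
move=> gz; have [|r r_gt0 Hr] := linear_zero_bounds c0 gz (_ : 0 < 1 / 2).
  by rewrite divr_gt0.
exists (r / 2) => [|a ar]; first by rewrite divr_gt0.
have /Hr/andP[h1 h2] : `|a - z| < r by apply: le_lt_trans ar _; lra.
by apply/andP; split; lra.
Qed.

(** For the exact profile [k * `|a - z|] the rescaled integral tends to
    [1 / (k (b - 1))].  As [g] is squeezed between the slopes [(1 - d) c] and
    [(1 + d) c] for every [d], up to bounded terms that [e ^ (b - 1)] annihilates,
    the limit is [1 / (c (b - 1))]. *)
Lemma blowup_constant_side z : linear_zero g c z ->
  exists2 r0 : R, 0 < r0 & forall l r b, 0 < r <= r0 -> 1 < b ->
    e `^ (b - 1) * \int[mu]_(a in [set` side l z r]) (e + g a) `^ (- b)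
      @[e --> 0^'+] --> c^-1 / (b - 1).
Proof.
move=> gz; have [r0 r0_gt0 H0] := linear_zero_half gz.
exists r0 => // l r b /andP[r_gt0 rr0] b1.
have b0 : 0 < b by lra.
have b10 : 0 < b - 1 by lra.
have bN1 : b != 1 by rewrite gt_eqF.
have r0b a : `|a - z| <= r0 -> 1 / 2 * c * `|a - z| <= g a.
  by move=> /H0/andP[].
(* [v] is kept opaque so that linear arithmetic treats it as an atom *)
have [v vE] : exists v : R, v = c^-1 / (b - 1) by eexists.
have v_gt0 : 0 < v by rewrite vE divr_gt0 ?invr_gt0.
rewrite -vE.
have main k e : 0 < k -> 0 < e ->
    e `^ (b - 1) * \int[mu]_(a in [set` side l z r]) (e + k * `|a - z|) `^ (- b)
    = (1 - e `^ (b - 1) * (e + k * r) `^ (- (b - 1))) / (k * (b - 1)).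
  move=> k0 e0; rewrite integral_side_powR//; last exact: ltW.
  rewrite (_ : 1 - b = - (b - 1)); last by ring.
  rewrite mulrA mulrBr; congr ((_ - _) / _).
  by rewrite powRN mulfV// gt_eqF// powR_gt0.
apply/cvgrPdist_le => /= h h0.
have [d [d0 d12 dh]] : exists d, [/\ 0 < d, d <= 1 / 2 & d * v <= h / 4].
  exists (Num.min (1 / 2) (h / 4 / v)); split.
  - by rewrite lt_min !divr_gt0.
  - by rewrite ge_min lexx.
  - by rewrite -ler_pdivlMr// ge_min lexx orbT.
have [rd rd0 Hrd] := linear_zero_bounds c0 gz d0.
have k1_gt0 : 0 < (1 - d) * c by rewrite mulr_gt0//; lra.
have k2_gt0 : 0 < (1 + d) * c by rewrite mulr_gt0//; lra.
have Hup a : `|a - z| < rd -> (1 - d) * c * `|a - z| <= g a by move=> /Hrd/andP[].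
have Hlo a : `|a - z| < rd -> g a <= (1 + d) * c * `|a - z| by move=> /Hrd/andP[].
pose C1 := (1 / 2 * c * rd) `^ (- b) * r.
pose C2 := ((1 + d) * c * r) `^ (- (b - 1)) / ((1 + d) * c * (b - 1))
  + ((1 + d) * c * rd) `^ (- b) * r.
have l1 : ((1 - d) * c * (b - 1))^-1 <= v + h / 2.
  have -> : ((1 - d) * c * (b - 1))^-1 = v / (1 - d).
    by rewrite vE; field; rewrite !gt_eqF//; lra.
  by rewrite ler_pdivrMr; nra.
have l2 : v - h / 2 <= ((1 + d) * c * (b - 1))^-1.
  have -> : ((1 + d) * c * (b - 1))^-1 = v / (1 + d).
    by rewrite vE; field; rewrite !gt_eqF//; lra.
  by rewrite ler_pdivlMr; nra.
have h2 : 0 < h / 2 by rewrite divr_gt0.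
near=> e.
have e0 : 0 < e by near: e; exact: near0_gt0.
have n1 : C1 * e `^ (b - 1) <= h / 2 by near: e; exact: near0_mulr_powR.
have n2 : C2 * e `^ (b - 1) <= h / 2 by near: e; exact: near0_mulr_powR.
have E0 : 0 < e `^ (b - 1) by rewrite powR_gt0.
have d01 : 0 < d < 1 by rewrite d0; lra.
have /(ler_wpM2l (ltW E0)) := @integral_side_upper _ g c c0 mg g0 z r0 r0b
  l r rd d e b r_gt0 rr0 rd0 d01 Hup e0 b0.
rewrite mulrDr main//.
set F := _ * \int[mu]_(a in _) _.
set B := (1 - _) / _ => up.
have /(ler_wpM2l (ltW E0)) := @integral_side_lower _ g c c0 mg g0 z
  l r rd d e b r_gt0 rd0 d0 Hlo e0 b0.
rewrite mulrBr main// -/F; set A := _ / _ => lo.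
have AE : A >= ((1 + d) * c * (b - 1))^-1 -
    e `^ (b - 1) * ((1 + d) * c * r) `^ (- (b - 1)) / ((1 + d) * c * (b - 1)).
  rewrite -[leLHS](_ : (1 - e `^ (b - 1) * ((1 + d) * c * r) `^ (- (b - 1)))
    / ((1 + d) * c * (b - 1)) = _); last by rewrite mulrBl mul1r.
  apply: ler_wpM2r; first by rewrite invr_ge0 ltW// mulr_gt0.
  rewrite lerD2l lerN2; apply: ler_wpM2l; first exact: ltW.
  apply: ler_powRN; [exact: ltW|by rewrite mulr_gt0|by rewrite lerDr ltW].
have BE : B <= ((1 - d) * c * (b - 1))^-1.
  rewrite -[leRHS]mul1r; apply: ler_wpM2r; first by rewrite invr_ge0 ltW// mulr_gt0.
  by rewrite gerBl mulr_ge0 ?powR_ge0.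
rewrite ler_norml; apply/andP; split.
  have : F <= v + h / 2 + C1 * e `^ (b - 1).
    apply: (le_trans up); rewrite [e `^ _ * _]mulrC lerD2r.
    exact: le_trans BE _.
  lra.
have : v - h / 2 - C2 * e `^ (b - 1) <= F.
  apply: le_trans lo; rewrite /C2 mulrDl opprD addrA.
  rewrite [_ `^ (- b) * r * _]mulrC lerD2r.
  apply: le_trans AE; rewrite lerB//.
  by rewrite [e `^ _ * _]mulrC mulrAC.
lra.
Unshelve. all: by end_near.
Qed.

Lemma blowup_constant0 x y d : x <= y -> 0 < d ->
  (forall a, x <= a <= y -> d <= g a) -> blowup_constant g x y 0.
Proof.
move=> xy d0 dg b b1; rewrite mul0r.
pose C := d `^ (- b) * (y - x).
have H : C * e `^ (b - 1) @[e --> 0^'+] --> 0.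
  by rewrite -[X in _ --> X](mulr0 C); apply: cvgMr; apply: powR_cvg0; lra.
apply: (squeeze_cvgr _ (cvg_cst (0:R)) H) => //.
near=> e.
have e0 : 0 < e by near: e; exact: near0_gt0.
rewrite mulr_ge0 ?powR_ge0 ?Rintegral_ge0//=; last first.
  by move=> a _; rewrite powR_ge0.
rewrite mulrC ler_wpM2r ?powR_ge0// /C.
have -> : d `^ (- b) * (y - x) = \int[mu]_(a in `[x, y]) (d `^ (- b)).
  by rewrite Rintegral_cst// [X in fine X]lebesgue_itvcc.
apply: le_Rintegral => //.
- by apply: integrable_powRN_shift => //; lra.
- exact: integrable_cst_itv.
- move=> a /=; rewrite in_itv/= => axy; apply: ler_powRN; [lra|by []|].
  by apply: le_trans (dg _ axy) _; rewrite lerDr ltW.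
Unshelve. all: by end_near.
Qed.

Lemma blowup_constant_cat x y z L L' : x <= y -> y <= z ->
  blowup_constant g x y L -> blowup_constant g y z L' ->
  blowup_constant g x z (L + L').
Proof.
move=> xy yz H H' b b1; rewrite mulrDl.
apply: cvg_trans (cvgD (H b b1) (H' b b1)); apply: near_eq_cvg; near=> e.
have e0 : 0 < e by near: e; exact: near0_gt0.
rewrite (Rintegral_itv_cat xy yz) ?mulrDr//.
by apply: integrable_powRN_shift => //; lra.
Unshelve. all: by end_near.
Qed.

Lemma blowup_constant_ge0 x y L : blowup_constant g x y L -> 0 <= L.
Proof.
move=> /(_ 2 (ltr1n _ 2)); rewrite (_ : 2 - 1 = 1) ?divr1; last by ring.
move=> H; rewrite -(cvg_lim _ H)//; apply: limr_ge; first by apply/cvg_ex; exists L.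
near=> e; rewrite mulr_ge0 ?powR_ge0 ?Rintegral_ge0// => a _; exact: powR_ge0.
Unshelve. all: by end_near.
Qed.

(** A local dichotomy, in the form consumed by [segment_induction]: near each
    point, [g] either stays away from 0 or vanishes linearly. *)
Definition linear_vanishing : Prop := forall z, 0 <= z <= 1 ->
  (exists rd : R * R, [/\ 0 < rd.1, 0 < rd.2 &
     forall a, 0 <= a <= 1 -> `|a - z| < rd.1 -> rd.2 <= g a]) \/
  linear_zero g c z.

Hypothesis lv : linear_vanishing.

Lemma blowup_constant_exists x y : 0 <= x -> x <= y -> y <= 1 ->
  exists L, blowup_constant g x y L.
Proof.
move: x y; apply: segment_induction.
  move=> x y z _ xy yz _ [L HL] [L' HL'].
  by exists (L + L'); exact: blowup_constant_cat HL HL'.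
move=> z z01; have [[[r d]/= [r0 d0 Hd]]|zz] := lv z01.
  exists r => //; split=> [x x0 /andP[zrx xz]|y y1 /andP[zy yzr]]; exists 0.
    apply: (blowup_constant0 (d := d)) => // a /andP[xa az]; apply: Hd.
      by apply/andP; split; lra.
    by rewrite ltr_norml; apply/andP; split; lra.
  apply: (blowup_constant0 (d := d)) => // a /andP[xa az]; apply: Hd.
    by apply/andP; split; lra.
  by rewrite ltr_norml; apply/andP; split; lra.
have deg : exists L, blowup_constant g z z L.
  exists 0 => b _; rewrite mul0r; under eq_fun do rewrite set_itv1 Rintegral_set1 mulr0.
  exact: cvg_cst.
have [r0 r0_gt0 H] := blowup_constant_side zz.
exists r0 => //; split=> [x x0 /andP[zrx xz]|y y1 /andP[zy yzr]].
  have [->//|xnz] := eqVneq x z.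
  exists c^-1 => b b1; have := H true (z - x) b _ b1; rewrite /side subKr; apply.
  by rewrite subr_gt0 lt_neqAle xnz xz/=; lra.
have [<-//|ynz] := eqVneq z y.
exists c^-1 => b b1; have := H false (y - z) b _ b1; rewrite /side (addrC z) subrK; apply.
by rewrite subr_gt0 lt_neqAle ynz zy/=; lra.
Qed.

Variable z0 : R.
Hypotheses (z01 : 0 <= z0 < 1) (z0z : linear_zero g c z0).

(** The right side of the zero [z0] lies in [0, 1] and contributes [c^-1]; the rest
    of the segment contributes a nonnegative amount. *)
Lemma blowup_constant_gt0 : exists2 L, 0 < L & blowup_constant g 0 1 L.
Proof.
move: z01 => /andP[z00 z01'].
have [r0 r0_gt0 H] := blowup_constant_side z0z.
pose r := Num.min r0 (1 - z0).
have r_gt0 : 0 < r by rewrite lt_min r0_gt0 subr_gt0.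
have rr0 : r <= r0 by rewrite ge_min lexx.
have rz : z0 + r <= 1.
  have : r <= 1 - z0 by rewrite ge_min lexx orbT.
  lra.
have Hr : blowup_constant g z0 (z0 + r) c^-1.
  by move=> b b1; apply: (H false r b) => //; rewrite r_gt0.
have [L1 HL1] := blowup_constant_exists (lexx 0) z00 (ltW z01').
have [||L2 HL2] := blowup_constant_exists _ _ (lexx 1) (x := z0 + r).
- lra.
- exact: rz.
exists (L1 + (c^-1 + L2)).
  have := blowup_constant_ge0 HL1; have := blowup_constant_ge0 HL2.
  have : 0 < c^-1 by rewrite invr_gt0.
  lra.
apply: (@blowup_constant_cat _ z0) => //; first lra.
by apply: (@blowup_constant_cat _ (z0 + r)) => //; lra.
Qed.

(** The borderline exponent: a linear zero makes the integral of [(e + g)^-1]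
    diverge like [- ln e]. *)
Lemma integral_inv_shift_cvgy : I 1 0 1 e @[e --> 0^'+] --> +oo.
Proof.
move: z01 => /andP[z00 z01'].
have [r0 r0_gt0 H] := linear_zero_half z0z.
pose r := Num.min r0 (1 - z0).
have r_gt0 : 0 < r by rewrite lt_min r0_gt0 subr_gt0.
have rr0 : r <= r0 by rewrite ge_min lexx.
have rz : z0 + r <= 1.
  have : r <= 1 - z0 by rewrite ge_min lexx orbT.
  lra.
have k0 : 0 < (1 + 1 / 2) * c by rewrite mulr_gt0// addr_gt0.
have Hlo a : `|a - z0| < r -> g a <= (1 + 1 / 2) * c * `|a - z0|.
  by move=> ar; have /andP[_] := H a (le_trans (ltW ar) rr0); lra.
set C := ((1 + 1 / 2) * c * r) `^ (- 1) * r.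
apply/cvgryPge => A; near=> e.
have e0 : 0 < e by near: e; exact: near0_gt0.
have h : ln e <= ln ((1 + 1 / 2) * c * r) - (A + C) * ((1 + 1 / 2) * c).
  near: e; have := @lnNy R => /cvgrNyPle; exact.
have h12 : 0 < 1 / 2 :> R by rewrite divr_gt0.
have := @integral_side_lower _ g c c0 mg g0 z0 false r r (1 / 2) e 1
  r_gt0 r_gt0 h12 Hlo e0 ltr01.
rewrite -/C integral_side_inv//; last exact: ltW.
set S := \int[mu]_(a in _) _ => lo.
have SI : S <= I 1 0 1 e.
  have ii : mu.-integrable `[0, 1] (EFin \o (fun a => (e + g a) `^ (- 1))).
    exact: integrable_powRN_shift.
  have ii' : mu.-integrable `[z0, 1] (EFin \o (fun a => (e + g a) `^ (- 1))).
    exact: integrable_powRN_shift.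
  rewrite (Rintegral_itv_cat z00 (ltW z01') ii).
  rewrite (@Rintegral_itv_cat _ _ z0 (z0 + r) 1)//; last lra.
  rewrite -/S.
  have : 0 <= I 1 0 z0 e by apply: Rintegral_ge0 => a _; exact: powR_ge0.
  have : 0 <= I 1 (z0 + r) 1 e by apply: Rintegral_ge0 => a _; exact: powR_ge0.
  lra.
apply: le_trans SI; apply: le_trans lo; rewrite lerBrDr ler_pdivlMr//.
have : ln ((1 + 1 / 2) * c * r) <= ln (e + (1 + 1 / 2) * c * r).
  by rewrite ler_ln ?posrE ?lerDr ?ltW ?addr_gt0 ?mulr_gt0.
lra.
Unshelve. all: by end_near.
Qed.

(** For exponents below 1 the primitive [t ^ (1 - b)] is bounded near 0. *)
Lemma integral_powRN_shift_bounded b : 0 < b < 1 ->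
  exists C, forall e, 0 < e <= 1 -> I b 0 1 e <= C.
Proof.
move=> /andP[b0 b1].
suff: forall x y, 0 <= x -> x <= y -> y <= 1 ->
    exists C, forall e, 0 < e <= 1 -> I b x y e <= C by exact.
apply: segment_induction.
  move=> x y z _ xy yz _ [C HC] [C' HC'].
  exists (C + C') => e /[dup] e01 /andP[e0 _]; rewrite (@Rintegral_itv_cat _ _ x y z)//.
    by rewrite lerD ?HC ?HC'.
  by apply: integrable_powRN_shift => //; exact: ltW.
move=> z zz; have [[[r d]/= [r0 d0 Hd]]|z_z] := lv zz.
  have deg x y : x <= y -> (forall a, x <= a <= y -> d <= g a) ->
      exists C, forall e, 0 < e <= 1 -> I b x y e <= C.
    move=> xy H; exists (d `^ (- b) * (y - x)) => e /andP[e0 _].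
    have -> : d `^ (- b) * (y - x) = \int[mu]_(a in `[x, y]) (d `^ (- b)).
      by rewrite Rintegral_cst// [X in fine X]lebesgue_itvcc.
    apply: le_Rintegral => //.
    - by apply: integrable_powRN_shift => //; lra.
    - exact: integrable_cst_itv.
    - move=> a /=; rewrite in_itv/= => axy; apply: ler_powRN; [lra|by []|].
      by apply: le_trans (H _ axy) _; rewrite lerDr ltW.
  exists r => //; split=> [x x0 /andP[zrx xz]|y y1 /andP[zy yzr]];
    apply: deg => // a /andP[xa az]; apply: Hd.
  - by apply/andP; split; lra.
  - by rewrite ltr_norml; apply/andP; split; lra.
  - by apply/andP; split; lra.
  - by rewrite ltr_norml; apply/andP; split; lra.
have deg : exists C, forall e, 0 < e <= 1 -> I b z z e <= C.
  by exists 0 => e _; rewrite set_itv1 Rintegral_set1.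
have [r0 r0_gt0 H] := linear_zero_half z_z.
have r0b a : `|a - z| <= r0 -> 1 / 2 * c * `|a - z| <= g a.
  by move=> /H/andP[].
have k0 : 0 < (1 - 1 / 2) * c by rewrite mulr_gt0// subr_gt0; lra.
have Hs l r : 0 < r -> r <= r0 -> exists C, forall e, 0 < e <= 1 ->
    \int[mu]_(a in [set` side l z r]) (e + g a) `^ (- b) <= C.
  move=> r_gt0 rr0.
  exists ((1 + (1 - 1 / 2) * c * r) `^ (1 - b) / ((1 - 1 / 2) * c * (1 - b))
    + (1 / 2 * c * r) `^ (- b) * r) => e /andP[e0 e1].
  have Hup a : `|a - z| < r -> (1 - 1 / 2) * c * `|a - z| <= g a.
    by move=> ar; have := r0b _ (le_trans (ltW ar) rr0); lra.
  have h12 : 0 < (1 / 2 : R) < 1 by apply/andP; split; lra.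
  have := @integral_side_upper _ g c c0 mg g0 z r0 r0b l r r (1 / 2) e b
    r_gt0 rr0 r_gt0 h12 Hup e0 b0.
  move=> /le_trans; apply; rewrite lerD2r integral_side_powR//; last 2 first.
  - exact: ltW.
  - by rewrite lt_eqF.
  rewrite -(opprB 1 b) mulrN invrN mulrN -mulNr opprB.
  apply: ler_wpM2r; first by rewrite invr_ge0 ltW// mulr_gt0// subr_gt0.
  rewrite lerBlDr ler_wpDr ?powR_ge0//.
  have kr0 : 0 <= (1 - 1 / 2) * c * r by exact: mulr_ge0 (ltW k0) (ltW r_gt0).
  by apply: ge0_ler_powR; rewrite ?nnegrE; lra.
exists r0 => //; split=> [x x0 /andP[zrx xz]|y y1 /andP[zy yzr]].
  have [->//|xnz] := eqVneq x z.
  have := Hs true (z - x); rewrite /side subKr; apply; last lra.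
  by rewrite subr_gt0 lt_neqAle xnz xz.
have [<-//|ynz] := eqVneq z y.
have := Hs false (y - z); rewrite /side (addrC z) subrK; apply; last lra.
by rewrite subr_gt0 lt_neqAle ynz zy.
Qed.

End linear_vanishing.

(** * Integrable singularities *)

Section dominated_right_limit.
Variable R : realType.
Local Notation mu := (@lebesgue_measure R).

(** Dominated convergence for a real parameter tending to 0 from the right,
    reduced to sequences; a sequence is shifted so that it stays below [r]. *)
Lemma Rintegral_cvg_at_right0 (A : set R) (F : R -> R -> R) (f D : R -> R) (r : R) :
  measurable A -> 0 < r ->
  (forall e, 0 < e -> measurable_fun A (F e)) -> measurable_fun A f ->
  mu.-integrable A (EFin \o D) ->
  {ae mu, forall a, A a -> F e a @[e --> 0^'+] --> f a} ->
  {ae mu, forall a, A a -> forall e, 0 < e < r -> `|F e a| <= D a} ->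
  mu.-integrable A (EFin \o f) /\
  \int[mu]_(a in A) F e a @[e --> 0^'+] --> \int[mu]_(a in A) f a.
Proof.
move=> mA r0 mF mf iD Fcvg Fdom.
have main (w : R^nat) : (forall n, 0 < w n) -> w n @[n --> \oo] --> 0 ->
    mu.-integrable A (EFin \o f) /\
    \int[mu]_(a in A) F (w n) a @[n --> \oo] --> \int[mu]_(a in A) f a.
  move=> w0 wc.
  have [N _ Nw] : \forall n \near \oo, w n < r by near=> n; near: n; apply: (cvgr_lt 0).
  have [] := @dominated_convergence _ _ _ mu A mA
    (fun n => EFin \o F (w (n + N)%N)) (EFin \o f) (EFin \o D).
  - by move=> n; apply/measurable_EFinP; exact: mF.
  - exact/measurable_EFinP.
  - apply: (@filterS _ _ (ae_filter_ringOfSetsType mu)) Fcvg => a h /h {}h; apply: cvg_EFin; first exact: nearW.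
    move/cvg_at_rightP : h; apply; split; first by move=> n.
    by rewrite (cvg_shiftn N).
  - by [].
  - apply: (@filterS _ _ (ae_filter_ringOfSetsType mu)) Fdom => a h n /h {}h; rewrite /= lee_fin; apply: h.
    by rewrite w0/=; apply: Nw => /=; exact: leq_addl.
  - move=> fi _ ic; split=> //; rewrite -(cvg_shiftn N).
    apply: fine_cvg; rewrite /Rintegral fineK//.
    exact: integrable_fin_num.
split; last by apply/cvg_at_rightP => w [w0 wc]; have [] := main w w0 wc.
have [] // := main (@harmonic R); last exact: cvg_harmonic.
by move=> n; rewrite /harmonic/= invr_gt0.
Unshelve. all: by end_near.
Qed.

End dominated_right_limit.

Section integrable_singularity.
Variable R : realType.
Local Notation mu := (@lebesgue_measure R).
Variables (g : R -> R) (c G : R).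
Hypotheses (c0 : 0 < c) (mg : measurable_fun setT g) (g0 : forall a, 0 <= g a).
Hypotheses (lv : linear_vanishing g c) (gG : forall a, g a <= G).

(** The functions [(e + g) ^ (- b)] increase to [g ^ (- b)] as [e] decreases to 0
    along the harmonic sequence, and their integrals are bounded, so monotone
    convergence applies.  At the zeros of [g], [powR 0] takes the value 0, which
    is harmless for an upper bound. *)
Lemma integrable_powRN b : b < 1 ->
  mu.-integrable `[0, 1] (EFin \o (fun a => g a `^ (- b))).
Proof.
move=> b1; have [b0|b0] := leP b 0.
  apply: (@bounded_integrable_itv _ _ _ _ (G `^ (- b))).
    by apply: measurable_funTS; exact: measurable_powRl.
  move=> a _; rewrite ger0_norm ?powR_ge0//; apply: ge0_ler_powR; rewrite ?nnegrE ?oppr_ge0//.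
  exact: le_trans (g0 a) (gG a).
have [|C HC] := integral_powRN_shift_bounded c0 mg g0 lv (_ : 0 < b < 1).
  by rewrite b0.
pose f n (a : R) : \bar R := ((harmonic n + g a) `^ (- b))%:E.
have h0 n : 0 < harmonic n :> R by rewrite /harmonic/= invr_gt0.
have mf n : measurable_fun (`[0, 1]%classic : set R) (f n).
  by apply/measurable_EFinP; apply: measurable_funTS; exact: measurable_powRN_shift.
have f0 n a : (`[0, 1]%classic : set R) a -> (0 <= f n a)%E by rewrite lee_fin powR_ge0.
have fnd a : (`[0, 1]%classic : set R) a -> {homo f^~ a : n m / (n <= m)%N >-> (n <= m)%E}.
  move=> _ n m nm; rewrite lee_fin; apply: ler_powRN; [exact: ltW|by rewrite ltr_wpDr|].
  by rewrite lerD2r /harmonic/= lef_pV2 ?posrE// ler_nat.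
have mono := monotone_convergence mu (measurable_itv _) mf f0 fnd.
have ile : (\int[mu]_(a in `[0%R, 1%R]) limn (f^~ a) <= C%:E)%E.
  rewrite mono; apply: lime_le.
    apply: ereal_nondecreasing_is_cvgn => n m nm.
    by apply: ge0_le_integral => //; do ?[exact: mf|by move=> a; exact: f0
      |by move=> a a01; exact: (fnd _ a01 _ _ nm)].
  apply: nearW => n.
  have fi : mu.-integrable (`[0, 1]%classic : set R) (f n) by apply: integrable_powRN_shift => //; exact: ltW.
  rewrite -(fineK (integrable_fin_num _ fi))// lee_fin; apply: HC.
  by rewrite h0/= /harmonic/= invf_le1// ler1n.
have li : mu.-integrable (`[0, 1]%classic : set R) (fun a => limn (f^~ a)).
  apply/integrableP; split.
    by apply: emeasurable_fun_cvg mf _ => a a01; exact: ereal_nondecreasing_is_cvgn (fnd a a01).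
  apply: le_lt_trans (ltry C); apply: le_trans ile.
  rewrite le_eqVlt; apply/orP; left; apply/eqP; apply: eq_integral => a /[!inE] a01.
  rewrite gee0_abs//; apply: lime_ge; first exact: ereal_nondecreasing_is_cvgn (fnd a a01).
  by apply: nearW => n; exact: f0.
apply: le_integrable li => //.
  by apply/measurable_EFinP; apply: measurable_funTS; exact: measurable_powRl.
move=> a a01; rewrite gee0_abs ?lee_fin ?powR_ge0//.
apply: le_trans (lee_abs _).
have [ga|ga] := eqVneq (g a) 0.
  rewrite /= ga powR0 ?oppr_eq0 ?gt_eqF//; apply: lime_ge.
    exact: ereal_nondecreasing_is_cvgn (fnd a a01).
  by apply: nearW => n; exact: f0.
have ga0 : 0 < g a by rewrite lt0r ga g0.
rewrite (_ : limn _ = (g a `^ (- b))%:E)//; apply/cvg_lim => //.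
apply: cvg_EFin; first exact: nearW.
have ha : harmonic n + g a @[n --> \oo] --> g a.
  by rewrite -[X in _ --> X](add0r (g a)); apply: cvgD; [exact: cvg_harmonic|exact: cvg_cst].
exact: cvg_powR ga0 ha.
Qed.

End integrable_singularity.

(** * Moments for an exponent 1 / lambda between 0 and 2 *)

(** Negative moments of the shifted profile [e + g]; the orders are spaced by
    one so that quotients by [shift_moment g v 0] are the moments of
    [(e + g)^-1] for the probability density proportional to [(e + g)^(-v)]. *)
Definition shift_moment (R : realType) (g : R -> R) (v : R) (i : nat) (e : R) : R :=
  \int[@lebesgue_measure R]_(a in `[0, 1]) (e + g a) `^ (- i%:R - v).

Lemma shift_moment_ge0 (R : realType) (g : R -> R) (v : R) i e : 0 <= shift_moment g v i e.
Proof. by apply: Rintegral_ge0 => a _; exact: powR_ge0. Qed.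

(** The powers of [Q] and [e] that remain besides the prefactor
    [Q^-1 * e^-1 * r] of the second central moment form a square of [Q * e]. *)
Lemma rescaled_central_third (R : realFieldType) (Q e r p1 p2 p3 : R) : Q != 0 -> e != 0 ->
  Q ^- 3 * (e ^- 3 * (r * p3) - 3 * (e ^- 1 * (r * p1)) * (e ^- 2 * (r * p2))
    + 2 * (e ^- 1 * (r * p1)) ^+ 3) =
  Q^-1 * e^-1 * r * (p3 - 3 * r * p1 * p2 + 2 * r ^+ 2 * p1 ^+ 3) / (Q * e) ^+ 2.
Proof. by move=> Q0 e0; field; rewrite Q0 e0. Qed.

Lemma gt0_mulr_cvgy (R : realType) (T : Type) (F : set_system T) {FF : Filter F}
    (f h : T -> R) (l : R) : 0 < l ->
  f e @[e --> F] --> +oo -> h e @[e --> F] --> l -> f e * h e @[e --> F] --> +oo.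
Proof.
move=> l0 fy hl; apply/cvgryPge => A; near=> e.
have h1 : l / 2 <= h e.
  by near: e; apply: cvgr_ge hl _ _; rewrite ltr_pdivrMr// ltr_pMr// ltr1n.
have h2 : Num.max 0 (A / (l / 2)) <= f e.
  by near: e; move/cvgryPge : fy; exact.
move: h2; rewrite ge_max => /andP[f0 Af].
apply: le_trans (ler_wpM2l f0 h1).
by rewrite -ler_pdivrMr// divr_gt0.
Unshelve. all: by end_near.
Qed.

Section strong_singularity.
Variable R : realType.
Local Notation mu := (@lebesgue_measure R).
Variables (g : R -> R) (c G L v : R).
Hypotheses (mg : measurable_fun setT g) (g0 : forall a, 0 <= g a).
Hypotheses (gG : forall a, g a <= G) (L0 : 0 < L) (gL : blowup_constant g 0 1 L).
Hypothesis gy : \int[mu]_(a in `[0, 1]) (e + g a) `^ (- 1) @[e --> 0^'+] --> +oo.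
Hypothesis v02 : 0 < v < 2.

Local Notation I := (shift_moment g v).

Lemma shift_moment_ge i e : 0 < e -> (e + G) `^ (- (i%:R + v)) <= I i e.
Proof.
move=> e0; have iv : - i%:R - v = - (i%:R + v) by ring.
have v0 : 0 <= i%:R + v by rewrite addr_ge0// ltW//; case/andP: v02.
rewrite /shift_moment iv.
have -> : (e + G) `^ (- (i%:R + v)) =
    \int[mu]_(a in `[0, 1]) (e + G) `^ (- (i%:R + v)).
  by rewrite Rintegral_cst// [X in fine X]lebesgue_itvcc// subr0 mulr1.
apply: le_Rintegral => //; first exact: integrable_cst_itv.
  exact: integrable_powRN_shift.
move=> a _; apply: ler_powRN => //; first by rewrite ltr_wpDr.
by rewrite lerD2l.
Qed.

Let G0 : 0 <= G. Proof. exact: le_trans (g0 0) (gG 0). Qed.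

Lemma shift_moment_gt0 i e : 0 < e -> 0 < I i e.
Proof.
by move=> e0; apply: lt_le_trans (shift_moment_ge i e0); rewrite powR_gt0// ltr_wpDr.
Qed.

(** Rescaled quantities with finite limits: [I i e / I 0 e] is
    [e ^- i * (rho e * p i e)].  The limit of [rho] is [v - 1] when [1 < v] and 0
    when the integral [I 0 e] grows more slowly than any power. *)
Let p i e := e `^ (i%:R + v - 1) * I i e / L.

Let p_cvg i : (0 < i)%N -> p i e @[e --> 0^'+] --> (v - 1 + i%:R)^-1.
Proof.
move=> i0; have /andP[v0 _] := v02.
have i1 : 1 <= i%:R :> R by rewrite ler1n.
have b1 : 1 < i%:R + v by lra.
have := gL b1; rewrite /p /shift_moment (_ : - i%:R - v = - (i%:R + v)); last by ring.
move=> H; have -> : (v - 1 + i%:R)^-1 = L / (i%:R + v - 1) / L.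
  by field; rewrite !gt_eqF//; lra.
by apply: cvgMl.
Qed.

Let rho e := e `^ (1 - v) * L / I 0 e.

(** [I 0 e] grows at most like [e ^ (- b)], with [b] so small that
    [I 0 e ^ (2 / v) * e] tends to 0 and [e ^ (- v) * I 0 e ^ (- (2 / v + 1))]
    tends to infinity.  For [1 < v] the exact rate [b = v - 1] has these
    properties, precisely because [v < 2]; otherwise any positive [b] is an
    admissible rate, by comparison with the exponent [1 + b]. *)
Lemma shift_moment0_le : exists C b : R, [/\ 0 < C, 0 < b, b * (2 / v + 1) < v,
  2 / v * b < 1 & \forall e \near 0^'+, I 0 e <= C * e `^ (- b)].
Proof.
have /andP[v0 v2] := v02.
have [v1|v1] := ltP 1 v.
  exists (L / (v - 1) + 1), (v - 1); split.
  - by rewrite addr_gt0// divr_gt0// subr_gt0.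
  - by rewrite subr_gt0.
  - rewrite -(ltr_pM2r v0) (_ : _ * v = (v - 1) * (2 + v)); last by field; rewrite gt_eqF.
    by nra.
  - rewrite -(ltr_pM2r v0) (_ : _ * v = 2 * (v - 1)); last by field; rewrite gt_eqF.
    by lra.
  - have := gL v1; rewrite /shift_moment oppr0 add0r => H.
    near=> e.
    have e0 : 0 < e by near: e; exact: near0_gt0.
    rewrite powRN ler_pdivlMr ?powR_gt0// mulrC.
    near: e; apply: cvgr_le H _ _; by rewrite ltrDl.
pose b := v / (2 * (2 / v + 1)).
have w0 : 0 < 2 / v + 1 by rewrite addr_gt0// divr_gt0.
have b0 : 0 < b by rewrite divr_gt0// mulr_gt0.
have bE : b * (2 / v + 1) = v / 2 by rewrite /b; field; rewrite !gt_eqF//; lra.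
exists ((1 + G) `^ (1 + b - v) * (L / b + 1)), b; split => //.
- by apply: mulr_gt0; [rewrite powR_gt0// ltr_wpDr|rewrite addr_gt0// divr_gt0].
- by rewrite bE; lra.
- have : 2 / v * b = v / 2 - b by rewrite -bE; ring.
  by move=> ->; lra.
have b1 : 1 < 1 + b by rewrite ltrDl.
have := gL b1; rewrite (_ : 1 + b - 1 = b); last by ring.
move=> H; near=> e.
have e0 : 0 < e by near: e; exact: near0_gt0.
have e1 : e < 1 by near: e; exact: near0_lt.
have h : e `^ b * \int[mu]_(a in `[0, 1]) (e + g a) `^ (- (1 + b)) <= L / b + 1.
  by near: e; apply: cvgr_le H _ _; rewrite ltrDl.
have {}h : \int[mu]_(a in `[0, 1]) (e + g a) `^ (- (1 + b)) <= (L / b + 1) * e `^ (- b).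
  by rewrite powRN ler_pdivlMr ?powR_gt0// mulrC.
have ii : mu.-integrable `[0, 1] (EFin \o (fun a => (e + g a) `^ (- (1 + b)))).
  by apply: integrable_powRN_shift => //; lra.
rewrite -mulrA; apply: le_trans (ler_wpM2l (powR_ge0 _ _) h).
rewrite -RintegralZl//; apply: le_Rintegral => //.
- by rewrite oppr0 add0r; apply: integrable_powRN_shift => //; exact: ltW.
- exact: integrable_mulrl.
move=> a _; have ega : 0 < e + g a by rewrite ltr_wpDr.
rewrite (_ : - 0%:R - v = (1 + b - v) + - (1 + b)); last by rewrite oppr0; ring.
rewrite gt0_powRD//.
apply: ler_wpM2r; first exact: powR_ge0.
apply: ge0_ler_powR; rewrite ?nnegrE; first lra.
- exact: ltW.
- by rewrite addr_ge0.
- by apply: lerD; [exact: ltW|exact: gG].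
Unshelve. all: by end_near.
Qed.

Let rho_cvg : rho e @[e --> 0^'+] --> Num.max (v - 1) 0.
Proof.
have /andP[v0 v2] := v02; have [v1|v1|v1] := ltgtP v 1.
- rewrite max_r ?subr_le0 ?ltW//.
    have H : (1 + G) `^ v * L * e `^ (1 - v) @[e --> 0^'+] --> 0.
    rewrite -[X in _ --> X](mulr0 ((1 + G) `^ v * L)); apply: cvgMr.
    by apply: powR_cvg0; rewrite subr_gt0.
  apply: (squeeze_cvgr _ (cvg_cst (0:R)) H) => //; near=> e.
  have e0 : 0 < e by near: e; exact: near0_gt0.
  have e1 : e < 1 by near: e; exact: near0_lt.
  have I0 := shift_moment_gt0 0 e0.
  rewrite /rho; apply/andP; split.
    by rewrite divr_ge0 ?mulr_ge0 ?powR_ge0 ?ltW.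
  rewrite ler_pdivrMr//.
  have h : 1 <= (1 + G) `^ v * I 0 e.
    have : (1 + G) `^ (- v) <= I 0 e.
      apply: le_trans (shift_moment_ge 0 e0); rewrite add0r.
      by apply: ler_powRN; [exact: ltW|rewrite ltr_wpDr|rewrite lerD2r ltW].
    by rewrite powRN -[leLHS]mulr1 ler_pdivrMl// powR_gt0// ltr_wpDr.
  rewrite (_ : _ * L * _ * _ = e `^ (1 - v) * L * ((1 + G) `^ v * I 0 e)); last by ring.
  by rewrite ler_peMr// mulr_ge0 ?powR_ge0// ltW.
- rewrite max_l; last by rewrite subr_ge0 ltW.
  have H := gL v1.
  have Hd : L / (v - 1) != 0 by rewrite gt_eqF// divr_gt0// subr_gt0.
  have -> : v - 1 = L * (L / (v - 1))^-1 by field; rewrite !gt_eqF// subr_gt0.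
  rewrite (_ : rho = fun e => L * (e `^ (v - 1) *
      \int[mu]_(a in `[0, 1]) (e + g a) `^ (- v))^-1); last first.
    apply/funext => e; rewrite /rho /shift_moment oppr0 add0r invfM -powRN opprB.
    by rewrite mulrA [L * _]mulrC.
  by apply: cvgMr; apply: cvgV.
- rewrite v1 subrr maxxx.
  rewrite (_ : rho = fun e => L * (\int[mu]_(a in `[0, 1]) (e + g a) `^ (- 1))^-1); last first.
    by apply/funext => e; rewrite /rho /shift_moment v1 subrr powRr0 mul1r oppr0 add0r.
  rewrite -[X in _ --> X](mulr0 L); apply: cvgMr; apply/gtr0_cvgV0; last exact: gy.
  near=> e.
  have e0 : 0 < e by near: e; exact: near0_gt0.
  by have := shift_moment_gt0 0 e0; rewrite /shift_moment v1 oppr0 add0r.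
Unshelve. all: by end_near.
Qed.

Let w := 2 / v.
(** The diverging prefactor common to the mean deviation and, up to a power of
    [I 0 e ^ w * e], to the third moment. *)
Let W e := L * e `^ (- v) * I 0 e `^ (- (w + 1)).

Let W_cvgy : W e @[e --> 0^'+] --> +oo.
Proof.
have /andP[v0 _] := v02; have w0 : 0 < w by rewrite divr_gt0.
have [C [b [C0 b0 bw _ Cb]]] := shift_moment0_le.
have d0 : 0 < v - b * (w + 1) by rewrite subr_gt0.
apply/cvgryPge => A; near=> e.
have e0 : 0 < e by near: e; exact: near0_gt0.
have I0 := shift_moment_gt0 0 e0.
have h1 : I 0 e <= C * e `^ (- b) by near: e.
have h2 : A / (L * C `^ (- (w + 1))) * e `^ (v - b * (w + 1)) <= 1.
  by near: e; exact: near0_mulr_powR.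
have w1 : 0 <= w + 1 by rewrite addr_ge0// ltW.
have := ler_powRN w1 I0 h1.
rewrite powRM ?powR_ge0 ?(ltW C0)// -powRrM mulrNN => h3.
have : L * e `^ (- v) * (C `^ (- (w + 1)) * e `^ (b * (w + 1))) <= W e.
  by apply: ler_wpM2l => //; rewrite mulr_ge0 ?powR_ge0 ?ltW.
apply: le_trans.
have C1 : 0 < C `^ (- (w + 1)) by rewrite powR_gt0.
rewrite (_ : _ * _ = L * C `^ (- (w + 1)) * (e `^ (- v) * e `^ (b * (w + 1)))); last by ring.
rewrite -gt0_powRD// (_ : - v + _ = - (v - b * (w + 1))); last by ring.
rewrite powRN ler_pdivlMr ?powR_gt0//.
by move: h2; rewrite mulrAC ler_pdivrMr ?mulr_gt0// mul1r.
Unshelve. all: by end_near.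
Qed.

Let momE i e : 0 < e -> I i e / I 0 e = e ^- i * (rho e * p i e).
Proof.
move=> e0; have I0 := shift_moment_gt0 0 e0.
have ei : e `^ (1 - v) * e `^ (i%:R + v - 1) = e ^+ i.
  by rewrite -gt0_powRD// -powR_mulrn ?ltW//; congr (_ `^ _); ring.
have ei0 : e ^+ i != 0 by rewrite expf_neq0// gt_eqF.
have -> : rho e * p i e = (e `^ (1 - v) * e `^ (i%:R + v - 1)) * (I i e / I 0 e).
  by rewrite /rho /p; field; rewrite !gt_eqF.
by rewrite ei mulKf.
Qed.

Let WE e : 0 < e -> W e = I 0 e `^ (- w) * e^-1 * rho e.
Proof.
move=> e0; have I0 := shift_moment_gt0 0 e0.
rewrite /W /rho opprD gt0_powRD// [I 0 e `^ (-1)]powR_inv1 ?ltW//.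
rewrite [e `^ (1 - v)]gt0_powRD// powRr1 ?ltW//.
by field; rewrite !gt_eqF.
Qed.

Let r0 := Num.max (v - 1) 0.

(** For [1 < v] the constant equals [1 / (v ^ 2 (v + 1))]. *)
Let var_const_gt0 : 0 < (v - 1 + 2)^-1 - r0 * (v - 1 + 1)^-1 ^+ 2.
Proof.
have /andP[v0 v2] := v02; rewrite /r0.
have [v1|v1] := leP (v - 1) 0.
  by rewrite mul0r subr0 invr_gt0; lra.
rewrite subr_gt0 subrK exprVn ltr_pdivrMr ?exprn_gt0//.
rewrite mulrC ltr_pdivlMr; last lra.
by rewrite expr2; nra.
Qed.

Let third_const_gt0 : 0 < (v - 1 + 3)^-1 - 3 * r0 * (v - 1 + 1)^-1 * (v - 1 + 2)^-1
   + 2 * r0 ^+ 2 * (v - 1 + 1)^-1 ^+ 3.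
Proof.
have /andP[v0 v2] := v02; rewrite /r0.
have [v1|v1] := leP (v - 1) 0.
  by rewrite expr0n/= !(mulr0, mul0r) subr0 addr0 invr_gt0; lra.
have -> : (v - 1 + 3)^-1 - 3 * (v - 1) * (v - 1 + 1)^-1 * (v - 1 + 2)^-1
   + 2 * (v - 1) ^+ 2 * (v - 1 + 1)^-1 ^+ 3
   = 2 * (2 - v) / (v ^+ 3 * (v + 1) * (v + 2)).
  by field; rewrite !gt_eqF//; lra.
rewrite divr_gt0 ?mulr_gt0 ?exprn_gt0//; lra.
Qed.

(** Writing [X] for [(e + g)^-1], the quantity is [I 0 e ^ (- 2 / v) * e] times the
    variance of [X]; it equals [W e * (p 2 e - rho e * p 1 e ^ 2)]. *)
Lemma deviation_lower_cvgy :
  I 0 e `^ (- (2 / v)) * e * (I 2 e / I 0 e - (I 1 e / I 0 e) ^+ 2)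
    @[e --> 0^'+] --> +oo.
Proof.
have H : p 2 e - rho e * p 1 e ^+ 2 @[e --> 0^'+] -->
    (v - 1 + 2)^-1 - r0 * (v - 1 + 1)^-1 ^+ 2.
  apply: cvgB; first exact: p_cvg.
  by apply: cvgM; [exact: rho_cvg|rewrite expr2; apply: cvgM; exact: (@p_cvg 1)].
apply: cvg_trans (gt0_mulr_cvgy var_const_gt0 W_cvgy H).
apply: near_eq_cvg; near=> e.
have e0 : 0 < e by near: e; exact: near0_gt0.
rewrite (momE 2 e0) (momE 1 e0) WE// -/w.
move: (I 0 e `^ (- w)) (rho e) (p 1 e) (p 2 e) => x r p1 p2.
by field; rewrite gt_eqF.
Unshelve. all: by end_near.
Qed.

(** The same product [W e * q], where [q] has a positive limit, but divided by the
    square of [I 0 e ^ w * e], which is eventually at most 1. *)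
Lemma third_moment_cvgy :
  I 0 e `^ (- (6 / v)) * (I 3 e / I 0 e
    - 3 * (I 1 e / I 0 e) * (I 2 e / I 0 e) + 2 * (I 1 e / I 0 e) ^+ 3)
    @[e --> 0^'+] --> +oo.
Proof.
have /andP[v0 _] := v02; have w0 : 0 < w by rewrite divr_gt0.
have H : p 3 e - 3 * rho e * p 1 e * p 2 e + 2 * rho e ^+ 2 * p 1 e ^+ 3
    @[e --> 0^'+] --> (v - 1 + 3)^-1 - 3 * r0 * (v - 1 + 1)^-1 * (v - 1 + 2)^-1
   + 2 * r0 ^+ 2 * (v - 1 + 1)^-1 ^+ 3.
  have p1 := p_cvg (ltn0Sn 0).
  apply: cvgD; first apply: cvgB; first exact: p_cvg.
    apply: cvgM; last exact: p_cvg.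
    by apply: cvgM => //; apply: cvgMr; exact: rho_cvg.
  apply: cvgM; last by rewrite !exprS expr0 mulr1; apply: cvgM => //; apply: cvgM.
  by apply: cvgMr; rewrite expr2; apply: cvgM; exact: rho_cvg.
have /(_ _)/cvgryPge HW := gt0_mulr_cvgy third_const_gt0 W_cvgy H.
have [C [b [C0 b0 _ bw Cb]]] := shift_moment0_le.
have d0 : 0 < 1 - w * b by rewrite subr_gt0.
apply/cvgryPge => A; near=> e.
have e0 : 0 < e by near: e; exact: near0_gt0.
have I0 := shift_moment_gt0 0 e0.
have h1 : I 0 e <= C * e `^ (- b) by near: e.
have h2 : C `^ w * e `^ (1 - w * b) <= 1 by near: e; exact: near0_mulr_powR.
have h3 : Num.max 0 A <= W e * (p 3 e - 3 * rho e * p 1 e * p 2 e + 2 * rho e ^+ 2 * p 1 e ^+ 3).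
  by near: e; exact: HW.
have Q0 : 0 < I 0 e `^ w * e by rewrite mulr_gt0// powR_gt0.
have Q1 : I 0 e `^ w * e <= 1.
  apply: le_trans h2.
  rewrite gt0_powRD// powRr1; last exact: ltW.
  rewrite mulrCA [leLHS]mulrC; apply: ler_wpM2l; first exact: ltW.
  have -> : C `^ w * e `^ (- (w * b)) = (C * e `^ (- b)) `^ w.
    by rewrite powRM ?powR_ge0 ?ltW// -powRrM mulNr [b * w]mulrC.
  have Ceb : 0 <= C * e `^ (- b) by rewrite mulr_ge0 ?powR_ge0// ltW.
  by apply: ge0_ler_powR; rewrite ?nnegrE//; apply: ltW.
move: h3; rewrite ge_max => /andP[h30 h3A]; apply: (le_trans h3A).
rewrite (momE 3 e0) (momE 2 e0) (momE 1 e0).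
have -> : I 0 e `^ (- (6 / v)) = (I 0 e `^ w) ^- 3.
  by rewrite -powR_invn ?powR_ge0// -powRrM /w; congr (_ `^ _); field; rewrite gt_eqF.
have WE' : W e = (I 0 e `^ w)^-1 * e^-1 * rho e by rewrite WE// powRN.
set q := p 3 e - _ + _ in h30 h3A *.
have -> : (I 0 e `^ w) ^- 3 * (e ^- 3 * (rho e * p 3 e)
    - 3 * (e ^- 1 * (rho e * p 1 e)) * (e ^- 2 * (rho e * p 2 e))
    + 2 * (e ^- 1 * (rho e * p 1 e)) ^+ 3) = (W e * q) / (I 0 e `^ w * e) ^+ 2.
  by rewrite WE' rescaled_central_third// gt_eqF// powR_gt0.
rewrite ler_pdivlMr ?exprn_gt0// ler_piMr//.
by rewrite expr_le1// ltW.
Unshelve. all: by end_near.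
Qed.

End strong_singularity.

(** * Moments for a negative exponent 1 / lambda *)

(** The hypothesis on [k2] absorbs [3 k1 k2] in half of [k3]. *)
Lemma central_third_lower (R : realFieldType) (A K k1 k2 k3 : R) :
  0 < K -> 0 <= k1 <= K -> 0 <= k3 ->
  k2 <= (6 * K)^-1 * k3 + 3 / 2 * K * k1 -> 2 * A + 9 * K ^+ 3 <= k3 ->
  A <= k3 - 3 * k1 * k2 + 2 * k1 ^+ 3.
Proof.
move=> K0 /andP[k10 h1] k30 h3 h2.
have H1 : k1 * k2 <= k1 * ((6 * K)^-1 * k3 + 3 / 2 * K * k1) by exact: ler_wpM2l.
have H2 : k1 * (6 * K)^-1 <= 6^-1.
  by rewrite invfM mulrCA ler_piMr ?invr_ge0// ler_pdivrMr// mul1r.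
have H3 : k1 * (6 * K)^-1 * k3 <= 6^-1 * k3 by exact: ler_wpM2r.
have H4 : k1 * k1 <= K * K by apply: ler_pM.
have H5 : K * (k1 * k1) <= K * (K * K) by apply: ler_wpM2l => //; exact: ltW.
have H6 : 0 <= k1 ^+ 3 by rewrite exprn_ge0.
have -> : k3 - 3 * k1 * k2 + 2 * k1 ^+ 3 = k3 - 3 * (k1 * k2) + 2 * k1 ^+ 3 by ring.
move: H1; rewrite mulrDr mulrA => H1.
have E1 : k1 * (3 / 2 * K * k1) = 3 / 2 * (K * (k1 * k1)) by ring.
have E2 : K ^+ 3 = K * (K * K) by ring.
move: H1 h2; rewrite E1 E2; lra.
Qed.

Section weak_singularity.
Variable R : realType.
Local Notation mu := (@lebesgue_measure R).
Variables (g : R -> R) (G v : R).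
Hypotheses (mg : measurable_fun setT g) (g0 : forall a, 0 <= g a).
Hypotheses (gG : forall a, g a <= G).
Hypothesis gfin : finite_set [set a | 0 <= a <= 1 /\ g a = 0].
Hypothesis gint : forall b, b < 1 ->
  mu.-integrable `[0, 1] (EFin \o (fun a => g a `^ (- b))).
Hypothesis gy : \int[mu]_(a in `[0, 1]) (e + g a) `^ (- 1) @[e --> 0^'+] --> +oo.
Hypothesis v0 : v < 0.

Local Notation I := (shift_moment g v).

Let G0 : 0 <= G. Proof. exact: le_trans (g0 0) (gG 0). Qed.

(** A finite set is negligible. *)
Lemma ae_gt0 : {ae mu, forall a, (`[0, 1]%classic : set R) a -> 0 < g a}.
Proof.
exists [set a | 0 <= a <= 1 /\ g a = 0]; split.
- by apply: countable_measurable => //; exact: finite_set_countable.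
- by apply: countable_lebesgue_measure0; exact: finite_set_countable.
- move=> a /= /not_implyP[]; rewrite in_itv/= => a01 /negP; rewrite -leNgt => ga.
  by split => //; apply/eqP; rewrite eq_le ga g0.
Qed.

(** A bound that serves both signs of the exponent: [g ^ (- b)] dominates when
    [0 <= b], the constant when [b < 0]. *)
Lemma shift_powRN_le b e a : 0 < e <= 1 -> 0 < g a ->
  (e + g a) `^ (- b) <= g a `^ (- b) + (1 + G) `^ (- b).
Proof.
move=> /andP[e0 e1] ga; have [b0|b0] := leP 0 b.
  rewrite ler_wpDr ?powR_ge0//; apply: ler_powRN => //.
  by rewrite lerDr ltW.
rewrite ler_wpDl ?powR_ge0//; apply: ge0_ler_powR; rewrite ?nnegrE.
- by rewrite oppr_ge0 ltW.
- by rewrite addr_ge0// ltW.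
- by rewrite addr_ge0.
- exact: lerD.
Qed.

Lemma integrable_dominant b : b < 1 ->
  mu.-integrable `[0, 1] (EFin \o (fun a => g a `^ (- b) + (1 + G) `^ (- b))).
Proof.
by move=> b1; apply: integrable_addr => //; [exact: gint|exact: integrable_cst_itv].
Qed.

Lemma shift_powRN_cvg b : b < 1 ->
  \int[mu]_(a in `[0, 1]) (e + g a) `^ (- b) @[e --> 0^'+] -->
  \int[mu]_(a in `[0, 1]) g a `^ (- b).
Proof.
move=> b1.
have [] // := @Rintegral_cvg_at_right0 R `[0, 1]
  (fun e a => (e + g a) `^ (- b)) (fun a => g a `^ (- b))
  (fun a => g a `^ (- b) + (1 + G) `^ (- b)) 1.
- by move=> e e0; apply: measurable_funTS; exact: measurable_powRN_shift.
- by apply: measurable_funTS; exact: measurable_powRl.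
- exact: integrable_dominant.
- apply: (@filterS _ _ (ae_filter_ringOfSetsType mu)) ae_gt0 => a h /h ga.
  apply: cvg_powR => //; apply: cvg_at_right_filter.
  by rewrite -[X in _ --> X]add0r; apply: cvgD; [exact: cvg_id|exact: cvg_cst].
- apply: (@filterS _ _ (ae_filter_ringOfSetsType mu)) ae_gt0 => a h /h ga e /andP[e0 e1].
  by rewrite ger0_norm ?powR_ge0//; apply: shift_powRN_le; rewrite ?e0 ?ltW.
Qed.

Lemma shift_moment_cvg i : i%:R + v < 1 ->
  I i e @[e --> 0^'+] --> \int[mu]_(a in `[0, 1]) g a `^ (- i%:R - v).
Proof.
by move=> iv; rewrite /shift_moment (_ : - i%:R - v = - (i%:R + v));
  [exact: shift_powRN_cvg|ring].
Qed.

Lemma shift_moment_cvgy i : 1 <= i%:R + v -> I i e @[e --> 0^'+] --> +oo.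
Proof.
move=> iv; have C0 : 0 < (1 + G) `^ (- (i%:R + v - 1)) by rewrite powR_gt0// ltr_wpDr.
apply/cvgryPge => A; near=> e.
have e0 : 0 < e by near: e; exact: near0_gt0.
have e1 : e < 1 by near: e; exact: near0_lt.
have : A / (1 + G) `^ (- (i%:R + v - 1)) <= \int[mu]_(a in `[0, 1]) (e + g a) `^ (- 1).
  by near: e; move/cvgryPge : gy; exact.
rewrite ler_pdivrMr// => /le_trans; apply.
have i1 : mu.-integrable `[0, 1] (EFin \o (fun a => (e + g a) `^ (- 1))).
  exact: integrable_powRN_shift.
rewrite mulrC -RintegralZl// /shift_moment (_ : - i%:R - v = - (i%:R + v)); last by ring.
apply: le_Rintegral => //.
- exact: integrable_mulrl.
- by apply: integrable_powRN_shift => //; lra.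
- move=> a _; have ega : 0 < e + g a by rewrite ltr_wpDr.
  rewrite (_ : - (i%:R + v) = - (i%:R + v - 1) + - 1); last by ring.
  rewrite gt0_powRD//; apply: ler_wpM2r; first exact: powR_ge0.
  apply: ler_powRN => //; first by rewrite subr_ge0.
  by apply: lerD => //; exact: ltW.
Unshelve. all: by end_near.
Qed.

Let I0s := \int[mu]_(a in `[0, 1]) g a `^ (- 0%:R - v).

Lemma shift_moment0_cvg : I 0 e @[e --> 0^'+] --> I0s.
Proof. by apply: shift_moment_cvg; rewrite add0r (lt_trans v0). Qed.

(** The function [(e + g) ^ (- v)] is small only where [(e + g) ^ (- 1 / 2)] is
    large, and the integral of the latter is bounded in [e].  Quantitatively,
    [h ^ (- v) >= T ^ (- v) (1 - T ^ (1 / 2) h ^ (- 1 / 2))] for all [h > 0]. *)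
Lemma shift_moment0_lim_gt0 : 0 < I0s.
Proof.
have [A [A0 HA]] : exists A : R, 0 < A /\ \forall e \near 0^'+,
    \int[mu]_(a in `[0, 1]) (e + g a) `^ (- (1 / 2)) <= A.
  have h12 : 1 / 2 < 1 :> R by lra.
  exists (\int[mu]_(a in `[0, 1]) g a `^ (- (1 / 2)) + 1); split.
    by rewrite ltr_wpDl// Rintegral_ge0// => a _; exact: powR_ge0.
  by apply: cvgr_le (shift_powRN_cvg h12) _ _; rewrite ltrDl.
(* the right-hand side is nonpositive for [h < T] and at most [T ^ (- v)]
   otherwise; this [T] makes its integral at least [T ^ (- v) / 2] *)
pose T := (2 * A)^-1 ^+ 2.
have T0 : 0 < T by rewrite exprn_gt0// invr_gt0 mulr_gt0.
have Th : T `^ (1 / 2) = (2 * A)^-1.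
  rewrite /T -powR_mulrn; last by rewrite invr_ge0 mulr_ge0// ltW.
  rewrite -powRrM (_ : 2 * (1 / 2) = 1); last by field.
  by rewrite powRr1// invr_ge0 mulr_ge0// ltW.
apply: (@lt_le_trans _ _ (T `^ (- v) * (1 / 2))).
  by rewrite mulr_gt0// ?powR_gt0//; lra.
rewrite -(cvg_lim _ shift_moment0_cvg)//; apply: limr_ge.
  by apply/cvg_ex; exists I0s; exact: shift_moment0_cvg.
near=> e.
have e0 : 0 < e by near: e; exact: near0_gt0.
have e1 : e < 1 by near: e; exact: near0_lt.
have i1 : mu.-integrable `[0, 1] (EFin \o (fun a => (e + g a) `^ (- (1 / 2)))).
  by apply: integrable_powRN_shift => //; lra.
have i2 : mu.-integrable `[0, 1]
    (EFin \o (fun a => T `^ (1 / 2) * (e + g a) `^ (- (1 / 2)))).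
  exact: integrable_mulrl.
have i3 : mu.-integrable `[0, 1]
    (EFin \o (fun a => 1 - T `^ (1 / 2) * (e + g a) `^ (- (1 / 2)))).
  by apply: integrable_subr => //; exact: integrable_cst_itv.
have i4 : mu.-integrable `[0, 1]
    (EFin \o (fun a => T `^ (- v) * (1 - T `^ (1 / 2) * (e + g a) `^ (- (1 / 2))))).
  exact: integrable_mulrl.
have i5 : mu.-integrable `[0, 1] (EFin \o (fun a => (e + g a) `^ (- 0%:R - v))).
  apply: (@bounded_integrable_itv _ _ _ _ ((1 + G) `^ (- v))).
    by apply: measurable_funTS; exact: measurable_powRN_shift.
  move=> a _; rewrite ger0_norm ?powR_ge0// oppr0 add0r.
  apply: ge0_ler_powR; rewrite ?nnegrE.
  - by rewrite oppr_ge0 ltW.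
  - by rewrite addr_ge0// ltW.
  - by rewrite addr_ge0.
  - by apply: lerD => //; exact: ltW.
apply: (@le_trans _ _ (\int[mu]_(a in `[0, 1])
    (T `^ (- v) * (1 - T `^ (1 / 2) * (e + g a) `^ (- (1 / 2)))))).
  rewrite RintegralZl// RintegralB//; last exact: integrable_cst_itv.
  rewrite RintegralZl// Rintegral_cst// [X in fine X]lebesgue_itvcc// subr0 mulr1.
  apply: ler_wpM2l; first exact: powR_ge0.
  have : \int[mu]_(a in `[0, 1]) (e + g a) `^ (- (1 / 2)) <= A by near: e.
  rewrite Th; set S := \int[mu]_(a in _) _ => SA.
  have : (2 * A)^-1 * S <= (2 * A)^-1 * A.
    by apply: ler_wpM2l => //; rewrite invr_ge0 mulr_ge0// ltW.
  rewrite invfM mulfVK ?gt_eqF//; lra.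
apply: le_Rintegral => // a _; have ega : 0 < e + g a by rewrite ltr_wpDr.
rewrite oppr0 add0r; have [Tg|gT] := leP T (e + g a).
  apply: (@le_trans _ _ (T `^ (- v))).
    by rewrite ler_piMr ?powR_ge0// gerBl mulr_ge0 ?powR_ge0.
  apply: ge0_ler_powR; rewrite ?nnegrE//; last exact: ltW.
    by rewrite oppr_ge0 ltW.
  exact: ltW.
apply: (@le_trans _ _ 0); last exact: powR_ge0.
rewrite pmulr_rle0 ?powR_gt0// subr_le0 powRN ler_pdivlMr ?powR_gt0// [leLHS]mul1r.
by apply: ge0_ler_powR; rewrite ?nnegrE ?ltW//; lra.
Unshelve. all: by end_near.
Qed.

Lemma shift_moment_mean_cvg i : i%:R + v < 1 ->
  exists l : R, I i e / I 0 e @[e --> 0^'+] --> l.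
Proof.
move=> iv; exists ((\int[mu]_(a in `[0, 1]) g a `^ (- i%:R - v)) / I0s).
apply: cvgM; first exact: (shift_moment_cvg iv).
by apply: cvgV shift_moment0_cvg; rewrite gt_eqF// shift_moment0_lim_gt0.
Qed.

Let v1 : 1%:R + v < 1. Proof. by rewrite gtrDl. Qed.

(** Dominated convergence: the integrand is at most a constant times
    [(e + g) ^ (- (p + v)) + (e + g) ^ (- v)], because the mean [I 1 e / I 0 e] is
    bounded; [p + v < 1] is what makes the dominating function integrable. *)
Lemma deviation_power_cvg p : 1 <= p -> p + v < 1 -> exists l : R,
  I 0 e `^ (- (2 / v) * p - 1) * \int[mu]_(a in `[0, 1])
    (`|(e + g a)^-1 - I 1 e / I 0 e| `^ p * (e + g a) `^ (- v))
  @[e --> 0^'+] --> l.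
Proof.
move=> p1 pv.
pose k e := I 1 e / I 0 e.
have [ks kcvg] : exists ks : R, k e @[e --> 0^'+] --> ks := shift_moment_mean_cvg v1.
pose K := `|ks| + 1.
have [r r0 Hr] : exists2 r, 0 < r & forall e, 0 < e < r -> `|k e| <= K.
  have : \forall e \near 0^'+, `|k e| <= K.
    by apply: (cvgr_le _ (cvg_norm kcvg)); rewrite /K ltrDl.
  rewrite near_withinE near_nbhs => -[r /= r0 H]; exists r => // e /andP[e0 er].
  by apply: H => //=; rewrite sub0r normrN gtr0_norm.
pose F e a := `|(e + g a)^-1 - k e| `^ p * (e + g a) `^ (- v).
pose f a := `|(g a)^-1 - ks| `^ p * g a `^ (- v).
pose D a := 2 `^ p * ((g a `^ (- (p + v)) + (1 + G) `^ (- (p + v)))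
  + K `^ p * (g a `^ (- v) + (1 + G) `^ (- v))).
have r10 : 0 < Num.min r 1 by rewrite lt_min r0/=.
have mh e : measurable_fun setT (fun a => e + g a) by exact: measurable_funD.
have minv (h : R -> R) : (forall a, 0 <= h a) -> measurable_fun setT h ->
    measurable_fun setT (fun a => (h a)^-1).
  move=> h0 mh'; rewrite (_ : (fun a => (h a)^-1) = fun a => h a `^ (-1)).
    exact: measurable_powRl.
  by apply/funext => a; rewrite powR_inv1.
have [] := @Rintegral_cvg_at_right0 R `[0, 1] F f D (Num.min r 1).
- by [].
- by [].
- move=> e e0; apply: measurable_funTS; apply: measurable_funM.
    apply: measurable_powRl; apply: measurableT_comp => //.
    apply: measurable_funB => //; apply: minv => // a.
    by rewrite addr_ge0// ltW.
  exact: measurable_powRl.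
- apply: measurable_funTS; apply: measurable_funM.
    apply: measurable_powRl; apply: measurableT_comp => //.
    by apply: measurable_funB => //; exact: minv.
  exact: measurable_powRl.
- apply: integrable_mulrl => //; apply: integrable_addr => //.
    exact: integrable_dominant.
  by apply: integrable_mulrl => //; apply: integrable_dominant; lra.
- apply: (@filterS _ _ (ae_filter_ringOfSetsType mu)) ae_gt0 => a h /h ga.
  have eg : e + g a @[e --> 0^'+] --> g a.
    apply: cvg_at_right_filter.
    by rewrite -[X in _ --> X]add0r; apply: cvgD; [exact: cvg_id|exact: cvg_cst].
  apply: cvgM; last exact: cvg_powR.
  have H : `|(e + g a)^-1 - k e| @[e --> 0^'+] --> `|(g a)^-1 - ks|.
    by apply: cvg_norm; apply: cvgB => //; apply: cvgV => //; rewrite gt_eqF.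
  have [z|nz] := eqVneq `|(g a)^-1 - ks| 0.
    have p0 : 0 < p by exact: lt_le_trans p1.
    rewrite z powR0 ?gt_eqF//; apply: cvg_powR0 => //.
    by move: H; rewrite z.
  by apply: cvg_powR => //; rewrite lt0r nz/=.
- apply: (@filterS _ _ (ae_filter_ringOfSetsType mu)) ae_gt0 => a h /h ga e /andP[e0].
  rewrite lt_min => /andP[er e1].
  have ega : 0 < e + g a by rewrite ltr_wpDr.
  have e01 : 0 < e <= 1 by rewrite e0 ltW.
  have ke : `|k e| <= K by apply: Hr; rewrite e0.
  have K0 : 0 <= K by exact: le_trans ke.
  have x0 : 0 <= (e + g a)^-1 by rewrite invr_ge0 ltW.
  rewrite ger0_norm ?mulr_ge0 ?powR_ge0//.
  apply: (@le_trans _ _ (2 `^ p * (((e + g a)^-1) `^ p + K `^ p) * (e + g a) `^ (- v))).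
    apply: ler_wpM2r; first exact: powR_ge0.
    have p0 : 0 <= p by lra.
    apply: le_trans (ler_powRD p0 x0 K0).
    apply: ge0_ler_powR; rewrite ?nnegrE ?addr_ge0//.
    by apply: le_trans (ler_normB _ _) _; rewrite (ger0_norm x0) lerD2l.
  rewrite -mulrA; apply: ler_wpM2l; first exact: powR_ge0.
  rewrite mulrDl; apply: lerD.
    rewrite -powR_inv1 ?(ltW ega)// -powRrM mulN1r -gt0_powRD// -opprD.
    exact: shift_powRN_le.
  by apply: ler_wpM2l; [exact: powR_ge0|exact: shift_powRN_le].
move=> _ FC; exists (I0s `^ (- (2 / v) * p - 1) * \int[mu]_(a in `[0, 1]) f a).
apply: cvgM; last exact: FC.
exact: cvg_powR shift_moment0_lim_gt0 shift_moment0_cvg.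
Qed.

Lemma integrable_shift_any b e : 0 < e ->
  mu.-integrable `[0, 1] (EFin \o (fun a => (e + g a) `^ b)).
Proof.
move=> e0; have eG : 0 < e + G by rewrite ltr_wpDr.
apply: (@bounded_integrable_itv _ _ _ _ (e `^ b + (e + G) `^ b)).
  by apply: measurable_funTS; exact: measurable_powRN_shift.
move=> a _; rewrite ger0_norm ?powR_ge0//; have [b0|b0] := leP b 0.
  rewrite -(opprK b) ler_wpDr ?powR_ge0//; apply: ler_powRN => //.
    by rewrite oppr_ge0.
  by rewrite lerDl.
rewrite ler_wpDl ?powR_ge0//; apply: ge0_ler_powR; rewrite ?nnegrE ?lerD2l//.
- exact: ltW.
- by rewrite addr_ge0// ltW.
- exact: ltW.
Qed.

Let mean_cvgy i : 1 <= i%:R + v -> I i e / I 0 e @[e --> 0^'+] --> +oo.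
Proof.
move=> iv; have l0 : 0 < I0s^-1 by rewrite invr_gt0 shift_moment0_lim_gt0.
apply: gt0_mulr_cvgy l0 (shift_moment_cvgy iv) _.
by apply: cvgV shift_moment0_cvg; rewrite gt_eqF// shift_moment0_lim_gt0.
Qed.

(** The first moment stays bounded while the second one diverges. *)
Lemma variance_cvgy : 1 <= 2%:R + v ->
  I 0 e `^ (- (4 / v)) * (I 2 e / I 0 e - (I 1 e / I 0 e) ^+ 2)
    @[e --> 0^'+] --> +oo.
Proof.
move=> v2; have [k kc] := shift_moment_mean_cvg v1.
under eq_fun do rewrite mulrC.
have l0 : 0 < I0s `^ (- (4 / v)) by rewrite powR_gt0// shift_moment0_lim_gt0.
apply: gt0_mulr_cvgy l0 _ (cvg_powR _ shift_moment0_lim_gt0 shift_moment0_cvg).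
have k2 : (I 1 e / I 0 e) ^+ 2 @[e --> 0^'+] --> k ^+ 2.
  by rewrite expr2; apply: cvgM.
apply/cvgryPge => A; near=> e.
have h1 : (I 1 e / I 0 e) ^+ 2 <= k ^+ 2 + 1.
  by near: e; apply: cvgr_le k2 _ _; rewrite ltrDl.
have h2 : A + k ^+ 2 + 1 <= I 2 e / I 0 e.
  by near: e; move/cvgryPge : (mean_cvgy v2); exact.
by move: h1 h2; lra.
Unshelve. all: by end_near.
Qed.

(** The pointwise inequality [h ^ (-2) <= th * h ^ (-3) + h ^ (-1) / (4 th)] is
    [0 <= (h - 2 th) ^ 2]. *)
Lemma shift_moment2_le th e : 0 < th -> 0 < e ->
  I 2 e <= th * I 3 e + (4 * th)^-1 * I 1 e.
Proof.
move=> th0 e0; have ii (i : nat) := integrable_shift_any (- i%:R - v) e0.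
rewrite /shift_moment -RintegralZl// -RintegralZl// -RintegralD//; last 2 first.
- exact: integrable_mulrl.
- exact: integrable_mulrl.
apply: le_Rintegral => //.
- by apply: integrable_addr => //; exact: integrable_mulrl.
- move=> a _; have h0 : 0 < e + g a by rewrite ltr_wpDr.
  set h := e + g a in h0 *.
  have -> : - 2%:R - v = 1 + (- 3%:R - v) by ring.
  have -> : - 1%:R - v = 1 + (1 + (- 3%:R - v)) by ring.
  move: (- 3%:R - v) => y; rewrite !gt0_powRD// powRr1; last exact: ltW.
  have := powR_ge0 h y; set x := h `^ _ => x0.
  rewrite !mulrA -mulrDl; apply: ler_wpM2r => //; rewrite -subr_ge0.
  have -> : th + (4 * th)^-1 * h * h - h = (h - 2 * th) ^+ 2 / (4 * th).
    by field; rewrite gt_eqF.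
  by rewrite divr_ge0 ?sqr_ge0// mulr_ge0// ltW.
Qed.

Local Notation third e := (I 3 e / I 0 e
    - 3 * (I 1 e / I 0 e) * (I 2 e / I 0 e) + 2 * (I 1 e / I 0 e) ^+ 3).

(** The mean stays bounded, by [K] say; [shift_moment2_le] for [th = 1 / (6 K)]
    then makes the mixed term at most half of the diverging third moment, up to
    a constant. *)
Lemma weak_third_moment_cvgy : 1 <= 3%:R + v ->
  I 0 e `^ (- (6 / v)) * third e @[e --> 0^'+] --> +oo.
Proof.
move=> v3; have [k kc] := shift_moment_mean_cvg v1.
under eq_fun do rewrite mulrC.
have l0 : 0 < I0s `^ (- (6 / v)) by rewrite powR_gt0// shift_moment0_lim_gt0.
apply: gt0_mulr_cvgy l0 _ (cvg_powR _ shift_moment0_lim_gt0 shift_moment0_cvg).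
pose K := `|k| + 1.
have K0 : 0 < K by rewrite ltr_wpDl.
apply/cvgryPge => A; near=> e.
have e0 : 0 < e by near: e; exact: near0_gt0.
have I0e : 0 < I 0 e.
  near: e; apply: (cvgr_gt _ shift_moment0_cvg); exact: shift_moment0_lim_gt0.
have h1 : I 1 e / I 0 e <= K.
  by near: e; apply: cvgr_le kc _ _; rewrite /K ltr_pwDr// ler_norm.
have h2 : 2 * A + 9 * K ^+ 3 <= I 3 e / I 0 e.
  by near: e; move/cvgryPge : (mean_cvgy v3); exact.
have I1e : 0 <= I 1 e / I 0 e by exact: divr_ge0 (shift_moment_ge0 _ _ _ _) (ltW I0e).
have I3e : 0 <= I 3 e / I 0 e by exact: divr_ge0 (shift_moment_ge0 _ _ _ _) (ltW I0e).
apply: (central_third_lower K0 _ I3e _ h2); first by apply/andP; split.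
have th0 : 0 < (6 * K)^-1 by rewrite invr_gt0 mulr_gt0.
have I0i : 0 <= (I 0 e)^-1 by rewrite invr_ge0 ltW.
apply: le_trans (ler_wpM2r I0i (shift_moment2_le th0 e0)) _.
rewrite le_eqVlt; apply/orP; left; apply/eqP.
move: (I 0 e) I0e (I 1 e) (I 3 e) (K) K0 => i0 i00 i1 i3 K' K0'.
by field; rewrite !gt_eqF.
Unshelve. all: by end_near.
Qed.

Lemma weak_third_moment_cvg : 3%:R + v < 1 -> exists l : R,
  I 0 e `^ (- (6 / v)) * third e @[e --> 0^'+] --> l.
Proof.
move=> v3; have v2 : 2%:R + v < 1 by apply: le_lt_trans v3; rewrite lerD2r ler_nat.
have [k1 c1] := shift_moment_mean_cvg v1.
have [k2 c2] := shift_moment_mean_cvg v2.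
have [k3 c3] := shift_moment_mean_cvg v3.
exists (I0s `^ (- (6 / v)) * (k3 - 3 * k1 * k2 + 2 * k1 ^+ 3)).
apply: cvgM; first exact: cvg_powR shift_moment0_lim_gt0 shift_moment0_cvg.
apply: cvgD; last by apply: cvgMr; rewrite !exprS expr0 mulr1; apply: cvgM => //; apply: cvgM.
by apply: cvgB => //; apply: cvgM => //; apply: cvgMr.
Qed.

End weak_singularity.

(** * Substitution along an increasing absolutely continuous map *)

Section density_measure.
Context d (T : measurableType d) (R : realType).
Variables (m nu : {measure set T -> \bar R}) (rho : T -> R).
Hypotheses (mrho : measurable_fun setT rho) (rho0 : forall x, 0 <= rho x).
Hypothesis nuE : forall A, measurable A -> nu A = (\int[m]_(x in A) (rho x)%:E)%E.

Import HBNNSimple.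

Let integral_density_nnsfun (h : {nnsfun T >-> R}) :
  (\int[nu]_x (h x)%:E = \int[m]_x ((h x)%:E * (rho x)%:E))%E.
Proof.
have hE x : ((h x)%:E = \sum_(y \in range h) (y * \1_(h @^-1` [set y]) x)%:E)%E.
  by rewrite fsumEFin// -fimfunE.
under eq_integral do rewrite hE.
have hE2 x : ((h x)%:E * (rho x)%:E =
    \sum_(y \in range h) ((y * \1_(h @^-1` [set y]) x)%:E * (rho x)%:E))%E.
  by rewrite hE ge0_mule_fsuml// => y; exact: nnfun_muleindic_ge0.
under [RHS]eq_integral do rewrite hE2.
have mrho' : measurable_fun setT (EFin \o rho) by exact/measurable_EFinP.
rewrite ge0_integral_fsum//; last 2 first.
- by move=> y; apply/measurable_EFinP; exact: measurable_funM.
- by move=> y x _; exact: nnfun_muleindic_ge0.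
rewrite ge0_integral_fsum//; last 2 first.
- move=> y; apply: emeasurable_funM => //.
  by apply/measurable_EFinP; exact: measurable_funM.
- by move=> y x _; apply: mule_ge0; [exact: nnfun_muleindic_ge0|rewrite lee_fin].
apply: eq_fsbigr => y /[!inE] -[x _ <-]; set z := h x.
have z0 : (0 <= z%:E)%E by rewrite lee_fin.
under eq_integral do rewrite EFinM.
rewrite ge0_integralZl//; last exact/measurable_EFinP.
rewrite integral_indic// setIT nuE//.
under [RHS]eq_integral do rewrite EFinM -muleA.
rewrite ge0_integralZl//; last 2 first.
- by apply: emeasurable_funM => //; exact/measurable_EFinP.
- by move=> *; rewrite mule_ge0 ?lee_fin.
congr (_ * _)%E; rewrite integral_mkcond; apply: eq_integral => t _.
by rewrite muleC epatch_indic.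
Qed.

(** By linearity the formula passes from indicators to simple functions, and by
    monotone convergence to nonnegative functions. *)
Lemma ge0_integral_density (f : T -> \bar R) :
  measurable_fun setT f -> (forall x, (0 <= f x)%E) ->
  (\int[nu]_x f x = \int[m]_x (f x * (rho x)%:E))%E.
Proof.
move=> mf f0.
pose h := nnsfun_approx measurableT mf.
have hf x : (h n x)%:E @[n --> \oo] --> f x.
  by apply: cvg_nnsfun_approx => // *; exact: f0.
have hnd x : {homo (fun n => (h n x)%:E) : a b / (a <= b)%N >-> (a <= b)%E}.
  by move=> a b ab; rewrite lee_fin; exact/lefP/nd_nnsfun_approx.
transitivity (limn (fun n => \int[nu]_x (h n x)%:E)%E).
  rewrite -monotone_convergence//=.
  - by apply: eq_integral => x _; apply/esym/cvg_lim => //; exact: hf.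
  - by move=> n; apply/measurable_EFinP.
  - by move=> n x _; rewrite lee_fin.
transitivity (limn (fun n => \int[m]_x ((h n x)%:E * (rho x)%:E))%E).
  by congr (limn _); apply/funext => n; exact: integral_density_nnsfun.
rewrite -monotone_convergence//=.
- apply: eq_integral => x _; apply/cvg_lim => //.
  by apply: cvgeZr => //; exact: hf.
- by move=> n; apply: emeasurable_funM => //; exact/measurable_EFinP.
- by move=> n x _; rewrite mule_ge0 ?lee_fin.
- by move=> x _ a b ab; apply: lee_wpmul2r; [rewrite lee_fin|exact: hnd].
Qed.

End density_measure.

Section substitution.
Variable R : realType.
Local Notation mu := (@lebesgue_measure R).
Variables (G rho : R -> R).
Hypotheses (mrho : measurable_fun setT rho) (rho0 : forall x, 0 <= rho x).
Hypothesis Grho : density G rho.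
Hypothesis Gmono : {mono G : x y / x <= y}.
Hypothesis Gsurj : forall y, exists x, G x = y.

Definition density_measure (A : set (measurableTypeR R)) : \bar R := (\int[mu]_(x in A) (rho x)%:E)%E.

Let density_measure0 : density_measure set0 = 0%E.
Proof. by rewrite /density_measure integral_set0. Qed.

Let density_measure_ge0 A : (0 <= density_measure A)%E.
Proof. by apply: integral_ge0 => x _; rewrite lee_fin. Qed.

Let density_measure_sigma_additive : semi_sigma_additive density_measure.
Proof.
apply: (@semi_sigma_additive_nng_induced _ (measurableTypeR R) R mu (EFin \o rho)).
  exact/measurable_EFinP.
by move=> x; rewrite lee_fin.
Qed.

HB.instance Definition _ := isMeasure.Build _ _ _ density_measure
  density_measure0 density_measure_ge0 density_measure_sigma_additive.

Let mG : measurable_fun setT (G : R -> measurableTypeR R).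
Proof.
by apply: nondecreasing_measurable => // x y; rewrite Gmono.
Qed.

(** The preimage of an interval under the increasing bijection [G] is an
    interval, over which [rho] integrates to the increment of [G]; Lebesgue
    measure is determined by its values on intervals. *)
Lemma pushforward_density_lebesgue (A : set (measurableTypeR R)) : measurable A ->
  mu A = pushforward density_measure (G : R -> measurableTypeR R) A.
Proof.
move=> mA; apply: lebesgue_measure_unique => //= _ [[c d]] _ <- /=.
have [x Gx] := Gsurj c; have [y Gy] := Gsurj d.
have -> : pushforward density_measure (G : R -> measurableTypeR R) `]c, d]%classic =
    density_measure `]x, y]%classic.
  congr density_measure; apply/seteqP; split=> a /=; rewrite !in_itv/= -Gx -Gy.
    by rewrite Gmono !ltNge Gmono.
  by rewrite Gmono !ltNge Gmono.
have [xy|yx] := leP x y; last first.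
  rewrite !set_itv_ge ?measure0// -leNgt bnd_simp ?ltW//.
  by rewrite -Gx -Gy ltNge Gmono -ltNge.
have [Gi GE] := Grho xy.
rewrite /density_measure integral_itv_obnd_cbnd; last first.
  by apply: measurable_funS (measurable_int _ Gi) => //; exact: subset_itv_oc_cc.
rewrite -(fineK (integrable_fin_num _ Gi))//.
rewrite -[fine _]/(\int[mu]_(x in `[x, y]) rho x) -GE Gx Gy.
rewrite lebesgue_measure_itv/= lte_fin; have [cd|dc] := ltP c d; first by rewrite EFinB.
suff -> : c = d by rewrite subrr.
by apply/eqP; rewrite eq_le dc andbT -Gx -Gy Gmono.
Qed.

Lemma ge0_integral_substitution (f : R -> \bar R) :
  measurable_fun setT f -> (forall x, (0 <= f x)%E) ->
  (\int[mu]_x f x = \int[mu]_a (f (G a) * (rho a)%:E))%E.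
Proof.
move=> mf f0.
transitivity (\int[pushforward density_measure (G : R -> measurableTypeR R)]_x f x)%E.
  by apply: eq_measure_integral => A mA _; exact: pushforward_density_lebesgue.
rewrite ge0_integral_pushforward//.
rewrite preimage_setT.
apply: (@ge0_integral_density _ (measurableTypeR R) R mu density_measure rho
  mrho rho0 _ (f \o G)) => [A mA //| |x]; last exact: f0.
exact: measurableT_comp mf mG.
Qed.

End substitution.

Section periodic_substitution.
Variable R : realType.
Local Notation mu := (@lebesgue_measure R).
Implicit Types (h f : R -> \bar R) (c x y : R).

Lemma ge0_integral_shift h c : measurable_fun setT h -> (forall x, (0 <= h x)%E) ->
  (\int[mu]_x h x = \int[mu]_a h (a + c)%R)%E.
Proof.
move=> mh h0.
rewrite (@ge0_integral_substitution _ (fun a => a + c) (fun=> 1))//.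
- by under eq_integral do rewrite mule1.
- move=> a b ab; split; first exact: integrable_cst_itv.
  rewrite Rintegral_cst// [X in fine X]lebesgue_itvcc// mul1r/=; ring.
- by move=> a b; rewrite lerD2r.
- by move=> y; exists (y - c); rewrite subrK.
Qed.

Lemma ge0_integral_itv_shift h c x y :
  measurable_fun setT h -> (forall x, (0 <= h x)%E) ->
  (\int[mu]_(a in `[(x + c)%R, (y + c)%R[) h a =
   \int[mu]_(a in `[x, y[) h (a + c)%R)%E.
Proof.
move=> mh h0; rewrite integral_mkcond (ge0_integral_shift c); last 2 first.
- apply/(measurable_restrictT _ _).1 => //; exact: measurable_funTS.
- by move=> a; apply: erestrict_ge0.
rewrite [RHS]integral_mkcond; apply: eq_integral => a _.
by rewrite !patchE !mem_setE !in_itv/= lerD2r ltrD2r.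
Qed.

(** Cut [x, x + 1[ at the integer [n + 1] following [x] and translate the second
    piece by -1 to obtain [n, n + 1[. *)
Lemma ge0_integral_periodic h x : measurable_fun setT h -> (forall x, (0 <= h x)%E) ->
  (forall a, h (a + 1) = h a) ->
  (\int[mu]_(a in `[x, (x + 1)%R[) h a = \int[mu]_(a in `[0%R, 1%R]) h a)%E.
Proof.
move=> mh h0 hp.
have hz (n : int) a : h (a + n%:~R) = h a.
  have hn (k : nat) b : h (b + k%:R) = h b.
    by elim: k => [|k IH]; rewrite ?addr0// -natr1 addrA hp.
  case: n => k; first by rewrite -pmulrn hn.
  by rewrite NegzE mulrNz -pmulrn -[in RHS](subrK k.+1%:R a) hn.
pose n : R := (Num.floor x)%:~R.
have nx : n <= x by exact: floor_le.
have xn : x < n + 1 by rewrite /n; have := floorD1_gt x; rewrite rmorphD.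
have mS (i j : R) : measurable_fun (`[i, j[%classic : set R) h by exact: measurable_funTS.
have cat (i j k : R) : i <= j -> j <= k ->
    (\int[mu]_(a in `[i, k[) h a = \int[mu]_(a in `[i, j[) h a + \int[mu]_(a in `[j, k[) h a)%E.
  move=> ij jk; rewrite (@itv_bndbnd_setU _ _ (BLeft i) (BLeft j) (BLeft k)) ?bnd_simp//.
  rewrite ge0_integral_setU//.
    exact: measurable_funTS.
  by apply/disj_setPS => a /=; rewrite !in_itv/= => -[/andP[_ aj] /andP[]]; rewrite leNgt aj.
have step (i j : R) : (\int[mu]_(a in `[(i + 1)%R, (j + 1)%R[) h a = \int[mu]_(a in `[i, j[) h a)%E.
  by rewrite ge0_integral_itv_shift//; apply: eq_integral => a _; rewrite hp.
rewrite (cat x (n + 1) (x + 1)) ?lerD2r//; last exact: ltW.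
rewrite step addeC -(cat n x (n + 1) nx (ltW xn)).
rewrite -[X in `[X, _[](add0r n) -[X in `[_, X[](addrC 1 n) ge0_integral_itv_shift//.
under eq_integral do rewrite hz.
by rewrite integral_itv_bndo_bndc//; exact: measurable_funTS.
Qed.

Variables (G rho : R -> R) (c C : R).
Hypotheses (mrho : measurable_fun setT rho) (c0 : 0 < c).
Hypothesis rhob : forall a, c <= rho a <= C.
Hypotheses (Grho : density G rho) (rhop : periodic rho 1).
Hypothesis Gp : forall a, G (a + 1) = G a + 1.

Let rho0 a : 0 <= rho a.
Proof. by have /andP[ca _] := rhob a; apply: le_trans ca; exact: ltW. Qed.

Let Gincr x y : x <= y -> c * (y - x) <= G y - G x <= C * (y - x).
Proof.
move=> xy; have [Gi ->] := Grho xy.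
have cE (k : R) : k * (y - x) = \int[mu]_(a in `[x, y]) k.
  by rewrite Rintegral_cst// [X in fine X]lebesgue_itvcc.
by rewrite !cE; apply/andP; split; apply: le_Rintegral => //;
  [exact: integrable_cst_itv|move=> a _; have /andP[]:= rhob a
  |exact: integrable_cst_itv|move=> a _; have /andP[]:= rhob a].
Qed.

Let Gmono : {mono G : x y / x <= y}.
Proof.
apply: le_mono => x y xy; have /andP[h _] := Gincr (ltW xy).
by rewrite -subr_gt0; apply: lt_le_trans h; rewrite mulr_gt0// subr_gt0.
Qed.

Let Gcont : continuous G.
Proof.
have C0 : 0 < C by have /andP[h1 h2] := rhob 0; exact: lt_le_trans (le_trans h1 h2).
move=> x; apply/cvgrPdist_le => e e0; near=> y.
have yx : `|x - y| <= e / C.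
  by near: y; apply: cvgr_dist_le; rewrite ?divr_gt0.
have {}yx : C * `|x - y| <= e by rewrite mulrC -ler_pdivlMr.
apply: le_trans yx.
have [xy|/ltW xy] := leP x y.
  have /andP[_ h] := Gincr xy.
  by rewrite distrC ger0_norm ?subr_ge0 ?Gmono// distrC ger0_norm ?subr_ge0.
have /andP[_ h] := Gincr xy.
by rewrite ger0_norm ?subr_ge0 ?Gmono// ger0_norm ?subr_ge0.
Unshelve. all: by end_near.
Qed.

Let Gsurj y : exists x, G x = y.
Proof.
have Gn (k : nat) b : G (b + k%:R) = G b + k%:R.
  by elim: k => [|k IH]; rewrite ?addr0// -natr1 addrA Gp IH addrA.
pose k := Num.bound `|y - G 0|.
have kb : `|y - G 0| < k%:R by apply: archi_boundP.
have GN : G (- k%:R) = G 0 - k%:R by rewrite -[G (- k%:R)](addrK k%:R) -Gn addNr.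
have GP : G k%:R = G 0 + k%:R by rewrite -[in LHS](add0r k%:R) Gn.
have kN : - k%:R <= k%:R :> R by rewrite -subr_ge0 opprK addr_ge0.
have [|||x _ <-] := @IVT _ G (- k%:R) k%:R y; first exact: kN.
- exact: continuous_subspaceT.
- rewrite GN GP; move: kb; rewrite ltr_norml => /andP[h1 h2].
  by rewrite ge_min le_max; apply/andP; split; apply/orP; [left|right]; lra.
- by exists x.
Qed.

(** [G] maps the period starting at the preimage of 0 onto [0, 1[; by periodicity
    that period may be replaced by [0, 1]. *)
Lemma ge0_integral_periodic_substitution f :
  measurable_fun setT f -> (forall x, (0 <= f x)%E) -> (forall x, f (x + 1) = f x) ->
  (\int[mu]_(x in `[0%R, 1%R]) f x =
   \int[mu]_(a in `[0%R, 1%R]) (f (G a) * (rho a)%:E))%E.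
Proof.
move=> mf f0 fp.
have [a0 Ga0] := Gsurj 0.
have mG : measurable_fun setT G by exact: continuous_measurable_fun.
rewrite -integral_itv_bndo_bndc; last exact: measurable_funTS.
rewrite integral_mkcond (ge0_integral_substitution mrho rho0 Grho Gmono Gsurj); last 2 first.
- by apply/(measurable_restrictT _ _).1 => //; exact: measurable_funTS.
- by move=> a; apply: erestrict_ge0.
rewrite -(@ge0_integral_periodic _ a0); last 3 first.
- apply: emeasurable_funM; last exact/measurable_EFinP.
  exact: measurableT_comp mf mG.
- by move=> a; rewrite mule_ge0// lee_fin.
- by move=> a; rewrite Gp fp rhop.
rewrite [RHS]integral_mkcond; apply: eq_integral => a _.
rewrite !patchE !mem_setE !in_itv/=.
have -> : (0 <= G a) = (a0 <= a) by rewrite -Ga0 Gmono.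
have -> : (G a < 1) = (a < a0 + 1) by rewrite -[1 in LHS]add0r -Ga0 -Gp !ltNge Gmono.
by case: ifP => //; rewrite mul0e.
Qed.

End periodic_substitution.

(** * Initial data and moments *)

(** One of the zeros is required to lie in [0, 1[, so that its right side is
    contained in [0, 1]; periodicity moves a zero at 1 to 0. *)
Definition linear_profile (R : realType) (g : R -> R) : Prop :=
  exists c : R, [/\ 0 < c, linear_vanishing g c,
    exists2 z, 0 <= z < 1 & linear_zero g c z &
    finite_set [set a | 0 <= a <= 1 /\ g a = 0]].

Section profile.
Variable R : realType.

Lemma finite_set_dist (A : set R) z : finite_set A -> ~ A z ->
  exists2 e : R, 0 < e & forall b, A b -> e <= `|z - b|.
Proof.
move=> /finite_seqP[s ->]; elim: s => [_|b s IH]; first by exists 1.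
rewrite /= inE => /negP; rewrite negb_or => /andP[zb zs].
have [|e e0 He] := IH; first by move=> /=; exact/negP.
exists (Num.min e `|z - b|); first by rewrite lt_min e0 normr_gt0 subr_eq0.
move=> b' /=; rewrite inE => /predU1P[->|b's]; first by rewrite ge_min lexx orbT.
by rewrite ge_min He.
Qed.

(** Away from the finite zero set, the separation hypothesis bounds [g] below on a
    neighbourhood, which yields the dichotomy of [linear_vanishing]. *)
Lemma linear_profileP (g : R -> R) (c : R) : 0 < c ->
  (forall a, g (a + 1) = g a) ->
  [set a | 0 <= a <= 1 /\ g a = 0] !=set0 ->
  finite_set [set a | 0 <= a <= 1 /\ g a = 0] ->
  (forall e, 0 < e -> exists2 d : R, 0 < d & forall a, 0 <= a <= 1 ->
     (forall b, 0 <= b <= 1 /\ g b = 0 -> e <= `|a - b|) -> d <= g a) ->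
  (forall b, 0 <= b <= 1 -> g b = 0 -> (g a / (c * `|a - b|)) @[a --> b^'] --> (1 : R)) ->
  linear_profile g.
Proof.
move=> c0 gp [z [z01 gz]] gfin gsep gprof; exists c; split => //.
- move=> x x01; have [gx|gx] := eqVneq (g x) 0; [right|left].
    by split => //; exact: gprof.
  have [|e e0 He] := finite_set_dist (z := x) gfin; first by move=> [_ /eqP]; apply/negP.
  have [|d d0 Hd] := gsep (e / 2); first by rewrite divr_gt0.
  exists (e / 2, d); split => //=; first by rewrite divr_gt0.
  move=> a a01 ax; apply: Hd => // b Zb; have := He b Zb.
  have := ler_distD a x b; rewrite [`|x - a|]distrC; lra.
- have [zE|z1] := eqVneq z 1.
    exists 0; first by rewrite lexx ltr01.
    have g0 : g 0 = 0 by rewrite -gp add0r -zE.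
    by split => //; apply: gprof => //; rewrite lexx ler01.
  case/andP: (z01) => z0 z1'; exists z; last by split => //; exact: gprof.
  by rewrite z0 lt_neqAle z1.
Qed.

Variables (u0 du0 : R -> R) (M0 m0 : R).
Hypothesis hdata : admissible_data u0 du0 M0 m0.

Lemma level_pointsE c b : level_points du0 c b <-> 0 <= b <= 1 /\ du0 b = c.
Proof. by rewrite /level_points/= in_itv. Qed.

Lemma max_linear_profile C1 : C1 < 0 -> linear_max_profile du0 M0 C1 ->
  linear_profile (fun a => M0 - du0 a).
Proof.
move=> C10 hp.
have Z b : (0 <= b <= 1 /\ M0 - du0 b = 0) <-> level_points du0 M0 b.
  rewrite level_pointsE; split=> -[b01 h]; split=> //; last by rewrite h subrr.
  by apply/esym/eqP; rewrite -subr_eq0 h.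
have ZE : [set a | 0 <= a <= 1 /\ M0 - du0 a = 0] = level_points du0 M0.
  by apply/seteqP; split => b /=; apply Z.
apply: (@linear_profileP _ `|C1|); rewrite ?ZE ?normr_gt0 ?lt_eqF//.
- by move=> a; rewrite (data_du0_periodic hdata).
- exact: data_max_attained hdata.
- exact: data_max_finite hdata.
- move=> e /(data_max_separated hdata)[d d0 Hd]; exists d => // a a01 Ha.
  have := Hd a; rewrite in_itv/= => /(_ a01); rewrite lerBrDl addrC -lerBrDl; apply.
  by move=> b /Z; exact: Ha.
- by move=> b b01 gb; apply: hp; apply/Z.
Qed.

Lemma min_linear_profile C2 : 0 < C2 -> linear_min_profile du0 m0 C2 ->
  linear_profile (fun a => du0 a - m0).
Proof.
move=> C20 hp.
have Z b : (0 <= b <= 1 /\ du0 b - m0 = 0) <-> level_points du0 m0 b.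
  rewrite level_pointsE; split=> -[b01 h]; split=> //; last by rewrite h subrr.
  by apply/eqP; rewrite -subr_eq0 h.
have ZE : [set a | 0 <= a <= 1 /\ du0 a - m0 = 0] = level_points du0 m0.
  by apply/seteqP; split => b /=; apply Z.
apply: (@linear_profileP _ C2); rewrite ?ZE//.
- by move=> a; rewrite (data_du0_periodic hdata).
- exact: data_min_attained hdata.
- exact: data_min_finite hdata.
- move=> e /(data_min_separated hdata)[d d0 Hd]; exists d => // a a01 Ha.
  have := Hd a; rewrite in_itv/= => /(_ a01); rewrite lerBrDl; apply.
  by move=> b /Z; exact: Ha.
- by move=> b b01 gb; apply: hp; apply/Z.
Qed.

Lemma density_measurable (f f' : R -> R) : density f f' -> measurable_fun setT f'.
Proof.
move=> ff'; have -> : [set: R] = \bigcup_n `[- n%:R, n%:R]%classic.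
  by apply/esym; rewrite -subTset => x _; exists (Num.bound `|x|) => //=;
    rewrite in_itv/= -ler_norml ltW// archi_boundP.
apply/measurable_fun_bigcup => // n.
by have [|/measurable_int/measurable_EFinP] := ff' (- n%:R) n%:R;
  first by rewrite -subr_ge0 opprK addr_ge0.
Qed.

Lemma measurable_du0 : measurable_fun setT du0.
Proof. exact: density_measurable (data_density hdata). Qed.

End profile.

Section moments.
Variable R : realType.
Local Notation mu := (@lebesgue_measure R).
Variables (lambda M0 m0 : R) (u0 du0 : R -> R).
Hypothesis hdata : admissible_data u0 du0 M0 m0.
Hypothesis lambda0 : lambda != 0.

Local Notation J := (J lambda du0).

(** The velocity gradient along characteristics is an affine function of
    [du0 / J], and the moments of [du0 / J] for the weight [J ^ (- 1 / lambda)]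
    are regular up to time 0, where the quotients of the explicit formula for
    [ux] degenerate to 0 / 0. *)
Definition moment (j : nat) (s : R) : R :=
  \int[mu]_(a in `[0, 1]) (du0 a ^+ j * J a s `^ (- j%:R - lambda^-1)).

(** Times at which the Jacobian factor [J] is bounded below by a positive
    constant; an open condition, so that also derivatives at time 0 are
    two-sided in this variable. *)
Definition regular (s : R) : bool := (0 < 1 - lambda * s * M0) && (0 < 1 - lambda * s * m0).

Lemma regular_itv s : 0 <= s < eta_star lambda M0 m0 -> regular s.
Proof.
have /andP[m0n M0p] := data_sign hdata.
rewrite /eta_star => /andP[s0]; case: ifPn => [l0|]; last rewrite -leNgt => l0.
  rewrite -[X in _ < X]mul1r ltr_pdivlMr ?mulr_gt0// => h.
  have ls : 0 <= lambda * s by rewrite mulr_ge0// ltW.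
  by apply/andP; split; nra.
have l0' : lambda < 0 by rewrite lt_neqAle lambda0.
have lm : 0 < lambda * m0 by rewrite nmulr_rgt0.
rewrite -[X in _ < X]mul1r ltr_pdivlMr// => h.
have ls : lambda * s <= 0 by rewrite nmulr_rle0.
by apply/andP; split; nra.
Qed.

Lemma J_bounds k K a s : k <= 1 - lambda * s * M0 <= K -> k <= 1 - lambda * s * m0 <= K ->
  k <= J a s <= K.
Proof.
move=> /andP[h1 h2] /andP[h3 h4]; have /andP[ma aM] := data_bounds hdata a.
rewrite /J; have [ls|ls] := leP 0 (lambda * s); apply/andP; split; nra.
Qed.

Lemma regular_J s : regular s -> exists k K : R, 0 < k /\ forall a, k <= J a s <= K.
Proof.
move=> /andP[h1 h2].
exists (Num.min (1 - lambda * s * M0) (1 - lambda * s * m0)),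
       (Num.max (1 - lambda * s * M0) (1 - lambda * s * m0)).
split=> [|a]; first by rewrite lt_min h1.
by apply: J_bounds; rewrite ge_min le_max lexx ?orbT/= ?orbT.
Qed.

Lemma J_gt0 a s : regular s -> 0 < J a s.
Proof.
move=> /regular_J[k [K [k0 /(_ a)/andP[h _]]]]; exact: lt_le_trans h.
Qed.

Lemma powR_le_ends (k K x b : R) : 0 < k -> k <= x <= K -> x `^ b <= k `^ b + K `^ b.
Proof.
move=> k0 /andP[kx xK]; have [b0|b0] := leP b 0.
  by rewrite -(opprK b) ler_wpDr ?powR_ge0//; apply: ler_powRN; rewrite ?oppr_ge0.
rewrite ler_wpDl ?powR_ge0//; apply: ge0_ler_powR; rewrite ?nnegrE//; first exact: ltW.
  by apply: le_trans kx; exact: ltW.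
by apply: le_trans (le_trans kx xK); exact: ltW.
Qed.

Let D := Num.max M0 (- m0).

Lemma du0_norm a : `|du0 a| <= D.
Proof.
have /andP[ma aM] := data_bounds hdata a.
rewrite ler_norml lerNl /D !le_max; apply/andP; split; apply/orP; [right|left] => //.
by rewrite lerN2.
Qed.

Lemma measurable_J s : measurable_fun setT (J^~ s).
Proof.
apply: measurable_funB => //; apply: measurable_funM => //.
exact: measurable_du0 hdata.
Qed.

Lemma measurable_moment_integrand j b s :
  measurable_fun setT (fun a => du0 a ^+ j * J a s `^ b).
Proof.
apply: measurable_funM.
  by apply: measurable_funX; exact: measurable_du0 hdata.
by apply: measurable_powRl; exact: measurable_J.
Qed.

Lemma moment_integrand_le k K j b a s : 0 < k -> k <= J a s <= K ->
  `|du0 a ^+ j * J a s `^ b| <= D ^+ j * (k `^ b + K `^ b).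
Proof.
move=> k0 kJK; rewrite normrM normrX (ger0_norm (powR_ge0 _ _)).
apply: ler_pM; rewrite ?exprn_ge0 ?powR_ge0//; last exact: powR_le_ends.
by apply: lerXn2r; rewrite ?nnegrE ?du0_norm//; apply: le_trans (du0_norm a).
Qed.

Lemma integrable_moment j b s : regular s ->
  mu.-integrable `[0, 1] (EFin \o (fun a => du0 a ^+ j * J a s `^ b)).
Proof.
move=> /regular_J[k [K [k0 kK]]].
apply: (@bounded_integrable_itv _ _ _ _ (D ^+ j * (k `^ b + K `^ b))).
  by apply: measurable_funTS; exact: measurable_moment_integrand.
by move=> a _; exact: moment_integrand_le.
Qed.

Lemma Kbar_moment s : Kbar lambda du0 0 s = moment 0 s.
Proof. by apply: eq_Rintegral => a _; rewrite expr0 mul1r. Qed.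

Lemma moment0_gt0 s : regular s -> 0 < moment 0 s.
Proof.
move=> rs; have [k [K [k0 kK]]] := regular_J rs.
set b := - 0%:R - lambda^-1.
have K0 : 0 < K by have /andP[h1 h2] := kK 0; apply: lt_le_trans (le_trans h1 h2).
have [C C0 HC] : exists2 C : R, 0 < C & forall a, C <= J a s `^ b.
  exists (Num.min (k `^ b) (K `^ b)); first by rewrite lt_min !powR_gt0.
  move=> a; have /andP[h1 h2] := kK a; have J0 := lt_le_trans k0 h1.
  have [b0|b0] := leP b 0; rewrite ge_min; apply/orP; [right|left].
    by rewrite -(opprK b); apply: ler_powRN; rewrite ?oppr_ge0.
  by apply: ge0_ler_powR; rewrite ?nnegrE// ?ltW.
apply: (@lt_le_trans _ _ C) => //.
have -> : C = \int[mu]_(a in `[0, 1]) C.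
  by rewrite Rintegral_cst// [X in fine X]lebesgue_itvcc// subr0 mulr1.
apply: le_Rintegral => //.
- exact: integrable_cst_itv.
- exact: integrable_moment.
- by move=> a _; rewrite expr0 mul1r.
Qed.

Lemma regular_near s : regular s -> exists u v k K : R, [/\ u < s < v, 0 < k &
  forall x a, u < x < v -> k <= J a x <= K].
Proof.
move=> /andP[h1 h2].
pose k := Num.min (1 - lambda * s * M0) (1 - lambda * s * m0) / 2.
have k0 : 0 < k by rewrite divr_gt0// lt_min h1.
have k2 : k + k <= 1 - lambda * s * M0 /\ k + k <= 1 - lambda * s * m0.
  rewrite -[k + k]mulr2n -mulr_natr /k divfK ?pnatr_eq0//.
  by rewrite !ge_min !lexx orbT.
case: k2; move: k k0 => k k0 k1 k2.
pose q := `|lambda| * (`|M0| + `|m0|) + 1.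
have q0 : 0 < q by rewrite ltr_wpDl// mulr_ge0// addr_ge0.
exists (s - k / q), (s + k / q), k,
  (Num.max (1 - lambda * s * M0) (1 - lambda * s * m0) + k); split => //.
  by rewrite ltrBlDr !ltrDl !divr_gt0.
move=> x a /andP[sx xs].
have xsn : `|x - s| * q <= k.
  by rewrite -ler_pdivlMr// ler_norml; apply/andP; split; lra.
have bnd c : `|c| <= `|M0| + `|m0| -> `|lambda * (x - s) * c| <= k.
  move=> cM; apply: le_trans xsn; rewrite mulrAC normrM mulrC ler_wpM2l//.
  rewrite normrM /q; have : `|lambda| * `|c| <= `|lambda| * (`|M0| + `|m0|) by rewrite ler_wpM2l.
  lra.
have b1 : `|lambda * (x - s) * M0| <= k by apply: bnd; rewrite lerDl.
have b2 : `|lambda * (x - s) * m0| <= k by apply: bnd; rewrite lerDr.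
move: b1 b2; rewrite !ler_norml => /andP[b1 b1'] /andP[b2 b2'].
have m1 : 1 - lambda * s * M0 <= Num.max (1 - lambda * s * M0) (1 - lambda * s * m0).
  by rewrite le_max lexx.
have m2 : 1 - lambda * s * m0 <= Num.max (1 - lambda * s * M0) (1 - lambda * s * m0).
  by rewrite le_max lexx orbT.
have E1 : 1 - lambda * x * M0 = 1 - lambda * s * M0 - lambda * (x - s) * M0 by ring.
have E2 : 1 - lambda * x * m0 = 1 - lambda * s * m0 - lambda * (x - s) * m0 by ring.
by apply: J_bounds; rewrite ?E1 ?E2; apply/andP; split; lra.
Qed.

(** Since [J] has the derivative [- lambda * du0] in [s], differentiating the
    power lowers the exponent by one and produces one more factor [du0]. *)
Lemma is_derive_moment j s : regular s ->
  is_derive s 1 (moment j) ((j%:R * lambda + 1) * moment j.+1 s).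
Proof.
move=> rs; have [u [v [k [K [usv k0 kK]]]]] := regular_near rs.
set b := - j%:R - lambda^-1.
pose f (x a : R) := du0 a ^+ j * J a x `^ b.
have df x a : u < x < v -> is_derive x 1 (f^~ a)
    ((j%:R * lambda + 1) * (du0 a ^+ j.+1 * J a x `^ (- j.+1%:R - lambda^-1))).
  move=> uxv; have /andP[kJ _] := kK x a uxv.
  have JE y : J a y = 1 + (- (lambda * du0 a)) * y by rewrite /J; ring.
  have J0 : 0 < 1 + (- (lambda * du0 a)) * x by rewrite -JE; exact: lt_le_trans kJ.
  have D1 := is_derive_powR_affine b J0.
  rewrite /f (_ : (fun y => _) = fun y => du0 a ^+ j * (1 + (- (lambda * du0 a)) * y) `^ b).
    apply: is_derive_eq; rewrite /GRing.scale/= JE.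
    have -> : b - 1 = - j.+1%:R - lambda^-1 by rewrite /b -natr1; ring.
    by rewrite exprS /b; field.
  by apply/funext => y; rewrite JE.
have d1f x a : u < x < v -> partial1of2 f x a =
    (j%:R * lambda + 1) * (du0 a ^+ j.+1 * J a x `^ (- j.+1%:R - lambda^-1)).
  by move=> uxv; rewrite partial1of2E; have [_ ->] := df x a uxv.
have mf x : measurable_fun setT (f x) by exact: measurable_moment_integrand.
have fi x : `]u, v[%classic x -> mu.-integrable `[0, 1] (EFin \o f x).
  rewrite /= in_itv/= => uxv.
  apply: (@bounded_integrable_itv _ _ _ _ (D ^+ j * (k `^ b + K `^ b))).
    exact: measurable_funTS.
  by move=> a _; apply: moment_integrand_le => //; exact: kK.
have der x a : `]u, v[%classic x -> `[0, 1]%classic a -> derivable (f^~ a) x 1.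
  by rewrite /= in_itv/= => uxv _; have [] := df x a uxv.
pose c := `|j%:R * lambda + 1| * (D ^+ j.+1 *
  (k `^ (- j.+1%:R - lambda^-1) + K `^ (- j.+1%:R - lambda^-1))).
have D0 : 0 <= D by exact: le_trans (du0_norm 0).
have c0 (a : R) : 0 <= c by rewrite mulr_ge0// mulr_ge0 ?exprn_ge0// addr_ge0 ?powR_ge0.
have ci : mu.-integrable `[0, 1] (EFin \o (fun=> c)) by exact: integrable_cst_itv.
have fc x a : `]u, v[%classic x -> `[0, 1]%classic a -> `|partial1of2 f x a| <= c.
  rewrite /= in_itv/= => uxv _; rewrite d1f// normrM /c; apply: ler_wpM2l => //.
  by apply: moment_integrand_le => //; exact: kK.
have sI : `]u, v[%classic s by rewrite /= in_itv.
have mI : measurable (`[0, 1]%classic : set R) by [].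
have H1 := @derivable_under_integral R _ _ mu f _ mI s u v sI fi der (fun=> c) c0 ci fc.
have H2 := @differentiation_under_integral R _ _ mu f _ mI s u v sI fi der (fun=> c) c0 ci fc.
apply: DeriveDef; first exact: H1.
rewrite -derive1E H2 -RintegralZl//; last first.
  exact: integrable_moment.
by apply: eq_Rintegral => a _; rewrite d1f.
Qed.

End moments.

(** * Distance to the singularity *)

Section rescaling.
Variables (R : realType) (sg k y i0 i1 i2 i3 x : R).
Hypotheses (sg2 : sg * sg = 1) (k0 : k != 0) (y0 : y != 0) (i00 : i0 != 0).

(** This identity and the next one carry central moments from [du0 / J] to [(e + g)^-1]: the
    two variables differ by an affine map, which shifts and scales. *)
Lemma rescaled_variance :
  k ^+ 4 * x * (k ^- 2 * y * (k ^- 2 * i2 - 2 * k^-1 * i1 + i0) / (y * i0) -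
    (sg * k^-1 * y * (k^-1 * i1 - i0) / (y * i0)) ^+ 2) =
  x * (i2 / i0 - (i1 / i0) ^+ 2).
Proof.
have -> : (sg * k^-1 * y * (k^-1 * i1 - i0) / (y * i0)) ^+ 2 =
  (sg * sg) * (k^-1 * y * (k^-1 * i1 - i0) / (y * i0)) ^+ 2 by ring.
by rewrite sg2; field; rewrite ?y0 ?k0 ?i00.
Qed.

Lemma rescaled_third_moment :
  k ^+ 6 * x * (sg * k ^- 3 * y *
      (k ^- 3 * i3 - 3 * k ^- 2 * i2 + 3 * k^-1 * i1 - i0) / (y * i0)
    - 3 * (sg * k^-1 * y * (k^-1 * i1 - i0) / (y * i0)) *
      (k ^- 2 * y * (k ^- 2 * i2 - 2 * k^-1 * i1 + i0) / (y * i0))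
    + 2 * (sg * k^-1 * y * (k^-1 * i1 - i0) / (y * i0)) ^+ 3) =
  sg * (x * (i3 / i0 - 3 * (i1 / i0) * (i2 / i0) + 2 * (i1 / i0) ^+ 3)).
Proof.
have -> : (sg * k^-1 * y * (k^-1 * i1 - i0) / (y * i0)) ^+ 3 =
  (sg * sg) * sg * (k^-1 * y * (k^-1 * i1 - i0) / (y * i0)) ^+ 3 by ring.
by rewrite sg2; field; rewrite ?y0 ?k0 ?i00.
Qed.

Lemma rescaled_gradient (t : R) : t != 0 ->
  k ^+ 2 * x * (sg * (k^-1 - t) / (k * t) -
     sg * k^-1 * y * (k^-1 * i1 - i0) / (y * i0)) =
  sg * (x * (t^-1 - i1 / i0)).
Proof. by move=> t0; field; rewrite ?y0 ?k0 ?i00 ?t0. Qed.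

Lemma rescaled_deviation (t : R) :
  x * t / i0 * (i2 - 2 * (i1 / i0) * i1 + (i1 / i0) ^+ 2 * i0) =
  x * t * (i2 / i0 - (i1 / i0) ^+ 2).
Proof. by field. Qed.

End rescaling.

Section distance_to_singularity.
Variable R : realType.
Local Notation mu := (@lebesgue_measure R).
Variables (lambda M0 m0 : R) (u0 du0 : R -> R).
Hypothesis hdata : admissible_data u0 du0 M0 m0.
Hypothesis lambda0 : lambda != 0.

Local Notation J := (J lambda du0).
Local Notation v := (lambda^-1).
Local Notation mom := (moment lambda du0).
Local Notation es := (eta_star lambda M0 m0).

(** For [s > 0], [J a s = `|lambda| * s * (excess s + gap a)]: [gap] is the
    distance of [du0] to the extreme value that causes the blow-up, and [excess]
    decreases to 0 as [s] increases to [eta_star]. *)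
Definition extreme : R := if 0 < lambda then M0 else - m0.
Definition gap (a : R) : R := if 0 < lambda then M0 - du0 a else du0 a - m0.
Definition excess (s : R) : R := (`|lambda| * s)^-1 - extreme.

Local Notation I := (shift_moment gap v).
Local Notation sg := (Num.sg lambda).

Lemma extreme_gt0 : 0 < extreme.
Proof.
by have /andP[h1 h2] := data_sign hdata; rewrite /extreme; case: ifP; rewrite ?oppr_gt0.
Qed.

Lemma gap_ge0 a : 0 <= gap a.
Proof.
by have /andP[h1 h2] := data_bounds hdata a; rewrite /gap; case: ifP; rewrite subr_ge0.
Qed.

Lemma gap_le a : gap a <= M0 - m0.
Proof.
by have /andP[h1 h2] := data_bounds hdata a; rewrite /gap; case: ifP => _; lra.
Qed.

Lemma measurable_gap : measurable_fun setT gap.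
Proof.
have md := measurable_du0 hdata.
by rewrite /gap; case: (0 < lambda); exact: measurable_funB.
Qed.

Lemma eta_starE : es = (`|lambda| * extreme)^-1.
Proof.
rewrite /eta_star /extreme; case: ifPn => [l0|]; first by rewrite gtr0_norm.
by rewrite -leNgt => l0; rewrite ler0_norm// mulrNN.
Qed.

Let nl0 : 0 < `|lambda|. Proof. by rewrite normr_gt0. Qed.

Lemma eta_star_gt0 : 0 < es.
Proof. by rewrite eta_starE invr_gt0 mulr_gt0// extreme_gt0. Qed.

Lemma sgE : sg * `|lambda| = lambda.
Proof. by rewrite -numEsg. Qed.

Lemma sg2 : sg * sg = 1.
Proof. by have := sqr_sg lambda; rewrite lambda0 expr2. Qed.

Lemma du0_gap a : du0 a = sg * (extreme - gap a).
Proof.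
rewrite /extreme /gap; case: ifPn => [l0|]; first by rewrite gtr0_sg// mul1r; ring.
rewrite -leNgt => l0; rewrite ltr0_sg; last by rewrite lt_neqAle lambda0.
ring.
Qed.

(** Along the characteristic issued from [a], at the time where [eta] equals
    [s]: the value of the velocity gradient and the Jacobian of the flow. *)
Definition gradient (a s : R) : R :=
  mom 0 s `^ (- (2 * lambda)) * (du0 a / J a s - mom 1 s / mom 0 s).

Definition flow_jacobian (a s : R) : R := J a s `^ (- v) / mom 0 s.

Definition gradient_moment (p s : R) : R :=
  \int[mu]_(a in `[0, 1]) (`|gradient a s| `^ p * flow_jacobian a s).

(** Up to a power of [moment 0], the second and third central moments of
    [du0 / J] for the probability density [flow_jacobian]: the energy and, up to
    the factor [1 + 2 * lambda], its time derivative. *)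
Definition flow_energy (s : R) : R :=
  mom 0 s `^ (- (4 * lambda)) * (mom 2 s / mom 0 s - (mom 1 s / mom 0 s) ^+ 2).

Definition flow_third_moment (s : R) : R :=
  mom 0 s `^ (- (6 * lambda)) * (mom 3 s / mom 0 s
     - 3 * (mom 1 s / mom 0 s) * (mom 2 s / mom 0 s) + 2 * (mom 1 s / mom 0 s) ^+ 3).

Lemma jacobian_ge0 a s : 0 <= flow_jacobian a s.
Proof. by rewrite divr_ge0 ?powR_ge0// Rintegral_ge0// => b _;
  rewrite expr0 mul1r powR_ge0. Qed.

Lemma measurable_gradient s : regular lambda M0 m0 s ->
  measurable_fun setT (gradient^~ s).
Proof.
move=> rs; apply: measurable_funM => //; apply: measurable_funB => //.
rewrite (_ : (fun a => du0 a / J a s) = fun a => du0 a ^+ 1 * J a s `^ (- 1)).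
  exact: measurable_moment_integrand hdata _ _ _.
by apply/funext => a; rewrite expr1 powR_inv1// ltW// (J_gt0 hdata).
Qed.

Lemma measurable_jacobian s : measurable_fun setT (flow_jacobian^~ s).
Proof.
apply: measurable_funM => //; apply: measurable_powRl.
exact: measurable_J hdata _.
Qed.

Lemma gradient_bounded s : regular lambda M0 m0 s ->
  exists C : R, forall a, `|gradient a s| <= C.
Proof.
move=> rs; have [k [K [k0 kK]]] := regular_J hdata rs.
exists (mom 0 s `^ (- (2 * lambda)) *
  (Num.max M0 (- m0) / k + `|mom 1 s / mom 0 s|)) => a.
rewrite normrM (ger0_norm (powR_ge0 _ _)); apply: ler_wpM2l; first exact: powR_ge0.
apply: le_trans (ler_normB _ _) _; rewrite lerD2r normrM.
have /andP[kJ _] := kK a; have J0 := lt_le_trans k0 kJ.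
apply: ler_pM => //; first exact: (du0_norm hdata).
by rewrite ger0_norm ?invr_ge0 ?(ltW J0)// lef_pV2 ?posrE.
Qed.

Lemma jacobian_bounds s : regular lambda M0 m0 s ->
  exists c C : R, 0 < c /\ forall a, c <= flow_jacobian a s <= C.
Proof.
move=> rs; have [k [K [k0 kK]]] := regular_J hdata rs.
have m00 := moment0_gt0 hdata rs.
have K0 : 0 < K by have /andP[h1 h2] := kK 0; apply: lt_le_trans (le_trans h1 h2).
exists (Num.min (k `^ (- v)) (K `^ (- v)) / mom 0 s), ((k `^ (- v) + K `^ (- v)) / mom 0 s).
split=> [|a]; first by rewrite divr_gt0// lt_min !powR_gt0.
have /andP[h1 h2] := kK a; have J0 := lt_le_trans k0 h1.
apply/andP; split; (apply: ler_wpM2r; first by rewrite invr_ge0 ltW); last exact: powR_le_ends.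
rewrite ge_min; apply/orP; have [v0|v0] := leP 0 v; [right|left].
  exact: ler_powRN.
by apply: ge0_ler_powR; rewrite ?nnegrE ?oppr_ge0//; exact: ltW.
Qed.

Lemma integrable_gradient_moment p s : 0 <= p -> regular lambda M0 m0 s ->
  mu.-integrable `[0, 1] (EFin \o (fun a => `|gradient a s| `^ p * flow_jacobian a s)).
Proof.
move=> p0 rs; have [C HC] := gradient_bounded rs.
have [c [C' [c0 HC']]] := jacobian_bounds rs.
apply: (@bounded_integrable_itv _ _ _ _ (C `^ p * C')).
  apply: measurable_funTS; apply: measurable_funM; last exact: measurable_jacobian.
  by apply: measurable_powRl; apply: measurableT_comp => //; exact: measurable_gradient.
move=> a _; rewrite normrM (ger0_norm (powR_ge0 _ _)) (ger0_norm (jacobian_ge0 _ _)).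
apply: ler_pM; rewrite ?powR_ge0 ?jacobian_ge0//; last by have /andP[] := HC' a.
by apply: ge0_ler_powR; rewrite ?nnegrE//; apply: le_trans (HC a).
Qed.

Lemma integral_jacobian s : regular lambda M0 m0 s ->
  \int[mu]_(a in `[0, 1]) flow_jacobian a s = 1.
Proof.
move=> rs; have m00 := moment0_gt0 hdata rs.
have E : \int[mu]_(a in `[0, 1]) J a s `^ (- v) = mom 0 s.
  by apply: eq_Rintegral => a _; rewrite expr0 mul1r oppr0 add0r.
rewrite /flow_jacobian RintegralZr// ?E ?mulfV ?gt_eqF//.
apply: eq_integrable (integrable_moment hdata 0 (- v) rs) => //.
by move=> a _ /=; rewrite mul1r.
Qed.

Lemma integrable_jacobian s : regular lambda M0 m0 s ->
  mu.-integrable `[0, 1] (EFin \o (flow_jacobian^~ s)).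
Proof.
move=> rs; apply: eq_integrable (integrable_gradient_moment (lexx 0) rs) => //.
by move=> a _ /=; rewrite powRr0 mul1r.
Qed.

Section at_time.
Variable s : R.
Hypothesis s0e : 0 < s < es.

Local Notation kap := (`|lambda| * s).
Local Notation e := (excess s).

Let s0 : 0 < s. Proof. by case/andP: s0e. Qed.
Let kap0 : 0 < kap. Proof. by rewrite mulr_gt0. Qed.

Lemma excess_gt0 : 0 < e.
Proof.
have /andP[_] := s0e; rewrite eta_starE => ses; rewrite /excess subr_gt0.
rewrite -[extreme]invrK ltf_pV2 ?posrE ?invr_gt0 ?extreme_gt0//.
by rewrite mulrC -ltr_pdivlMr// -invfM mulrC.
Qed.

Let h a := e + gap a.

Let h0 a : 0 < h a.
Proof. by rewrite ltr_wpDr ?gap_ge0// excess_gt0. Qed.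

Lemma regular_time : regular lambda M0 m0 s.
Proof. by apply: (regular_itv hdata lambda0); case/andP: s0e => /ltW ->. Qed.

Lemma du0_shift a : du0 a = sg * (kap^-1 - h a).
Proof. by rewrite du0_gap /h /excess; congr (_ * _); ring. Qed.

Lemma J_shift a : J a s = kap * h a.
Proof.
rewrite /Defs.J du0_shift.
rewrite (_ : lambda * s * _ = (sg * sg) * (kap * (kap^-1 - h a))); last first.
  by rewrite -{1}sgE; ring.
by rewrite sg2 mul1r mulrBr mulfV ?gt_eqF//; ring.
Qed.

Let Jpow b a : J a s `^ b = kap `^ b * h a `^ b.
Proof. by rewrite J_shift powRM ?ltW// h0. Qed.

Let hi b : mu.-integrable `[0, 1] (EFin \o (fun a => h a `^ b)).
Proof.
apply: (@integrable_shift_any _ gap (M0 - m0) measurable_gap gap_ge0 gap_le).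
exact: excess_gt0.
Qed.

Lemma shift_moment_gap_gt0 : 0 < I 0 e.
Proof.
have := moment0_gt0 hdata regular_time; rewrite /moment.
under eq_Rintegral do rewrite expr0 mul1r Jpow.
by rewrite RintegralZl//= pmulr_rgt0// powR_gt0.
Qed.

Let hS b a : h a * h a `^ b = h a `^ (1 + b).
Proof. by rewrite gt0_powRD// powRr1 ?ltW. Qed.

Lemma moment0_shift : mom 0 s = kap `^ (- v) * I 0 e.
Proof.
rewrite /moment; under eq_Rintegral do rewrite expr0 mul1r Jpow.
by rewrite RintegralZl//=; congr (_ `^ _ * _); rewrite oppr0 add0r.
Qed.

Let kS i : kap `^ (- i%:R - v) = kap ^- i * kap `^ (- v).
Proof. by rewrite gt0_powRD// powR_invn// ltW. Qed.

Let hI i : \int[mu]_(a in `[0, 1]) h a `^ (- i%:R - v) = I i e.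
Proof. by []. Qed.

Let kh i : mu.-integrable `[0, 1] (EFin \o (fun a => h a `^ (- i%:R - v))).
Proof. exact: hi. Qed.

(** Expanding [du0 ^ j = (sg * (kap^-1 - h)) ^ j] expresses the moments through
    the negative moments of the shifted profile [h]. *)
Lemma moment1_shift : mom 1 s = sg * kap^-1 * kap `^ (- v) * (kap^-1 * I 1 e - I 0 e).
Proof.
pose f a := kap^-1 * h a `^ (- 1%:R - v) - h a `^ (- 0%:R - v).
have i1 : mu.-integrable `[0, 1] (EFin \o (fun a => kap^-1 * h a `^ (- 1%:R - v))).
  exact: integrable_mulrl.
have fi : mu.-integrable `[0, 1] (EFin \o f) by exact: integrable_subr.
transitivity (\int[mu]_(a in `[0, 1]) (sg * kap^-1 * kap `^ (- v) * f a)).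
  apply: eq_Rintegral => a _; rewrite expr1 du0_shift Jpow kS /f.
  have -> : - 0%:R - v = 1 + (- 1%:R - v) by ring.
  by rewrite -hS; ring.
by rewrite RintegralZl// RintegralB// RintegralZl.
Qed.

Lemma moment2_shift : mom 2 s =
  kap ^- 2 * kap `^ (- v) * (kap ^- 2 * I 2 e - 2 * kap^-1 * I 1 e + I 0 e).
Proof.
pose f1 a := kap ^- 2 * h a `^ (- 2%:R - v).
pose f2 a := 2 * kap^-1 * h a `^ (- 1%:R - v).
pose f3 a := f1 a - f2 a.
pose f a := f3 a + h a `^ (- 0%:R - v).
have i1 : mu.-integrable `[0, 1] (EFin \o f1) by exact: integrable_mulrl.
have i2 : mu.-integrable `[0, 1] (EFin \o f2) by exact: integrable_mulrl.
have i3 : mu.-integrable `[0, 1] (EFin \o f3) by exact: integrable_subr.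
have fi : mu.-integrable `[0, 1] (EFin \o f) by exact: integrable_addr.
transitivity (\int[mu]_(a in `[0, 1]) (kap ^- 2 * kap `^ (- v) * f a)).
  apply: eq_Rintegral => a _; rewrite du0_shift exprMn expr2 sg2 mul1r Jpow kS.
  rewrite /f /f3 /f1 /f2.
  have -> : - 0%:R - v = 1 + (1 + (- 2%:R - v)) by ring.
  have -> : - 1%:R - v = 1 + (- 2%:R - v) by ring.
  by rewrite -!hS; field; rewrite !gt_eqF.
by rewrite RintegralZl// RintegralD// RintegralB// RintegralZl// RintegralZl.
Qed.

Lemma moment3_shift : mom 3 s =
  sg * kap ^- 3 * kap `^ (- v) *
   (kap ^- 3 * I 3 e - 3 * kap ^- 2 * I 2 e + 3 * kap^-1 * I 1 e - I 0 e).
Proof.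
pose f1 a := kap ^- 3 * h a `^ (- 3%:R - v).
pose f2 a := 3 * kap ^- 2 * h a `^ (- 2%:R - v).
pose f3 a := 3 * kap^-1 * h a `^ (- 1%:R - v).
pose f4 a := f1 a - f2 a.
pose f5 a := f4 a + f3 a.
pose f a := f5 a - h a `^ (- 0%:R - v).
have i1 : mu.-integrable `[0, 1] (EFin \o f1) by exact: integrable_mulrl.
have i2 : mu.-integrable `[0, 1] (EFin \o f2) by exact: integrable_mulrl.
have i3 : mu.-integrable `[0, 1] (EFin \o f3) by exact: integrable_mulrl.
have i4 : mu.-integrable `[0, 1] (EFin \o f4) by exact: integrable_subr.
have i5 : mu.-integrable `[0, 1] (EFin \o f5) by exact: integrable_addr.
have fi : mu.-integrable `[0, 1] (EFin \o f) by exact: integrable_subr.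
transitivity (\int[mu]_(a in `[0, 1]) (sg * kap ^- 3 * kap `^ (- v) * f a)).
  apply: eq_Rintegral => a _; rewrite du0_shift exprMn.
  rewrite [sg ^+ 3]exprS expr2 sg2 mulr1 Jpow kS.
  rewrite /f /f5 /f4 /f1 /f2 /f3.
  have -> : - 0%:R - v = 1 + (1 + (1 + (- 3%:R - v))) by ring.
  have -> : - 1%:R - v = 1 + (1 + (- 3%:R - v)) by ring.
  have -> : - 2%:R - v = 1 + (- 3%:R - v) by ring.
  by rewrite -!hS; field; rewrite !gt_eqF.
rewrite RintegralZl// RintegralB// RintegralD// RintegralB//.
by rewrite RintegralZl// RintegralZl// RintegralZl.
Qed.

Let I0 := shift_moment_gap_gt0.

Let m0pow w : mom 0 s `^ (- (w * lambda)) = kap `^ w * I 0 e `^ (- (w * lambda)).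
Proof.
rewrite moment0_shift powRM ?powR_ge0 ?(ltW I0)// -powRrM; congr (_ `^ _ * _).
by field.
Qed.

Lemma variance_shift :
  flow_energy s = I 0 e `^ (- (4 / v)) * (I 2 e / I 0 e - (I 1 e / I 0 e) ^+ 2).
Proof.
rewrite /flow_energy m0pow powR_mulrn ?(ltW kap0)// invrK.
rewrite moment2_shift moment1_shift moment0_shift.
by apply: rescaled_variance; rewrite ?sg2 ?gt_eqF ?powR_gt0.
Qed.

Lemma third_moment_shift :
  flow_third_moment s = sg * (I 0 e `^ (- (6 / v)) * (I 3 e / I 0 e
     - 3 * (I 1 e / I 0 e) * (I 2 e / I 0 e) + 2 * (I 1 e / I 0 e) ^+ 3)).
Proof.
rewrite /flow_third_moment m0pow powR_mulrn ?(ltW kap0)// invrK.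
rewrite moment3_shift moment2_shift moment1_shift moment0_shift.
by apply: rescaled_third_moment; rewrite ?sg2 ?gt_eqF ?powR_gt0.
Qed.

Lemma gradient_shift a :
  gradient a s = sg * (I 0 e `^ (- (2 / v)) * ((h a)^-1 - I 1 e / I 0 e)).
Proof.
rewrite /gradient m0pow powR_mulrn ?(ltW kap0)// invrK.
rewrite J_shift du0_shift moment1_shift moment0_shift.
by apply: rescaled_gradient; rewrite gt_eqF ?powR_gt0.
Qed.

Lemma jacobian_shift a : flow_jacobian a s = h a `^ (- v) / I 0 e.
Proof.
rewrite /flow_jacobian Jpow moment0_shift; have k0 := powR_gt0 (- v) kap0.
by field; rewrite !gt_eqF.
Qed.

Let sgn : `|sg| = 1. Proof. by rewrite normr_sg lambda0. Qed.

Let gradient_norm a :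
  `|gradient a s| = I 0 e `^ (- (2 / v)) * `|(h a)^-1 - I 1 e / I 0 e|.
Proof. by rewrite gradient_shift normrM sgn mul1r normrM (ger0_norm (powR_ge0 _ _)). Qed.

Lemma gradient_moment_shift p : 0 <= p -> gradient_moment p s =
  I 0 e `^ (- (2 / v) * p - 1) * \int[mu]_(a in `[0, 1])
    (`|(e + gap a)^-1 - I 1 e / I 0 e| `^ p * (e + gap a) `^ (- v)).
Proof.
move=> p0; pose z := I 0 e `^ (- (2 / v) * p - 1).
pose f a := `|(e + gap a)^-1 - I 1 e / I 0 e| `^ p * (e + gap a) `^ (- v).
have z0 : 0 < z by rewrite powR_gt0.
have fE a : `|gradient a s| `^ p * flow_jacobian a s = z * f a.
  rewrite gradient_norm jacobian_shift powRM ?powR_ge0// -powRrM /z /f.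
  rewrite gt0_powRD// [I 0 e `^ (-1)]powR_inv1 ?(ltW I0)//.
  have alg (A B C D : R) : A * B * (C * D) = A * D * (B * C) by ring.
  exact: alg.
have fi : mu.-integrable `[0, 1] (EFin \o f).
  have Hi : mu.-integrable `[0, 1]
      (EFin \o (fun a => z^-1 * (`|gradient a s| `^ p * flow_jacobian a s))).
    by apply: integrable_mulrl => //; exact: integrable_gradient_moment p0 regular_time.
  apply: eq_integrable Hi => //.
  by move=> a _ /=; rewrite fE mulKf// gt_eqF.
rewrite -/z -[\int[mu]_(a in _) (_ * (e + gap a) `^ _)]/(\int[mu]_(a in `[0, 1]) f a).
by rewrite -RintegralZl//; apply: eq_Rintegral => a _; exact: fE.
Qed.

(** Both [(e + gap)^-1] and its mean lie in [0, e^-1], so the absolute deviation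
    dominates [e] times the squared deviation. *)
Lemma gradient_moment_lower p : 1 <= p ->
  I 0 e `^ (- (2 / v)) * e * (I 2 e / I 0 e - (I 1 e / I 0 e) ^+ 2) - 1
    <= gradient_moment p s.
Proof.
move=> p1; have e0 := excess_gt0; have rs := regular_time.
set k := I 1 e / I 0 e; set x := I 0 e `^ (- (2 / v)).
have x0 : 0 <= x by exact: powR_ge0.
have hV a : (h a)^-1 <= e^-1.
  by rewrite lef_pV2 ?posrE// lerDl gap_ge0.
have hV0 a : 0 <= (h a)^-1 by rewrite invr_ge0 ltW.
have k1 : k <= e^-1.
  rewrite ler_pdivrMr// -(hI 1) -(hI 0) -RintegralZl//.
  apply: le_Rintegral => //; first exact: integrable_mulrl.
  move=> a _; have -> : - 1%:R - v = - 1 + (- 0%:R - v) by ring.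
  rewrite gt0_powRD// powR_inv1 ?(ltW (h0 a))//.
  by apply: ler_wpM2r; [exact: powR_ge0|exact: hV].
have k0 : 0 <= k.
  exact: divr_ge0 (shift_moment_ge0 _ _ _ _) (ltW I0).
pose f1 a := h a `^ (- 2%:R - v).
pose f2 a := 2 * k * h a `^ (- 1%:R - v).
pose f3 a := k ^+ 2 * h a `^ (- 0%:R - v).
pose f4 a := f1 a - f2 a.
pose f5 a := f4 a + f3 a.
pose y := x * e / I 0 e.
pose f6 a := y * f5 a.
pose f a := f6 a - flow_jacobian a s.
have i1 : mu.-integrable `[0, 1] (EFin \o f1) by exact: kh.
have i2 : mu.-integrable `[0, 1] (EFin \o f2) by exact: integrable_mulrl.
have i3 : mu.-integrable `[0, 1] (EFin \o f3) by exact: integrable_mulrl.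
have i4 : mu.-integrable `[0, 1] (EFin \o f4) by exact: integrable_subr.
have i5 : mu.-integrable `[0, 1] (EFin \o f5) by exact: integrable_addr.
have i6 : mu.-integrable `[0, 1] (EFin \o f6) by exact: integrable_mulrl.
have ij := integrable_jacobian rs.
have fi : mu.-integrable `[0, 1] (EFin \o f) by exact: integrable_subr.
have -> : x * e * (I 2 e / I 0 e - k ^+ 2) - 1 = \int[mu]_(a in `[0, 1]) f a.
  have E1 : \int[mu]_(a in `[0, 1]) f1 a = I 2 e by [].
  have E2 : \int[mu]_(a in `[0, 1]) f2 a = 2 * k * I 1 e by rewrite RintegralZl.
  have E3 : \int[mu]_(a in `[0, 1]) f3 a = k ^+ 2 * I 0 e by rewrite RintegralZl.
  rewrite RintegralB// integral_jacobian// RintegralZl// RintegralD// RintegralB//.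
  rewrite E1 E2 E3 /y /k; congr (_ - _).
  by apply/esym/rescaled_deviation; rewrite gt_eqF.
apply: le_Rintegral => //.
  by apply: integrable_gradient_moment => //; lra.
move=> a _; rewrite /f /f6.
have gp : `|gradient a s| - 1 <= `|gradient a s| `^ p.
  have [g1|g1] := leP `|gradient a s| 1.
    by apply: le_trans (powR_ge0 _ _); rewrite subr_le0.
  by rewrite lerBlDr ler_wpDr//; apply: le1r_powR => //; exact: ltW.
have := ler_wpM2r (jacobian_ge0 a s) gp; apply: le_trans.
rewrite mulrBl mul1r lerD2r gradient_norm jacobian_shift -/x -/k.
have -> : y * f5 a = x * (e * ((h a)^-1 - k) ^+ 2) * (h a `^ (- v) / I 0 e).
  rewrite /f5 /f4 /f1 /f2 /f3 /y.
  have -> : - 2%:R - v = - 1 + (- 1 + - v) by ring.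
  have -> : - 1%:R - v = - 1 + - v by ring.
  rewrite oppr0 add0r !(gt0_powRD _ _ (h0 a)) powR_inv1 ?(ltW (h0 a))//.
  by field; rewrite !gt_eqF.
apply: ler_wpM2r; first by rewrite divr_ge0 ?powR_ge0// ltW.
apply: ler_wpM2l => //.
rewrite -real_normK ?num_real//.
set w := `|_|; have w0 : 0 <= w by exact: normr_ge0.
have we : e * w <= 1.
  rewrite mulrC -ler_pdivlMr// mul1r /w ler_norml; apply/andP; split.
    by have := hV0 a; lra.
  by have := hV a; lra.
by rewrite expr2 mulrA ler_piMl.
Qed.

End at_time.

Lemma excess_cvg : excess s @[s --> es^'-] --> 0^'+.
Proof.
have ee : excess es = 0.
  rewrite /excess eta_starE; field.
  by rewrite !gt_eqF// extreme_gt0.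
have c : excess s @[s --> es^'-] --> 0.
  rewrite -[X in _ --> X]ee; apply: cvg_at_left_filter.
  apply: cvgB; last exact: cvg_cst.
  apply: cvgV; first by rewrite mulf_neq0 ?gt_eqF ?eta_star_gt0.
  by apply: cvgM; [exact: cvg_cst|exact: cvg_id].
have es_gt : \forall s \near es^'-, 0 < s by exact: nbhs_left_gt eta_star_gt0.
move=> P /= HP; suff : \forall s \near es^'-, P (excess s) by [].
near=> s.
have s0 : 0 < s by near: s; exact: es_gt.
have s1 : s < es by near: s; exact: nbhs_left_lt.
have : 0 < excess s -> P (excess s) by near: s; exact: c HP.
by apply; apply: excess_gt0; rewrite s0.
Unshelve. all: by end_near.
Qed.

End distance_to_singularity.

(** * Limits as s tends to eta_star *)

Section limits_at_singularity.
Variable R : realType.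
Local Notation mu := (@lebesgue_measure R).
Variables (lambda M0 m0 : R) (u0 du0 : R -> R).
Hypothesis hdata : admissible_data u0 du0 M0 m0.
Hypothesis lambda0 : lambda != 0.
Hypothesis hprof : linear_profile (gap lambda M0 m0 du0).

Local Notation v := (lambda^-1).
Local Notation es := (eta_star lambda M0 m0).
Local Notation g := (gap lambda M0 m0 du0).
Local Notation excess := (excess lambda M0 m0).
Local Notation I := (shift_moment g v).

Let mg : measurable_fun setT g. Proof. exact: measurable_gap hdata. Qed.
Let g0 a : 0 <= g a. Proof. exact: gap_ge0 hdata a. Qed.
Let gG a : g a <= M0 - m0. Proof. exact: gap_le hdata a. Qed.

Lemma near_eta_star : \forall s \near es^'-, 0 < s < es.
Proof.
have h : \forall s \near es^'-, 0 < s by exact: nbhs_left_gt (eta_star_gt0 hdata lambda0).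
near=> s; apply/andP; split; first by near: s.
by near: s; exact: nbhs_left_lt.
Unshelve. all: by end_near.
Qed.

Let ecvg : excess s @[s --> es^'-] --> 0^'+.
Proof. exact: excess_cvg hdata lambda0. Qed.

Section positive.
Hypothesis lambda12 : 1 / 2 < lambda.

Let l0 : 0 < lambda. Proof. by apply: lt_trans lambda12; rewrite divr_gt0. Qed.

Let v02 : 0 < v < 2.
Proof.
rewrite invr_gt0 l0/= invf_plt ?posrE//.
by apply: le_lt_trans lambda12; rewrite mul1r.
Qed.

(** The lower bound of [gradient_moment_lower] already diverges. *)
Lemma gradient_moment_cvgy p : 1 <= p ->
  gradient_moment lambda du0 p s @[s --> es^'-] --> +oo.
Proof.
move=> p1; have [c [c0 lv [z z01 zz] _]] := hprof.
have [L L0 HL] := blowup_constant_gt0 c0 mg g0 lv z01 zz.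
have gy := integral_inv_shift_cvgy c0 mg g0 z01 zz.
have H := deviation_lower_cvgy mg g0 gG L0 HL gy v02.
have H' := cvg_comp _ _ ecvg H.
apply/cvgryPge => A; near=> s.
have s0 : 0 < s < es by near: s; exact: near_eta_star.
apply: le_trans (gradient_moment_lower hdata lambda0 s0 p1).
rewrite lerBrDr; near: s; move/cvgryPge : H'; exact.
Unshelve. all: by end_near.
Qed.

Lemma flow_third_moment_cvgy :
  flow_third_moment lambda du0 s @[s --> es^'-] --> +oo.
Proof.
have [c [c0 lv [z z01 zz] _]] := hprof.
have [L L0 HL] := blowup_constant_gt0 c0 mg g0 lv z01 zz.
have gy := integral_inv_shift_cvgy c0 mg g0 z01 zz.
have H := third_moment_cvgy mg g0 gG L0 HL gy v02.
apply: cvg_trans (cvg_comp _ _ ecvg H); apply: near_eq_cvg; near=> s.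
have s0 : 0 < s < es by near: s; exact: near_eta_star.
by rewrite (third_moment_shift hdata lambda0 s0) gtr0_sg// mul1r.
Unshelve. all: by end_near.
Qed.

End positive.

Section negative.
Hypothesis lambdaN : lambda < 0.

Let v0 : v < 0. Proof. by rewrite invr_lt0. Qed.

Let weak : [/\ finite_set [set a | 0 <= a <= 1 /\ g a = 0],
  forall b, b < 1 -> mu.-integrable `[0, 1] (EFin \o (fun a => g a `^ (- b))) &
  \int[mu]_(a in `[0, 1]) (e + g a) `^ (- 1) @[e --> 0^'+] --> +oo].
Proof.
have [c [c0 lv [z z01 zz] gfin]] := hprof; split => //.
- by move=> b b1; exact: (integrable_powRN c0 mg g0 lv gG b1).
- exact: (integral_inv_shift_cvgy c0 mg g0 z01 zz).
Qed.

Lemma gradient_moment_cvg p : 1 <= p -> p + v < 1 ->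
  exists l : R, gradient_moment lambda du0 p s @[s --> es^'-] --> l.
Proof.
move=> p1 pv; have [gfin gint gy] := weak.
have [l H] := deviation_power_cvg mg g0 gG gfin gint v0 p1 pv.
exists l; apply: cvg_trans (cvg_comp _ _ ecvg H); apply: near_eq_cvg; near=> s.
have s0 : 0 < s < es by near: s; exact: near_eta_star.
by rewrite (gradient_moment_shift hdata lambda0 s0)//; lra.
Unshelve. all: by end_near.
Qed.

Lemma flow_energy_cvgy : lambda <= -1 -> flow_energy lambda du0 s @[s --> es^'-] --> +oo.
Proof.
move=> l1; have [gfin gint gy] := weak.
have v2 : 1 <= 2%:R + v.
  suff : - 1 <= v by lra.
  by rewrite -[v]opprK lerN2 -invrN invf_le1 ?oppr_gt0//; lra.
have H := variance_cvgy mg g0 gG gfin gint gy v0 v2.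
apply: cvg_trans (cvg_comp _ _ ecvg H); apply: near_eq_cvg; near=> s.
have s0 : 0 < s < es by near: s; exact: near_eta_star.
by rewrite (variance_shift hdata lambda0 s0).
Unshelve. all: by end_near.
Qed.

Lemma flow_third_moment_cvgNy : lambda < - (1 / 2) ->
  flow_third_moment lambda du0 s @[s --> es^'-] --> -oo.
Proof.
move=> l1; have [gfin gint gy] := weak.
have v3 : 1 <= 3%:R + v.
  suff : - 2 < v by lra.
  rewrite -[v]opprK ltrN2 -invrN invf_plt ?posrE ?oppr_gt0//; lra.
have H := weak_third_moment_cvgy mg g0 gG gfin gint gy v0 v3.
apply/cvgNry; apply: cvg_trans (cvg_comp _ _ ecvg H); apply: near_eq_cvg; near=> s.
have s0 : 0 < s < es by near: s; exact: near_eta_star.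
by rewrite /= fctE (third_moment_shift hdata lambda0 s0) ltr0_sg// mulN1r opprK.
Unshelve. all: by end_near.
Qed.

Lemma flow_third_moment_cvg : - (1 / 2) < lambda -> exists l : R,
  flow_third_moment lambda du0 s @[s --> es^'-] --> l.
Proof.
move=> l1; have [gfin gint gy] := weak.
have v3 : 3%:R + v < 1.
  suff : v < - 2 by lra.
  rewrite -[v]opprK ltrN2 -invrN invf_pgt ?posrE ?oppr_gt0//; lra.
have [l H] := weak_third_moment_cvg mg g0 gG gfin gint v0 v3.
have H' : - (I 0 (excess s) `^ (- (6 / v)) * (I 3 (excess s) / I 0 (excess s)
    - 3 * (I 1 (excess s) / I 0 (excess s)) * (I 2 (excess s) / I 0 (excess s))
    + 2 * (I 1 (excess s) / I 0 (excess s)) ^+ 3)) @[s --> es^'-] --> - l.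
  by apply: cvgN; exact: cvg_comp _ _ ecvg H.
exists (- l); apply: cvg_trans H'; apply: near_eq_cvg; near=> s.
have s0 : 0 < s < es by near: s; exact: near_eta_star.
by rewrite (third_moment_shift hdata lambda0 s0) ltr0_sg// mulN1r.
Unshelve. all: by end_near.
Qed.

End negative.
End limits_at_singularity.

(** * Derivatives in time and elapsed time *)

Section time_derivatives.
Variable R : realType.
Implicit Types (f phi : R -> R) (t l : R).

Local Notation axis t := (within [set s : R | 0 <= s] t^').

Lemma time_derivative_continuous phi t l : time_derivative phi t l ->
  phi s @[s --> axis t] --> phi t.
Proof.
move=> H.
have E : phi t + (phi s - phi t) / (s - t) * (s - t) @[s --> axis t] --> phi t.
  rewrite -[X in _ --> X]addr0 -[X in _ --> _ + X](mulr0 l).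
  apply: cvgD; first exact: cvg_cst.
  apply: cvgM => //.
  have : s - t @[s --> nbhs t] --> 0.
    by rewrite -(subrr t); apply: cvgB; [exact: cvg_id|exact: cvg_cst].
  apply: cvg_trans; apply: cvg_app.
  by move=> A HA; apply: cvg_within; exact: (@cvg_within _ (nbhs t)).
apply: cvg_trans E; apply: near_eq_cvg.
have h : \forall s \near axis t, s != t.
  by apply: cvg_within; exact: withinT.
near=> s; rewrite divfK ?subrKC//.
by rewrite subr_eq0; near: s.
Unshelve. all: by end_near.
Qed.

(** The difference quotient of the composite factors, by the Caratheodory form of
    differentiability, without dividing by increments of [phi]. *)
Lemma time_derivative_comp f phi t l D : time_derivative phi t l ->
  is_derive (phi t) 1 f D -> time_derivative (f \o phi) t (D * l).
Proof.
move=> H /is_derive1_caratheodory[q [qE qc qD]].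
have E : q (phi s) * ((phi s - phi t) / (s - t)) @[s --> axis t] --> D * l.
  apply: cvgM => //; rewrite -qD.
  exact: (cvg_comp _ _ (time_derivative_continuous H) qc).
apply: cvg_trans E; apply: near_eq_cvg; near=> s.
by rewrite /= qE mulrA.
Unshelve. all: by end_near.
Qed.

Lemma time_derivative_near phi t l e : 0 <= t -> time_derivative phi t l -> 0 < e ->
  exists2 r, 0 < r & forall s, 0 <= s -> `|s - t| < r ->
    `|phi s - phi t - l * (s - t)| <= e * `|s - t|.
Proof.
move=> t0 /cvgrPdist_le /[apply].
move=> h; have {h} : nbhs t [set s | s != t -> 0 <= s ->
    `|l - (phi s - phi t) / (s - t)| <= e] by exact: h.
move=> /nbhs_ballP[r r0 Hr]; exists r => // s s0 st.
have [->|sNt] := eqVneq s t; first by rewrite !subrr mulr0 subrr normr0 mulr0.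
have := Hr s; rewrite /ball/= distrC => /(_ st sNt s0) h.
have st0 : s - t != 0 by rewrite subr_eq0.
rewrite -[X in X - _](@divfK _ (s - t))// -mulrBl normrM distrC.
by apply: ler_wpM2r.
Qed.

(** Mean value inequality on short intervals, propagated to [0, a]. *)
Lemma time_derivative_cst phi a l : (forall t, 0 <= t <= a -> time_derivative phi t l) ->
  forall t, 0 <= t <= a -> phi t = phi 0 + l * t.
Proof.
move=> H t /andP[t0 ta]; apply/eqP; rewrite -subr_eq0 -normr_le0.
apply/ler_addgt0Pl => e e0; rewrite addr0.
have t1 : 0 < t + 1 by rewrite ltr_wpDl.
pose P x y := `|phi y - phi x - l * (y - x)| <= e / (t + 1) * (y - x).
suff : P 0 t.
  rewrite /P subr0 opprD addrA => /le_trans; apply.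
  rewrite mulrAC -mulrA -[leRHS]mulr1; apply: ler_wpM2l; first exact: ltW.
  by rewrite ler_pdivrMr//; lra.
have ee : 0 < e / (t + 1) by rewrite divr_gt0.
apply: (@segment_induction _ P 0 t) => //.
- move=> x y z _ xy yz _; rewrite /P => h1 h2.
  have -> : phi z - phi x - l * (z - x) =
    (phi z - phi y - l * (z - y)) + (phi y - phi x - l * (y - x)) by ring.
  have -> : z - x = (z - y) + (y - x) by ring.
  by rewrite [leRHS]mulrDr; apply: le_trans (ler_normD _ _) _; apply: lerD.
- move=> z /andP[z0 zt].
  have [|r r0 Hr] := time_derivative_near z0 (H z _) ee; first by rewrite z0 (le_trans zt).
  exists r => //; split.
    move=> x x0 /andP[xr xz]; rewrite /P.
    have := Hr x x0; rewrite distrC ger0_norm ?subr_ge0// => /(_ _)/le_trans.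
    have -> : phi z - phi x - l * (z - x) = - (phi x - phi z - l * (x - z)) by ring.
    by rewrite normrN; apply; lra.
  move=> y yt /andP[zy yr]; rewrite /P.
  have := Hr y (le_trans z0 zy); rewrite ger0_norm ?subr_ge0//; apply.
  by lra.
Qed.

End time_derivatives.

Section elapsed_time.
Variable R : realType.
Local Notation mu := (@lebesgue_measure R).
Variables (f eta : R -> R) (d es tstar : R).
Hypotheses (d0 : d < 0) (es0 : 0 < es).
Hypothesis fc : forall s, d < s < es -> {for s, continuous f}.
Hypothesis f0 : forall s, d < s < es -> 0 < f s.
Hypothesis eta0 : eta 0 = 0.
Hypothesis eta_range : forall t, 0 <= t < tstar -> 0 <= eta t < es.
Hypothesis eta_ode : forall t, 0 <= t < tstar -> time_derivative eta t (f (eta t))^-1.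
Hypothesis lim : \int[mu]_(s in `[0, e]) f s @[e --> es^'-] --> tstar.

Let d2 : d < d / 2 < 0.
Proof. by have := midf_lt d0; rewrite addr0 => -[-> ->]. Qed.

Let T x := \int[mu]_(s in `[0, x]) f s.
(* a primitive that is differentiable also at 0, since it starts before 0 *)
Let P x := \int[mu]_(s in `[d / 2, x]) f s.

Let fi x y : d < x -> y < es -> mu.-integrable `[x, y] (EFin \o f).
Proof.
move=> dx ye; apply: continuous_compact_integrable; first exact: segment_compact.
apply: continuous_in_subspaceT => a /set_mem; rewrite /= in_itv/= => /andP[xa ay].
by apply: fc; rewrite (lt_le_trans dx)//= (le_lt_trans ay).
Qed.

Let TP x : 0 <= x < es -> T x = P x - P 0.
Proof.
move=> /andP[x0 xe]; have /andP[h1 h2] := d2.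
rewrite /P /T (@Rintegral_itv_cat _ f (d / 2) 0 x) ?(ltW h2)//; last exact: fi.
by rewrite [RHS]addrC addKr.
Qed.

Let dP x : 0 <= x < es -> is_derive x 1 P (f x).
Proof.
move=> /andP[x0 xe]; have /andP[h1 h2] := d2.
have [xu ue] := midf_lt xe.
have := @continuous_FTC1_closed _ f (d / 2) x _ xu (fi h1 ue) (lt_le_trans h2 x0).
have /fc H : d < x < es by rewrite xe (lt_le_trans d0).
by move=> /(_ H)[D1 D2]; apply: DeriveDef => //; rewrite -derive1E.
Qed.

Let T_incr x y : 0 <= x -> x < y -> y < es -> T x < T y.
Proof.
move=> x0 xy ye.
rewrite !TP ?x0 ?(lt_trans xy) ?ye ?(le_trans x0) ?ltW// ltrD2r -subr_gt0.
have dd z : x <= z <= y -> is_derive z 1 P (f z).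
  by move=> /andP[xz zy]; apply: dP; rewrite (le_trans x0)//= (le_lt_trans zy).
have [||c] := @MVT _ P f x y xy.
- by move=> z; rewrite in_itv/= => /andP[xz zy]; apply: dd; rewrite !ltW.
- apply: continuous_in_subspaceT => z /set_mem; rewrite /= in_itv/= => xzy.
  by apply/differentiable_continuous/derivable1_diffP; have [] := dd z xzy.
rewrite in_itv/= => /andP[xc cy] ->; rewrite mulr_gt0 ?subr_gt0//.
by apply: f0; rewrite (lt_trans cy)// andbT (lt_trans d0)// (le_lt_trans x0).
Qed.

(** The function [P \o eta] has time derivative [f (eta t) / f (eta t) = 1]: the
    elapsed time is recovered from the value of [eta]. *)
Lemma eta_time t : 0 <= t < tstar -> T (eta t) = t.
Proof.
move=> /andP[t0 tt].
have H s : 0 <= s <= t -> time_derivative (P \o eta) s 1.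
  move=> /andP[s0 st]; have st' : 0 <= s < tstar by rewrite s0 (le_lt_trans st).
  have /andP[e0 ee] := eta_range st'.
  have fe : 0 < f (eta s) by apply: f0; rewrite ee (lt_le_trans d0).
  rewrite -(mulfV (lt0r_neq0 fe)).
  by apply: time_derivative_comp; [exact: eta_ode|apply: dP; rewrite e0].
rewrite TP ?eta_range ?t0//.
have := time_derivative_cst H; move=> /(_ t); rewrite t0 lexx => /(_ isT) /= ->.
by rewrite eta0 mul1r addrC addKr.
Qed.

Lemma blowup_time_gt e : 0 <= e < es -> T e < tstar.
Proof.
move=> /andP[e0 ee]; pose e' := (e + es) / 2.
have [e1 e2] : (e < e') * (e' < es) := midf_lt ee.
apply: lt_le_trans (T_incr e0 e1 e2) _.
apply: (cvgr_to_ge lim); near=> x; apply/ltW/T_incr; first exact: le_trans (ltW e1).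
  by near: x; exact: nbhs_left_gt.
by near: x; exact: nbhs_left_lt.
Unshelve. all: by end_near.
Qed.

Let T0 : T 0 = 0.
Proof. by rewrite /T set_itv1 Rintegral_set1. Qed.

Lemma eta_gt0 t : 0 < t < tstar -> 0 < eta t.
Proof.
move=> /andP[t0 tt]; have tI : 0 <= t < tstar by rewrite ltW.
have /andP[e0 _] := eta_range tI; rewrite lt_neqAle e0 andbT.
by apply: contraTneq t0 => e00; rewrite -(eta_time tI) -e00 T0 ltxx.
Qed.

Lemma blowup_time_gt0 : 0 < tstar.
Proof. by rewrite -T0; apply: blowup_time_gt; rewrite lexx. Qed.

(** Past the time [T e], which is smaller than [tstar], [eta] exceeds [e], by
    monotonicity of [T]. *)
Lemma eta_cvg : eta t @[t --> tstar^'-] --> es^'-.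
Proof.
suff H e : e < es -> \forall t \near tstar^'-, e < eta t < es.
  move=> A HA; have {HA} : nbhs es [set s | s < es -> A s] := HA.
  move=> /nbhs_ballP[r r0 Hr].
  have /H : es - r < es by rewrite ltrBlDr ltrDl.
  apply: filterS => t /andP[h1 h2]; apply: Hr => //.
  by rewrite /ball/= ger0_norm ?subr_ge0 ?(ltW h2)// ltrBlDr -ltrBlDl.
move=> ee; pose e' := Num.max 0 e.
have e'I : 0 <= e' < es by rewrite le_max lexx gt_max es0.
near=> t.
have tT : T e' < t by near: t; apply: nbhs_left_gt; exact: blowup_time_gt.
have t0 : 0 <= t < tstar.
  rewrite ltW; last by near: t; exact: nbhs_left_gt blowup_time_gt0.
  by near: t; exact: nbhs_left_lt.
have /andP[h1 h2] := eta_range t0; rewrite h2 andbT.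
apply: (@le_lt_trans _ _ e'); first by rewrite le_max lexx orbT.
rewrite ltNge; apply/negP => h3.
move: tT; rewrite -(eta_time t0) ltNge => /negP; apply.
move: h3; rewrite le_eqVlt => /predU1P[->//|h3].
by apply/ltW/T_incr => //; have /andP[] := e'I.
Unshelve. all: by end_near.
Qed.

End elapsed_time.

(** * Norms and energy of the solution *)

Section solution.
Variable R : realType.
Local Notation mu := (@lebesgue_measure R).
Variables (lambda M0 m0 tstar : R).
Variables (u0 du0 : R -> R) (u ux gamma : R -> R -> R) (eta : R -> R).
Hypothesis lambda0 : lambda != 0.
Hypothesis hdata : admissible_data u0 du0 M0 m0.
Hypothesis htstar : is_blowup_time lambda du0 M0 m0 tstar.
Hypothesis hsol : characteristic_solution lambda du0 u0 M0 m0 tstar u ux gamma eta.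

Local Notation J := (J lambda du0).
Local Notation mom := (moment lambda du0).
Local Notation es := (eta_star lambda M0 m0).
Local Notation regular := (regular lambda M0 m0).
Local Notation gradient := (gradient lambda du0).
Local Notation jacobian := (flow_jacobian lambda du0).
Local Notation gradient_moment := (gradient_moment lambda du0).
Local Notation flow_energy := (flow_energy lambda du0).
Local Notation flow_third_moment := (flow_third_moment lambda du0).

(** Times slightly before 0 are included to make derivatives at 0 two-sided. *)
Lemma regular_gt0 : exists2 d, d < 0 & forall s, d < s < es -> regular s.
Proof.
have H c : \forall s \near (0 : R), 0 < 1 - lambda * s * c.
  have h : 1 - lambda * s * c @[s --> (0 : R)] --> 1 - lambda * 0 * c.
    apply: cvgB; first exact: cvg_cst.
    by apply: cvgM; [apply: cvgM; [exact: cvg_cst|exact: cvg_id]|exact: cvg_cst].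
  by move/cvgr_gt : h; apply; rewrite mulr0 mul0r subr0.
have : \forall s \near (0 : R), regular s.
  by near=> s; apply/andP; split; near: s; exact: H.
move=> /nbhs_ballP[r r0 Hr]; exists (- r); rewrite ?oppr_lt0// => s /andP[rs se].
have [s0|s0] := leP 0 s; first by apply: (regular_itv hdata lambda0); rewrite s0.
by apply: Hr; rewrite /ball/= sub0r normrN ltr0_norm// ltrNl.
Unshelve. all: by end_near.
Qed.

Lemma continuous_moment j s : regular s -> {for s, continuous (mom j)}.
Proof.
move=> rs; apply/differentiable_continuous/derivable1_diffP.
by have [] := is_derive_moment hdata lambda0 j rs.
Qed.

Lemma eta_regular t : 0 <= t < tstar -> regular (eta t).
Proof. by move=> /(sol_eta_range hsol); exact: (regular_itv hdata lambda0). Qed.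

Lemma time_change : [/\ 0 < tstar, forall t, 0 < t < tstar -> 0 < eta t &
  eta t @[t --> tstar^'-] --> es^'-].
Proof.
have [d d0 Hd] := regular_gt0; have es0 := eta_star_gt0 hdata lambda0.
pose f s := mom 0 s `^ (2 * lambda).
have fc s : d < s < es -> {for s, continuous f}.
  move=> /Hd rs; have h := @continuous_moment 0 s rs.
  exact: cvg_comp h (continuous_powRl (moment0_gt0 hdata rs)).
have f0 s : d < s < es -> 0 < f s.
  by move=> /Hd rs; exact: powR_gt0 (moment0_gt0 hdata rs).
have ode t : 0 <= t < tstar -> time_derivative eta t (f (eta t))^-1.
  by move=> /(sol_eta_ode hsol); rewrite Kbar_moment powRN.
have lim : \int[mu]_(s in `[0, e]) f s @[e --> es^'-] --> tstar.
  have -> : f = fun s => Kbar lambda du0 0 s `^ (2 * lambda).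
    by apply/funext => s; rewrite Kbar_moment.
  exact: htstar.
have e0 := sol_eta0 hsol; have er := sol_eta_range hsol.
split.
- exact: blowup_time_gt0 d0 es0 fc f0 lim.
- by move=> t; exact: (eta_gt0 d0 fc f0 e0 er ode).
- exact: eta_cvg d0 es0 fc f0 e0 er ode lim.
Qed.

Lemma J0 a : J a 0 = 1.
Proof. by rewrite /Defs.J mulr0 mul0r subr0. Qed.

Lemma integral_du0 : \int[mu]_(a in `[0, 1]) du0 a = 0.
Proof.
have [_ <-] := data_density hdata ler01.
by rewrite -[1]add0r (data_u0_periodic hdata) subrr.
Qed.

Lemma Kbar1_moment s : regular s -> Kbar lambda du0 1 s = mom 0 s + lambda * s * mom 1 s.
Proof.
move=> rs; have i0 := integrable_moment hdata 0 (- 0%:R - lambda^-1) rs.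
have i1 := integrable_moment hdata 1 (- 1%:R - lambda^-1) rs.
have i2 : mu.-integrable `[0, 1] (EFin \o (fun a => lambda * s *
    (du0 a ^+ 1 * J a s `^ (- 1%:R - lambda^-1)))) by exact: integrable_mulrl.
rewrite /moment -RintegralZl// -RintegralD//; apply: eq_Rintegral => a _.
have J0 := J_gt0 hdata a rs.
have -> : - 0%:R - lambda^-1 = 1 + (- 1%:R - lambda^-1) by ring.
rewrite (gt0_powRD 1 _ J0) powRr1 ?ltW//; set z := J a s `^ _.
by rewrite /Defs.J; ring.
Qed.

(** For [t > 0], [J^-1 = 1 + lambda * s * (du0 / J)] with [s = eta t] removes the
    factor [lambda * s] from the denominator of the explicit formula.  The
    resulting expression also gives [du0 a] at [t = 0], because [du0] has mean
    zero. *)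
Lemma ux_gradient a t : 0 <= t < tstar -> ux (gamma a t) t = gradient a (eta t).
Proof.
move=> /[dup] tI /andP[t0 tt]; have rs := eta_regular tI.
have [_ egt _] := time_change.
move: t0; rewrite le_eqVlt => /predU1P[t0|t0].
  rewrite -t0 (sol_gamma0 hsol) (sol_initial hsol a).2 (sol_eta0 hsol) /gradient.
  have -> : mom 0 0 = 1.
    rewrite /moment; under eq_Rintegral do rewrite J0 powR1 expr0 mulr1.
    by rewrite Rintegral_cst// [X in fine X]lebesgue_itvcc// subr0 mulr1.
  have -> : mom 1 0 = 0.
    rewrite /moment; under eq_Rintegral do rewrite J0 powR1 expr1 mulr1.
    exact: integral_du0.
  by rewrite J0 powR1 mul0r subr0 divr1 mul1r.
rewrite (sol_ux_formula hsol) ?t0// Kbar1_moment// Kbar_moment /gradient.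
have e0 : 0 < eta t by apply: egt; rewrite t0.
have m00 := moment0_gt0 hdata rs; have Ja := J_gt0 hdata a rs.
rewrite powRN; have := powR_gt0 (2 * lambda) m00.
move: (mom 0 _) m00 (mom 1 _) (_ `^ _) => y y0 z x x0.
have : J a (eta t) = 1 - lambda * eta t * du0 a by [].
move: (eta t) e0 (J a (eta t)) Ja (du0 a) => s s0 j j0 w jE.
have {1}-> : j^-1 = 1 + lambda * s * w / j.
  by apply: (mulfI (lt0r_neq0 j0)); rewrite mulrDr mulfV ?gt_eqF// mulr1
    mulrCA mulfV ?gt_eqF// mulr1 jE subrK.
by field; rewrite lambda0 !gt_eqF.
Qed.

Lemma ux_measurable t : 0 <= t < tstar -> measurable_fun setT (ux^~ t).
Proof. by move=> tI; exact: density_measurable (sol_density hsol tI). Qed.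

Lemma jacobian_periodic s : periodic (jacobian^~ s) 1.
Proof. by move=> a; rewrite /flow_jacobian /Defs.J (data_du0_periodic hdata). Qed.

Lemma integral_ux_powR p t : 0 <= p -> 0 <= t < tstar ->
  (\int[mu]_(x in `[0%R, 1%R]) (`|ux x t| `^ p)%:E = (gradient_moment p (eta t))%:E)%E.
Proof.
move=> p0 tI; have rs := eta_regular tI.
have [c [C [c0 cC]]] := jacobian_bounds hdata rs.
have [up uxp gp] := sol_periodic hsol tI.
have gd : density (gamma^~ t) (jacobian^~ (eta t)).
  have := sol_gamma_formula hsol tI; by rewrite Kbar_moment.
have mux := ux_measurable tI.
have mup : measurable_fun setT (fun x => `|ux x t| `^ p).
  by apply: measurable_powRl; exact: measurableT_comp.
have mj := measurable_jacobian lambda hdata (eta t).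
rewrite (ge0_integral_periodic_substitution mj c0 cC gd (@jacobian_periodic _) gp).
- under eq_integral do rewrite (ux_gradient _ tI) -EFinM.
  rewrite -[LHS]fineK; first by [].
  exact: integrable_fin_num (integrable_gradient_moment hdata p0 rs).
- exact/measurable_EFinP.
- by move=> x; rewrite lee_fin powR_ge0.
- by move=> x; rewrite uxp.
Qed.

Lemma Lp_normE p t : 1 <= p -> 0 <= t < tstar ->
  Lp_norm p ux t = (gradient_moment p (eta t) `^ p^-1)%:E.
Proof.
move=> p1 tI; have p0 : 0 < p by exact: lt_le_trans p1.
rewrite /Lp_norm unlock -poweR_EFin -(integral_ux_powR (ltW p0) tI).
congr (poweR _ _).
rewrite [RHS]integral_mkcond; apply: eq_integral => x _.
rewrite patchE /slice /=; case: ifPn => xI; first by rewrite patchE xI.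
by rewrite patchE (negbTE xI) normr0 powR0// gt_eqF.
Qed.

Lemma gradient_moment_ge0 p s : 0 <= gradient_moment p s.
Proof.
by apply: Rintegral_ge0 => a _; rewrite mulr_ge0 ?powR_ge0 ?jacobian_ge0.
Qed.

Lemma slice_Lfun p t : 1 <= p -> 0 <= t < tstar -> slice ux t \in Lfun mu p%:E.
Proof.
move=> p1 tI; rewrite inE; apply/andP; split; apply/mem_set => /=.
  apply/(measurable_restrictT _ _).1 => //.
  exact: measurable_funTS (ux_measurable tI).
by rewrite /finite_norm -[X in (X < _)%E]/(Lp_norm p ux t) Lp_normE// ltry.
Qed.

Lemma gradient_moment2 s : regular s -> gradient_moment 2 s = flow_energy s.
Proof.
move=> rs; set m := mom 0 s; have m00 : 0 < m := moment0_gt0 hdata rs.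
set k := mom 1 s / m; set x := m `^ (- (2 * lambda)).
have ii i := integrable_moment hdata i (- i%:R - lambda^-1) rs.
pose f0 a := k ^+ 2 * (du0 a ^+ 0 * J a s `^ (- 0%:R - lambda^-1)).
pose f1 a := 2 * k * (du0 a ^+ 1 * J a s `^ (- 1%:R - lambda^-1)).
pose f2 a := du0 a ^+ 2 * J a s `^ (- 2%:R - lambda^-1).
pose f3 a := f2 a - f1 a.
pose f a := f3 a + f0 a.
have i0 : mu.-integrable `[0, 1] (EFin \o f0) by exact: integrable_mulrl.
have i1 : mu.-integrable `[0, 1] (EFin \o f1) by exact: integrable_mulrl.
have i2 : mu.-integrable `[0, 1] (EFin \o f2) by exact: ii.
have i3 : mu.-integrable `[0, 1] (EFin \o f3) by exact: integrable_subr.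
have i : mu.-integrable `[0, 1] (EFin \o f) by exact: integrable_addr.
transitivity (\int[mu]_(a in `[0, 1]) (x ^+ 2 / m * f a)).
  apply: eq_Rintegral => a _; have Ja := J_gt0 hdata a rs.
  rewrite powR_mulrn ?normr_ge0// real_normK ?num_real//.
  rewrite /gradient /flow_jacobian -/m -/k -/x /f /f3 /f2 /f1 /f0.
  have E1 : J a s `^ (- 1%:R - lambda^-1) = J a s * J a s `^ (- 2%:R - lambda^-1).
    have -> : - 1%:R - lambda^-1 = 1 + (- 2%:R - lambda^-1) by ring.
    by rewrite (gt0_powRD 1 _ Ja) powRr1// ltW.
  have E0 : J a s `^ (- lambda^-1) = J a s * J a s `^ (- 1%:R - lambda^-1).
    have {1}-> : - lambda^-1 = 1 + (- 1%:R - lambda^-1) by ring.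
    by rewrite (gt0_powRD 1 _ Ja) powRr1// ltW.
  rewrite oppr0 add0r E0 E1.
  move: (J a s) Ja (J a s `^ (- 2%:R - lambda^-1)) (m) m00 (x) (k) (du0 a) => j j0 z' m' m0' x' k' w.
  by field; rewrite !gt_eqF.
have E : \int[mu]_(a in `[0, 1]) f a = mom 2 s - 2 * k * mom 1 s + k ^+ 2 * m.
  have j0 := ii 0; have j1 := ii 1.
  have E0 : \int[mu]_(a in `[0, 1]) f0 a = k ^+ 2 * m by rewrite RintegralZl.
  have E1 : \int[mu]_(a in `[0, 1]) f1 a = 2 * k * mom 1 s by rewrite RintegralZl.
  by rewrite RintegralD// RintegralB// E0 E1.
rewrite RintegralZl// E /flow_energy -/m -/k.
have -> : m `^ (- (4 * lambda)) = x ^+ 2.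
  by rewrite /x expr2 -gt0_powRD//; congr (_ `^ _); ring.
have -> : mom 1 s = k * m by rewrite divfK ?gt_eqF.
move: (m) m00 (mom 2 s) (x) (k) => m' m0' z x' k'.
by field; rewrite gt_eqF.
Qed.

Lemma energyE t : 0 <= t < tstar -> energy ux t = (flow_energy (eta t))%:E.
Proof.
move=> tI; rewrite /energy Lp_normE//; last by rewrite ler1n.
rewrite -gradient_moment2 ?eta_regular// expe2 -EFinM -expr2; congr _%:E.
by rewrite -powR_mulrn ?powR_ge0// -powRrM mulVf// powRr1// gradient_moment_ge0.
Qed.

(** With [m_i = moment i / moment 0], the derivative of [m_2 - m_1 ^ 2], together
    with that of the power of [moment 0], is
    [(1 + 2 lambda) (m_3 - 3 m_1 m_2 + 2 m_1 ^ 3)]. *)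
Lemma is_derive_flow_energy s : regular s ->
  is_derive s 1 flow_energy
    ((1 + 2 * lambda) * mom 0 s `^ (2 * lambda) * flow_third_moment s).
Proof.
move=> rs; have m00 := moment0_gt0 hdata rs.
have d0 := is_derive_moment hdata lambda0 0 rs.
have d1 := is_derive_moment hdata lambda0 1 rs.
have d2 := is_derive_moment hdata lambda0 2 rs.
have dpow b : is_derive s 1 (fun y => mom 0 y `^ b)
    (b * mom 0 s `^ (b - 1) * ((0%:R * lambda + 1) * mom 1 s)).
  have := @is_derive1_comp _ (fun a => a `^ b) (mom 0) s _ _ (is_derive1_powR b m00) d0.
  by move=> H; apply: is_derive_eq.
have dp := dpow (- (4 * lambda)); have dq := dpow (- 1).
have m0_ge0 y : 0 <= mom 0 y.
  by apply: Rintegral_ge0 => a _; rewrite expr0 mul1r powR_ge0.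
rewrite (_ : flow_energy = fun y => mom 0 y `^ (- (4 * lambda)) *
   (mom 2 y * mom 0 y `^ (- 1) - (mom 1 y * mom 0 y `^ (- 1)) * (mom 1 y * mom 0 y `^ (- 1)))); last first.
  by apply/funext => y; rewrite /flow_energy powR_inv1// expr2.
apply: is_derive_eq; rewrite /GRing.scale/= /flow_third_moment.
have -> : - (4 * lambda) - 1 = 2 * lambda + (- (6 * lambda) + - 1) by ring.
have -> : - (4 * lambda) = 2 * lambda + - (6 * lambda) by ring.
have -> : - 1 - 1 = - 1 + - 1 :> R by ring.
rewrite !(gt0_powRD _ _ m00) powR_inv1//.
move: (mom 0 s) m00 (mom 1 s) (mom 2 s) (mom 3 s) (_ `^ (2 * lambda)) (_ `^ (- (6 * lambda))).
move=> m m00 m1 m2 m3 x y.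
by field; rewrite gt_eqF.
Qed.

Lemma continuous_flow_third_moment s : regular s ->
  {for s, continuous flow_third_moment}.
Proof.
move=> rs; have m00 := moment0_gt0 hdata rs.
have c i : mom i y @[y --> s] --> mom i s by exact: (@continuous_moment i s rs).
have q i : mom i y / mom 0 y @[y --> s] --> mom i s / mom 0 s.
  by apply: cvgM => //; apply: cvgV; rewrite ?gt_eqF//; exact: c.
apply: cvgM; first by apply: cvg_powR => //; exact: c.
apply: cvgD.
  apply: cvgB; first exact: q.
  by apply: cvgM; [apply: cvgM; [exact: cvg_cst|exact: q]|exact: q].
by apply: cvgM; [exact: cvg_cst|exact: (cvgM (q 1) (cvgM (q 1) (q 1)))].
Qed.

(** The factor [moment 0 ^ (2 lambda)] is compensated by the derivative of
    [eta]. *)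
Lemma energy_derivativeE :
  energy_derivative ux tstar (fun t => (1 + 2 * lambda) * flow_third_moment (eta t)).
Proof.
move=> t tI; rewrite energyE//; split => //.
have rs := eta_regular tI; have m00 := moment0_gt0 hdata rs.
have := time_derivative_comp (sol_eta_ode hsol tI) (is_derive_flow_energy rs).
rewrite Kbar_moment powRN.
rewrite (_ : _ * _ * _ / _ = (1 + 2 * lambda) * flow_third_moment (eta t)); last first.
  by rewrite mulrAC mulfK// gt_eqF// powR_gt0.
apply: cvg_trans; apply: near_eq_cvg.
suff : \forall v \near within [set v : R | 0 <= v] t^', 0 <= v < tstar.
  by apply: filterS => v vI; rewrite /= !energyE.
have /andP[_ tt] := tI.
have H : \forall v \near within [set v : R | 0 <= v] t^', v < tstar.
  by apply: cvg_within; apply: (@cvg_within _ (nbhs t)); exact: lt_nbhsl.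
have H' : \forall v \near within [set v : R | 0 <= v] t^', 0 <= v by exact: withinT.
by near=> v; apply/andP; split; near: v.
Unshelve. all: by end_near.
Qed.

End solution.

(** * Blow-up and boundedness *)

Section real_functions.
Variable R : realType.

Lemma bounded_half_open (f : R -> R) (b l : R) : 0 < b ->
  (forall s, 0 <= s < b -> {for s, continuous f}) -> f s @[s --> b^'-] --> l ->
  exists B : R, forall s, 0 <= s < b -> `|f s| <= B.
Proof.
move=> b0 fc fl.
have h : \forall s \near b^'-, `|f s| <= `|l| + 1.
  by move/cvg_norm/cvgr_le : fl; apply; rewrite ltrDl.
have {h} : nbhs b [set s | s < b -> `|f s| <= `|l| + 1] := h.
move=> /nbhs_ballP[r r0 Hr].
pose c := Num.max 0 (b - r / 2).
have c0 : 0 <= c by rewrite le_max lexx.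
have cb : c < b by rewrite gt_max b0 ltrBlDr ltrDl divr_gt0.
have fc' : {within `[0, c], continuous (fun s => `|f s|)}.
  apply: continuous_in_subspaceT => s /set_mem; rewrite /= in_itv/= => /andP[s0 sc].
  apply: continuous_comp; last exact: norm_continuous.
  by apply: fc; rewrite s0 (le_lt_trans sc).
have [m _ Hm] := EVT_max c0 fc'.
exists (Num.max `|f m| (`|l| + 1)) => s /andP[s0 sb].
rewrite le_max; have [sc|cs] := leP s c; apply/orP; [left|right].
  by apply: Hm; rewrite in_itv/= s0.
apply: Hr => //; rewrite /ball/= ger0_norm ?subr_ge0 ?(ltW sb)//.
have h : b - r / 2 < s by apply: le_lt_trans cs; rewrite le_max lexx orbT.
have [_ r2] := midf_lt r0; rewrite add0r in r2.
by rewrite ltrBlDr -ltrBlDl (le_lt_trans _ h)// lerD2l lerN2 ltW.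
Qed.

Lemma gt0_powR_cvgy (T : Type) (F : set_system T) (FF : Filter F) (f : T -> R) b :
  0 < b -> f t @[t --> F] --> +oo -> f t `^ b @[t --> F] --> +oo.
Proof.
move=> b0 /cvgryPge fy; apply/cvgryPge => A.
have B0 : 0 <= Num.max A 0 by rewrite le_max lexx orbT.
apply: filterS (fy (Num.max A 0 `^ b^-1)) => t h.
apply: (@le_trans _ _ (Num.max A 0)); first by rewrite le_max lexx.
rewrite -[leLHS](powRr1 B0) -(mulVf (lt0r_neq0 b0)) powRrM.
apply: ge0_ler_powR; rewrite ?nnegrE ?powR_ge0//; first exact: ltW.
by apply: le_trans h; exact: powR_ge0.
Qed.

Lemma ge0_cvg_powR (T : Type) (F : set_system T) (FF : ProperFilter F) (f : T -> R) b l :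
  0 < b -> (forall t, 0 <= f t) -> f t @[t --> F] --> l -> f t `^ b @[t --> F] --> l `^ b.
Proof.
move=> b0 f0 fl; have : 0 <= l by apply: (cvgr_to_ge fl); exact: nearW.
rewrite le_eqVlt => /predU1P[l0|l0]; last exact: cvg_powR.
by move: fl; rewrite -l0 powR0 ?gt_eqF//; exact: cvg_powR0.
Qed.

End real_functions.

Theorem theorem3p32 (R : realType) (lambda M0 m0 tstar : R)
    (u0 du0 : R -> R) (u ux gamma : R -> R -> R) (eta : R -> R)
    (hlambda : ~ (0 <= lambda <= 1 / 2))
    (hdata : admissible_data u0 du0 M0 m0)
    (hmax : 0 < lambda -> exists2 C1 : R, C1 < 0 & linear_max_profile du0 M0 C1)
    (hmin : lambda < 0 -> exists2 C2 : R, 0 < C2 & linear_min_profile du0 m0 C2)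
    (htstar : is_blowup_time lambda du0 M0 m0 tstar)
    (hsol : characteristic_solution lambda du0 u0 M0 m0 tstar u ux gamma eta) :
  [/\
      1 / 2 < lambda -> forall p : R, 1 < p ->
        Lp_norm p ux t @[t --> tstar^'-] --> +oo%E,
      lambda < 0 ->
        Lp_up_to 1 ux tstar /\
        (forall p : R, 1 < p -> 1 / (1 - p) < lambda -> Lp_up_to p ux tstar) &
      [/\ (lambda <= -1 \/ 1 / 2 < lambda ->
             energy ux t @[t --> tstar^'-] --> +oo%E),
          (-1 < lambda < 0 ->
             (forall t : R, 0 <= t < tstar -> energy ux t \is a fin_num) /\
             converges_to_finite (energy ux) tstar) &
          exists2 dE : R -> R, energy_derivative ux tstar dE &
            [/\ (lambda < - (1 / 2) \/ 1 / 2 < lambda ->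
                   dE t @[t --> tstar^'-] --> +oo),
                (lambda = - (1 / 2) ->
                   forall t : R, 0 <= t < tstar -> dE t = 0) &
                (- (1 / 2) < lambda < 0 ->
                   (exists B : R, forall t : R, 0 <= t < tstar ->
                      `|dE t| <= B) /\
                   exists l : R, dE t @[t --> tstar^'-] --> l)]]].
Proof.
have half0 : 0 < 1 / 2 :> R by rewrite divr_gt0.
have lambda0 : lambda != 0.
  by apply/eqP => l0; apply: hlambda; rewrite l0 lexx ltW.
have hprof : linear_profile (gap lambda M0 m0 du0).
  rewrite /gap; have [l0|l0] := ltP 0 lambda.
    have [C1 C10 hp] := hmax l0; exact: (max_linear_profile hdata C10 hp).
  have l0' : lambda < 0 by rewrite lt_neqAle lambda0.
  by have [C2 C20 hp] := hmin l0'; exact: (min_linear_profile hdata C20 hp).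
have [t0 _ etac] := time_change lambda0 hdata htstar hsol.
have tnear : \forall t \near tstar^'-, 0 <= t < tstar.
  near=> t; rewrite ltW; last by near: t; exact: nbhs_left_gt.
  by near: t; exact: nbhs_left_lt.
have normE := Lp_normE lambda0 hdata htstar hsol.
have enE := energyE lambda0 hdata htstar hsol.
have blowup (f : R -> R) (F : R -> \bar R) :
    (forall t, 0 <= t < tstar -> F t = (f (eta t))%:E) ->
    f s @[s --> (eta_star lambda M0 m0)^'-] --> +oo -> F t @[t --> tstar^'-] --> +oo%E.
  move=> FE H; have H' := cvg_comp _ _ etac H.
  have H2 : (f (eta t))%:E @[t --> tstar^'-] --> +oo%E by apply/cvgeryP.
  apply: cvg_trans H2; apply: near_eq_cvg.
  by apply: filterS tnear => t /FE.
have finite (f : R -> R) (F : R -> \bar R) (l : R) :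
    (forall t, 0 <= t < tstar -> F t = (f (eta t))%:E) ->
    f s @[s --> (eta_star lambda M0 m0)^'-] --> l -> converges_to_finite F tstar.
  move=> FE H; have H' := cvg_comp _ _ etac H; exists l.
  have H2 : (f (eta t))%:E @[t --> tstar^'-] --> l%:E by apply: cvg_EFin => //; exact: nearW.
  apply: cvg_trans H2; apply: near_eq_cvg.
  by apply: filterS tnear => t /FE.
have pos : 1 / 2 < lambda -> forall p, 1 <= p -> 
    gradient_moment lambda du0 p s @[s --> (eta_star lambda M0 m0)^'-] --> +oo.
  by move=> l12 p p1; exact: (gradient_moment_cvgy hdata lambda0 hprof l12 p1).
have energy_moment : \forall s \near (eta_star lambda M0 m0)^'-,
    gradient_moment lambda du0 2 s = flow_energy lambda du0 s.
  apply: filterS (near_eta_star hdata lambda0) => s /andP[s0 se].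
  by apply: (gradient_moment2 hdata); apply: (regular_itv hdata lambda0); rewrite ltW.
(* an exponent [p] with [p + 1 / lambda < 1] is admissible for the dominated
   convergence of the p-th moment *)
have integrable p : lambda < 0 -> 1 <= p -> p + lambda^-1 < 1 -> Lp_up_to p ux tstar.
  move=> l0 p1 pv; split; first by move=> t tI; exact: (slice_Lfun lambda0 hdata htstar hsol p1 tI).
  have [l H] := gradient_moment_cvg hdata lambda0 hprof l0 p1 pv.
  have p0 : 0 < p by exact: lt_le_trans p1.
  apply: (finite (fun s => gradient_moment lambda du0 p s `^ p^-1) _ (l `^ p^-1)).
    by move=> t tI; exact: normE.
  apply: ge0_cvg_powR; rewrite ?invr_gt0//.
  by move=> s; exact: gradient_moment_ge0.
split.
- move=> l12 p p1.
  apply: (blowup (fun s => gradient_moment lambda du0 p s `^ p^-1)).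
    by move=> t tI; exact: normE (ltW p1) tI.
  have p0 : 0 < p by exact: lt_trans p1.
  by apply: gt0_powR_cvgy; [rewrite invr_gt0|exact: pos l12 p (ltW p1)].
- move=> l0; split; first by apply: integrable => //; rewrite gtrDl invr_lt0.
  move=> p p1 pl; apply: integrable => //; first exact: ltW.
  have p1' : 1 - p < 0 by rewrite subr_lt0.
  by rewrite -ltrBrDl -ltf_nV2 ?negrE ?invr_lt0// invrK -div1r.
split.
- move=> H; apply: (blowup _ _ enE); case: H => [l1|l12].
    have l0 : lambda < 0 by apply: le_lt_trans l1 _; rewrite ltrN10.
    exact: (flow_energy_cvgy hdata lambda0 hprof l0 l1).
  apply: cvg_trans (pos l12 2 _); last by rewrite ler1n.
  exact: near_eq_cvg.
- move=> /andP[l1 l0]; split; first by move=> t tI; rewrite enE.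
  have pv : 2 + lambda^-1 < 1.
    rewrite -ltrBrDl [X in _ < X](_ : _ = (- 1)^-1); last by rewrite invrN1; ring.
    by rewrite ltf_nV2 ?negrE// ltrN10.
  have [l H] := gradient_moment_cvg hdata lambda0 hprof l0 (ler1n _ 2) pv.
  apply: (finite _ _ l enE); apply: cvg_trans H; exact: near_eq_cvg.
exists (fun t => (1 + 2 * lambda) * flow_third_moment lambda du0 (eta t)).
  exact: (energy_derivativeE lambda0 hdata htstar hsol).
split.
- case=> [l1|l12].
    have l0 : lambda < 0 by apply: lt_trans l1 _; rewrite oppr_lt0.
    have H := cvg_comp _ _ etac (flow_third_moment_cvgNy hdata lambda0 hprof l0 l1).
    have c0 : 0 < - (1 + 2 * lambda).
      by rewrite oppr_gt0 addrC -ltrBrDr sub0r mulrC -ltr_pdivlMr// mulNr.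
    have H' : - flow_third_moment lambda du0 (eta t) @[t --> tstar^'-] --> +oo by exact/cvgNry.
    under eq_fun do rewrite mulrC -mulrNN.
    by apply: (gt0_mulr_cvgy c0 H'); exact: cvg_cst.
  have H := cvg_comp _ _ etac (flow_third_moment_cvgy hdata lambda0 hprof l12).
  have l0 : 0 < lambda by exact: lt_trans l12.
  have c0 : 0 < 1 + 2 * lambda by rewrite addr_gt0 ?mulr_gt0.
  under eq_fun do rewrite mulrC.
  by apply: (gt0_mulr_cvgy c0 H); exact: cvg_cst.
- by move=> -> t _; rewrite mulrN mul1r mulfV ?pnatr_eq0// subrr mul0r.
- move=> /andP[l1 l0].
  have [l H] := flow_third_moment_cvg hdata lambda0 hprof l0 l1.
  have [B HB] : exists B : R, forall s, 0 <= s < eta_star lambda M0 m0 ->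
      `|(1 + 2 * lambda) * flow_third_moment lambda du0 s| <= B.
    apply: (@bounded_half_open _ _ _ ((1 + 2 * lambda) * l)).
    - exact: eta_star_gt0 hdata lambda0.
    - move=> s /(regular_itv hdata lambda0) rs.
      apply: cvgM; first exact: cvg_cst.
      exact: (continuous_flow_third_moment lambda0 hdata rs).
    - by apply: cvgM; [exact: cvg_cst|exact: H].
  split; first by exists B => t tI; apply: HB; exact: sol_eta_range hsol _ tI.
  exists ((1 + 2 * lambda) * l).
  by apply: cvgM; [exact: cvg_cst|exact: cvg_comp etac H].
Unshelve. all: by end_near.
Qed.
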